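(* The function $$F:(1,+\infty)\to\mathbb R,\qquad F(E)=\int_0^{\sqrt{2+2\sqrt E}}\frac{2-x^2}{\sqrt{E-(x^2/2-1)^2}}\,dx$$ is of class $C^1$ and admits a unique zero $E_c$ in $(1,+\infty)$. Moreover, for any choice, for each $j\in\mathbb N^*$, of $\alpha_{j,c}\in A_{j,c}$, we have $\lim_{j\to+\infty}\alpha_{j,c}=+\infty$ and $$\lim_{j\to+\infty}\frac{\lambda_j(\alpha_{j,c})}{\alpha_{j,c}^2}=E_c.$$
   Context: For $\alpha\in\mathbb R$, let $\mathfrak h_{\mathcal M}(\alpha)=-\frac{d^2}{dt^2}+\left(\frac12 t^2-\alpha\right)^2$ be the self-adjoint operator on $L^2(\mathbb R)$ with domain $\{u\in L^2(\mathbb R): -u''+(\frac12 t^2-\alpha)^2u\in L^2(\mathbb R)\}$. It has compact resolvent and simple positive eigenvalues $0<\lambda_1(\alpha)<\lambda_2(\alpha)<\cdots\to+\infty$; each $\alpha\mapsto\lambda_j(\alpha)$ is $C^\infty$. For $j\in\mathbb N^*$, $A_{j,c}=\{\alpha\in\mathbb R:\lambda_j'(\alpha)=0\}$ is the set of critical points of $\lambda_j$ (it is nonempty for every $j$). *)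

(* Defs.v *)
From Stdlib Require Import Reals Lra List ClassicalEpsilon.
From Coquelicot Require Import Coquelicot.
Open Scope R_scope.

(* Potential of the de Gennes--Montgomery operator h_M(alpha) *)
Definition VM (a t : R) : R := (t ^ 2 / 2 - a) ^ 2.

(* e is an eigenvalue of h_M(a): there is a nonzero (C^2) L^2(R) solution of
   -u'' + (t^2/2 - a)^2 u = e u.  (Eigenfunctions of h_M(a) are exactly such
   functions, by elliptic regularity.)  Square integrability is the (improper,
   nonnegative integrand) integral of u^2 over R. *)
Definition is_eigM (a e : R) : Prop :=
  exists u u' u'' : R -> R,
    (forall t, is_derive u t (u' t) /\ is_derive u' t (u'' t) /\
               - u'' t + VM a t * u t = e * u t) /\
    (exists t, u t <> 0) /\
    ex_RInt_gen (fun t => (u t) ^ 2) (Rbar_locally m_infty) (Rbar_locally p_infty).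

Definition is_jth_eig (j : nat) (a e : R) : Prop :=
  is_eigM a e /\
  exists l : list R, NoDup l /\ length l = (j - 1)%nat /\
    forall x, In x l <-> (is_eigM a x /\ x < e).

Definition lamM (j : nat) (a : R) : R :=
  epsilon (inhabits 0) (fun e => is_jth_eig j a e).

Definition A_crit (j : nat) (a : R) : Prop := is_derive (lamM j) a 0.

Definition F_integrand (E x : R) : R := (2 - x ^ 2) / sqrt (E - (x ^ 2 / 2 - 1) ^ 2).
Definition F_upper (E : R) : R := sqrt (2 + 2 * sqrt E).

(* F(E): improper integral (singular at the upper endpoint), defined for E > 1 *)
Definition F_fun (E : R) : R :=
  RInt_gen (F_integrand E) (at_point 0) (at_left (F_upper E)).

(* Main.v *)
Require Import Defs.
From Stdlib Require Import Reals Lra Lia List ClassicalEpsilon Classical Arith ZArith Ranalysis5.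
From Coquelicot Require Import Coquelicot.
Open Scope R_scope.
Set Bullet Behavior "Strict Subproofs".

(* After the rescaling t = sqrt a * x the eigenvalue equation becomes
   v'' = k (s^2 - E) v with s = x^2/2 - 1, E = lambda / a^2 and k = a^3 = 1/h^2,
   and the Hellmann-Feynman formula turns lambda'(a) = 0 into <s> = 0, averages
   being taken with respect to v^2.  Every odd multiplier phi gives the virial
   identity < 2 (E - s^2) phi' - 2 s x phi + phi''' / (2 k) > = 0.  The
   multipliers x, x s, x s^2 express <s^2>, <s^3>, <s^4> through E; since these
   are moments of a positive measure on s >= -1, E stays in [6/5, 5] for large k and
   lambda is bounded in terms of a.  As only finitely many eigenvalues lie below a given
   level, locally uniformly in a, the critical points tend to infinity, that is
   k -> oo.  Finally, if F(Es) <> 0, solving 2 (Es - s^2) phi' - 2 s x phi =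
   +-(2 - x^2) - d on the classically allowed side, and prolonging phi by a large
   constant, gives |d| = O(|E - Es| + k^(-1/2)), so that E cannot stay near Es.
   Compactness of [6/5, 5] then forces E -> Ec.

   With r = sqrt E and x = sqrt (2 + 2 r) sin y the integral F becomes regular
   and its integrand is strictly decreasing in r, whence the unique zero.  The
   existence of infinitely many eigenvalues comes from shooting with the Pruefer
   angle of the even solution: without an eigenvalue in an interval of energies,
   the quadrant in which the angle is finally trapped would be constant there. *)

(** * Linear second-order equations *)

(** [lamM] is picked by [epsilon] and [A_crit] asserts a derivative at one point only, so no smooth
    branch of eigenfunctions is at hand: even the parity of the eigenfunction might jump with the
    parameter. It is enough that one parity recurs arbitrarily close to the critical point. Nothing
    is differentiated in the parameter; a difference quotient of Wronskian identities is passed to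
    the limit, so decay bounds are uniform over bounded sets of (a, e). Parity reduces all integrals
    to the half line.

    The obstacle to semiclassical asymptotics is the turning point, where 1 / sqrt(E - s^2) blows
    up. The multiplier is cut off before it and continued by a constant a >= 1; there only a sign is
    needed, because 2 a s x dominates both 2 - x^2 and its opposite. The result is a one-sided
    estimate, which is enough for a contradiction. It needs E > 1, where F makes sense. This is why
    low energies are excluded separately: the moments leave only E = O(1 / k) below 6/5, and an
    uncertainty inequality removes that range. *)

Ltac derive_rw :=
  repeat match goal with
  | |- context [Derive ?f ?x] =>
    erewrite (is_derive_unique f x) by eassumption
  end.

Ltac derive_tac :=
  auto_derive; [repeat split; trivial; try (eexists; eassumption) | derive_rw; unfold Rminus; try ring].

Lemma mult_le_of_between (z y W N : R) :
  - W <= z <= W -> - N <= y <= N -> z * y <= N * W.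
Proof. intros Hz Hy. nra. Qed.

Lemma two_mul_between (x y : R) :
  - (x ^ 2 + y ^ 2) <= 2 * x * y <= x ^ 2 + y ^ 2.
Proof.
  assert (0 <= (x + y) ^ 2) by apply pow2_ge_0.
  assert (0 <= (x - y) ^ 2) by apply pow2_ge_0. lra.
Qed.

Lemma exp_le (x y : R) : x <= y -> exp x <= exp y.
Proof.
  intros [H| ->]; [left; now apply exp_increasing | right; trivial].
Qed.

Lemma deriv_nonpos_le (f df : R -> R) (a b : R) :
  a <= b ->
  (forall t, a <= t <= b -> is_derive f t (df t)) ->
  (forall t, a <= t <= b -> df t <= 0) -> f b <= f a.
Proof.
  intros Hab Hd Hn.
  destruct (MVT_gen f a b df) as [c [Hc Heq]].
  - rewrite Rmin_left, Rmax_right by lra. intros x Hx. apply Hd; lra.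
  - rewrite Rmin_left, Rmax_right by lra. intros x Hx.
    apply continuity_pt_filterlim, (ex_derive_continuous f).
    exists (df x). apply Hd; lra.
  - rewrite Rmin_left, Rmax_right in Hc by lra.
    specialize (Hn c Hc). nra.
Qed.

Lemma deriv_nonneg_le (f df : R -> R) (a b : R) :
  a <= b ->
  (forall t, a <= t <= b -> is_derive f t (df t)) ->
  (forall t, a <= t <= b -> 0 <= df t) -> f a <= f b.
Proof.
  intros Hab Hd Hn.
  cut (- f b <= - f a); [lra|].
  apply (deriv_nonpos_le (fun t => - f t) (fun t => - df t)); trivial.
  - intros t Ht. apply (is_derive_opp f t), Hd, Ht.
  - intros t Ht. specialize (Hn t Ht). lra.
Qed.

(** The integrating factor exp(-c t) is at most 1, so the forcing contributes at most eta t; no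
    division by c occurs and c = 0 is included. *)
Lemma gronwall (f df : R -> R) (c eta L : R) :
  0 <= c -> 0 <= eta ->
  (forall t, 0 <= t <= L -> is_derive f t (df t)) ->
  (forall t, 0 <= t <= L -> df t <= c * f t + eta) ->
  forall t, 0 <= t <= L -> f t <= (f 0 + eta * t) * exp (c * t).
Proof.
  intros Hc Heta Hd Hle t Ht.
  assert (H : f t * exp (- c * t) - eta * t <= f 0 * exp (- c * 0) - eta * 0).
  { apply (deriv_nonpos_le (fun t => f t * exp (- c * t) - eta * t)
      (fun t => (df t - c * f t) * exp (- c * t) - eta)); [lra| |].
    - intros s Hs. assert (Hs' := Hd s ltac:(lra)).
      derive_tac.
    - intros s Hs. assert (Hs' := Hle s ltac:(lra)).
      assert (exp (- c * s) <= 1).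
      { rewrite <- exp_0. apply exp_le. nra. }
      assert (0 < exp (- c * s)) by apply exp_pos. nra. }
  rewrite Rmult_0_r, exp_0 in H.
  assert (E : exp (- c * t) * exp (c * t) = 1).
  { rewrite <- exp_plus, <- exp_0. f_equal. ring. }
  assert (0 < exp (c * t)) by apply exp_pos.
  replace (f t) with ((f t * exp (- c * t)) * exp (c * t)) by (rewrite Rmult_assoc, E; ring).
  apply Rmult_le_compat_r; lra.
Qed.

Definition Sol (q u u' : R -> R) : Prop :=
  forall t, is_derive u t (u' t) /\ is_derive u' t (q t * u t).

Lemma sol_bound (q u u' : R -> R) (L M : R) :
  Sol q u u' -> 0 <= M -> (forall t, 0 <= t <= L -> Rabs (q t) <= M) ->
  forall t, 0 <= t <= L -> u t ^ 2 + u' t ^ 2 <= (u 0 ^ 2 + u' 0 ^ 2) * exp ((1 + M) * t).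
Proof.
  intros HS HM Hq t Ht.
  assert (H := gronwall (fun t => u t ^ 2 + u' t ^ 2)
    (fun t => 2 * u t * u' t * (1 + q t)) (1 + M) 0 L ltac:(lra) ltac:(lra)).
  replace (u 0 ^ 2 + u' 0 ^ 2) with (u 0 ^ 2 + u' 0 ^ 2 + 0 * t) by ring.
  apply H; trivial; clear t Ht H; intros t Ht.
  - destruct (HS t) as [H1 H2].
    derive_tac.
  - specialize (Hq t Ht). apply Rabs_le_between in Hq.
    assert (H12 := two_mul_between (u t) (u' t)).
    rewrite Rplus_0_r. apply mult_le_of_between; lra.
Qed.

(** The difference solves the equation of u with source (q - q1) v; splitting 2 y z <= y^2 + z^2
    adds one unit to the rate, hence [2 + M]. *)
Lemma sol_diff (q q1 u u' v v' : R -> R) (L M eps : R) :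
  Sol q u u' -> Sol q1 v v' -> u 0 = v 0 -> u' 0 = v' 0 -> 0 <= M ->
  (forall t, 0 <= t <= L -> Rabs (q t) <= M) ->
  (forall t, 0 <= t <= L -> Rabs (q t - q1 t) * Rabs (v t) <= eps) ->
  forall t, 0 <= t <= L -> (u t - v t) ^ 2 + (u' t - v' t) ^ 2
     <= eps ^ 2 * t * exp ((2 + M) * t).
Proof.
  intros HS HS1 E0 E1 HM Hq He t Ht.
  replace (eps ^ 2 * t) with (((u 0 - v 0) ^ 2 + (u' 0 - v' 0) ^ 2 + eps ^ 2 * t))
     by (rewrite E0, E1; ring).
  assert (H' := gronwall (fun t => (u t - v t) ^ 2 + (u' t - v' t) ^ 2)
    (fun t => 2 * (u t - v t) * (u' t - v' t) * (1 + q t)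
        + 2 * (u' t - v' t) * ((q t - q1 t) * v t)) (2 + M) (eps ^ 2) L
        ltac:(lra) ltac:(nra)).
  apply H'; trivial; clear t Ht H'; intros t Ht.
  - destruct (HS t) as [H1 H2], (HS1 t) as [H3 H4].
    derive_tac.
  - specialize (Hq t Ht). apply Rabs_le_between in Hq.
    specialize (He t Ht). rewrite <- Rabs_mult in He. apply Rabs_le_between in He.
    set (x := u t - v t). set (y := u' t - v' t). set (z := (q t - q1 t) * v t) in *.
    assert (Hxy := two_mul_between x y).
    assert (2 * x * y * (1 + q t) <= (1 + M) * (x ^ 2 + y ^ 2)).
    { apply mult_le_of_between; lra. }
    assert (2 * y * z <= y ^ 2 + z ^ 2) by (assert (0 <= (y - z) ^ 2) by apply pow2_ge_0; lra).
    assert (z ^ 2 <= eps ^ 2) by nra.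
    assert (0 <= x ^ 2) by apply pow2_ge_0. lra.
Qed.

(** * Entire solutions by power series *)

Section power_series.
Variables c0 c1 c2 A B : R.

(* [ode_state n] lists d_n, ..., d_{n+5}, where d_n is the coefficient of
   t^(n-4) of the solution of u'' = (c0 + c1 t^2 + c2 t^4) u; the shift by four
   makes the recurrence uniform. *)
Fixpoint ode_state (n : nat) : R * R * R * R * R * R :=
  match n with
  | O => (0, 0, 0, 0, A, B)
  | S m => let '(x0, x1, x2, x3, x4, x5) := ode_state m in
     (x1, x2, x3, x4, x5,
      (c0 * x4 + c1 * x2 + c2 * x0) / ((INR m + 2) * (INR m + 1)))
  end.

Definition ode_shifted_coef (n : nat) : R :=
  let '(x0, x1, x2, x3, x4, x5) := ode_state n in x0.

Lemma ode_shifted_coef_rec (n : nat) :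
  ode_shifted_coef (6 + n) =
  (c0 * ode_shifted_coef (4 + n) + c1 * ode_shifted_coef (2 + n)
   + c2 * ode_shifted_coef n) / ((INR n + 2) * (INR n + 1)).
Proof.
  unfold ode_shifted_coef; simpl.
  destruct (ode_state n) as [[[[[x0 x1] x2] x3] x4] x5]. reflexivity.
Qed.

Lemma finite_bound (e : nat -> R) (N : nat) :
  exists M, 0 <= M /\ forall k, (k < N)%nat -> e k <= M.
Proof.
  induction N as [|N [M [HM IH]]].
  - exists 0. split; [lra|]. intros k Hk. lia.
  - exists (Rmax M (e N)). split; [apply (Rle_trans _ M); [trivial | apply Rmax_l]|].
    intros k Hk. destruct (Nat.eq_dec k N) as [-> |].
    + apply Rmax_r.
    + apply (Rle_trans _ M); [apply IH; lia | apply Rmax_l].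
Qed.

(** After weighting by powers of R0, the recurrence multiplies by at most K / ((m + 2) (m + 1)),
    which is at most 1 once m >= K; a bound for the first terms then propagates. As R0 is arbitrary,
    the radius of convergence is infinite. *)
Lemma ode_shifted_coef_bound (R0 : R) : 0 < R0 ->
  exists M, forall n, Rabs (ode_shifted_coef n) * R0 ^ n <= M.
Proof.
  intros HR.
  set (e := fun n => Rabs (ode_shifted_coef n) * R0 ^ n).
  set (K := Rabs c0 * R0 ^ 2 + Rabs c1 * R0 ^ 4 + Rabs c2 * R0 ^ 6).
  assert (P2 : 0 < R0 ^ 2) by now apply pow_lt.
  assert (P4 : 0 < R0 ^ 4) by now apply pow_lt.
  assert (P6 : 0 < R0 ^ 6) by now apply pow_lt.
  assert (A0 := Rabs_pos c0). assert (A1 := Rabs_pos c1). assert (A2 := Rabs_pos c2).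
  assert (HK : 0 <= K) by (unfold K; repeat apply Rplus_le_le_0_compat; nra).
  destruct (nfloor_ex K HK) as [N [_ HN]].
  destruct (finite_bound e (N + 7)) as [M [HM Hfirst]].
  exists M. intros n.
  induction n as [n IH] using (well_founded_induction Nat.lt_wf_0).
  destruct (le_lt_dec (N + 7) n) as [Hn|Hn]; [|now apply Hfirst].
  destruct (Nat.le_exists_sub 6 n ltac:(lia)) as [m [-> _]].
  rewrite (Nat.add_comm m 6), ode_shifted_coef_rec.
  assert (Hm : K <= INR m).
  { apply Rlt_le, (Rlt_le_trans _ _ _ HN). rewrite <- S_INR. apply le_INR. lia. }
  assert (Hm0 := pos_INR m).
  assert (Hden : 0 < (INR m + 2) * (INR m + 1)) by nra.
  unfold Rdiv. rewrite Rabs_mult, (Rabs_pos_eq (/ _)) by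
    (left; now apply Rinv_0_lt_compat).
  assert (H4 := IH (4 + m)%nat ltac:(lia)).
  assert (H2 := IH (2 + m)%nat ltac:(lia)).
  assert (H0 := IH m ltac:(lia)).
  set (x4 := ode_shifted_coef (4 + m)) in *. set (x2 := ode_shifted_coef (2 + m)) in *.
  set (x0 := ode_shifted_coef m) in *.
  assert (Habs : Rabs (c0 * x4 + c1 * x2 + c2 * x0)
     <= Rabs c0 * Rabs x4 + Rabs c1 * Rabs x2 + Rabs c2 * Rabs x0).
  { rewrite <- !Rabs_mult. eapply Rle_trans; [apply Rabs_triang|].
    apply Rplus_le_compat_r, Rabs_triang. }
  apply (Rmult_le_reg_r ((INR m + 2) * (INR m + 1))); [trivial|].
  replace (_ * / _ * _ * _) with
    (Rabs (c0 * x4 + c1 * x2 + c2 * x0) * R0 ^ (6 + m)) by (field; lra).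
  assert (Pm : 0 < R0 ^ m) by now apply pow_lt.
  apply (Rle_trans _ (K * M)); [|nra].
  eapply Rle_trans.
  { apply Rmult_le_compat_r; [apply pow_le; lra | exact Habs]. }
  rewrite (pow_add _ 6 m), (pow_add _ 4 m), (pow_add _ 2 m) in *.
  unfold K.
  replace ((Rabs c0 * Rabs x4 + Rabs c1 * Rabs x2 + Rabs c2 * Rabs x0) * (R0 ^ 6 * R0 ^ m))
    with (Rabs c0 * R0 ^ 2 * (Rabs x4 * (R0 ^ 4 * R0 ^ m))
      + Rabs c1 * R0 ^ 4 * (Rabs x2 * (R0 ^ 2 * R0 ^ m))
      + Rabs c2 * R0 ^ 6 * (Rabs x0 * R0 ^ m)) by ring.
  rewrite !Rmult_plus_distr_r.
  repeat apply Rplus_le_compat; apply Rmult_le_compat_l; trivial; nra.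
Qed.

Definition ode_coef (n : nat) : R := ode_shifted_coef (4 + n).

Lemma ode_coef_radius : CV_radius ode_coef = p_infty.
Proof.
  destruct (CV_radius_bounded ode_coef) as [Hub _].
  assert (H : forall r, 0 < r -> Rbar_le r (CV_radius ode_coef)).
  { intros r Hr. apply Hub.
    destruct (ode_shifted_coef_bound r Hr) as [M HM].
    exists (M / r ^ 4). intros n.
    specialize (HM (4 + n)%nat). fold (ode_coef n) in HM.
    rewrite Rabs_mult, (Rabs_pos_eq (r ^ n)) by (apply pow_le; lra).
    assert (0 < r ^ 4) by now apply pow_lt.
    apply (Rmult_le_reg_r (r ^ 4)); [trivial|].
    unfold Rdiv. rewrite Rmult_assoc, (Rmult_assoc M), Rinv_l, Rmult_1_r by lra.
    rewrite <- pow_add, Nat.add_comm. exact HM. }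
  destruct (CV_radius ode_coef) as [x| |]; trivial.
  - specialize (H (Rmax 1 (x + 1)) ltac:(apply (Rlt_le_trans _ 1); [lra | apply Rmax_l])).
    simpl in H. assert (Hx := Rmax_r 1 (x + 1)). lra.
  - specialize (H 1 ltac:(lra)). destruct H.
Qed.

Definition ode_sol (t : R) : R := PSeries ode_coef t.
Definition ode_sol' (t : R) : R := PSeries (PS_derive ode_coef) t.

Lemma ode_sol_0 : ode_sol 0 = A /\ ode_sol' 0 = B.
Proof.
  unfold ode_sol, ode_sol'. rewrite !PSeries_0.
  unfold PS_derive, ode_coef, ode_shifted_coef. simpl. split; ring.
Qed.

Lemma ode_sol_Sol : Sol (fun t => c0 + c1 * t ^ 2 + c2 * t ^ 4) ode_sol ode_sol'.
Proof.
  assert (HR := ode_coef_radius).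
  intros t. split.
  - apply is_derive_PSeries. rewrite HR. exact I.
  - assert (E : PSeries (PS_derive (PS_derive ode_coef)) t
        = (c0 + c1 * t ^ 2 + c2 * t ^ 4) * ode_sol t).
    + rewrite (PSeries_ext _ (PS_plus (PS_scal c0 ode_coef)
        (PS_plus (PS_scal c1 (PS_incr_n ode_coef 2)) (PS_scal c2 (PS_incr_n ode_coef 4))))).
      * assert (X : forall a : nat -> R, CV_radius a = p_infty -> ex_pseries a t).
        { intros a Ha. apply CV_radius_inside. rewrite Ha. exact I. }
        assert (XI : forall n, ex_pseries (PS_incr_n ode_coef n) t).
        { intros n. apply ex_pseries_incr_n, X, HR. }
        rewrite !PSeries_plus, !PSeries_scal, !PSeries_incr_n.
        { unfold ode_sol. ring. }
        { apply ex_pseries_scal; [apply Rmult_comm | apply XI]. }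
        { apply ex_pseries_scal; [apply Rmult_comm | apply XI]. }
        { apply ex_pseries_scal; [apply Rmult_comm | apply X, HR]. }
        { apply ex_pseries_plus; apply ex_pseries_scal; try apply Rmult_comm; apply XI. }
      * intros n.
        assert (I2 : PS_incr_n ode_coef 2 n = ode_shifted_coef (2 + n)).
        { rewrite PS_incr_n_simplify. destruct (le_lt_dec 2 n) as [Hn|Hn].
          - unfold ode_coef. f_equal. lia.
          - destruct n as [|[|n]]; [| |lia]; reflexivity. }
        assert (I4 : PS_incr_n ode_coef 4 n = ode_shifted_coef n).
        { rewrite PS_incr_n_simplify. destruct (le_lt_dec 4 n) as [Hn|Hn].
          - unfold ode_coef. f_equal. lia.
          - destruct n as [|[|[|[|n]]]]; [| | | |lia]; reflexivity. }
        unfold PS_plus, PS_scal, PS_derive. rewrite I2, I4.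
        unfold ode_coef at 1. change (4 + S (S n))%nat with (6 + n)%nat.
        rewrite ode_shifted_coef_rec. unfold ode_coef.
        rewrite !S_INR. 
        assert (Hn := pos_INR n).
        unfold plus, scal; simpl. unfold mult; simpl. field. lra.
    + rewrite <- E. apply is_derive_PSeries. rewrite CV_radius_derive, HR. exact I.
Qed.

End power_series.

(** * Decay and integrals over the half line *)

Section decay.
Variables (q u u' : R -> R) (T : R).
Hypothesis HS : Sol q u u'.
Hypothesis Hq : forall t, T <= t -> 1 <= q t.
Hypothesis Hgood : forall t, T <= t -> u t * u' t <= 0.

(** Since q >= 1, u'^2 + q u^2 + 2 u u' >= (u + u')^2, so u u' exp(2 t) is nondecreasing. *)
Lemma decay_product (t : R) : T <= t ->
  - (u t * u' t) <= - (u T * u' T) * exp (- (2 * (t - T))).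
Proof.
  intros Ht.
  assert (H : u T * u' T * exp (2 * (T - T)) <= u t * u' t * exp (2 * (t - T))).
  { apply (deriv_nonneg_le (fun t => u t * u' t * exp (2 * (t - T)))
     (fun t => (u' t ^ 2 + q t * u t ^ 2 + 2 * u t * u' t) * exp (2 * (t - T)))); trivial.
    - intros s Hs. destruct (HS s). derive_tac.
    - intros s Hs. apply Rmult_le_pos; [|left; apply exp_pos].
      assert (X := two_mul_between (u s) (u' s)). assert (Y := Hq s ltac:(lra)).
      assert (Z := pow2_ge_0 (u s)). nra. }
  replace (2 * (T - T)) with 0 in H by ring. rewrite exp_0, Rmult_1_r in H.
  assert (E : exp (2 * (t - T)) * exp (- (2 * (t - T))) = 1).
  { rewrite <- exp_plus, <- exp_0. f_equal. ring. }
  assert (P := exp_pos (- (2 * (t - T)))).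
  apply (Rmult_le_compat_r _ _ _ (Rlt_le _ _ P)) in H.
  rewrite (Rmult_assoc (u t * u' t)), E in H. lra.
Qed.

(** Both u^2 and u'^2 decrease, so their sum at t + 1 is at most u'^2 + q u^2 at an intermediate
    point c, which by the mean value theorem is the increment of u u' over [t, t + 1]. *)
Lemma decay_step (t : R) : T <= t ->
  u (t + 1) ^ 2 + u' (t + 1) ^ 2 <= - (u t * u' t).
Proof.
  intros Ht.
  destruct (MVT_gen (fun t => u t * u' t) t (t + 1) (fun t => u' t ^ 2 + q t * u t ^ 2))
    as [c [Hc E]].
  - intros s _. destruct (HS s). derive_tac.
  - intros s _. apply continuity_pt_filterlim.
    apply (ex_derive_continuous (fun t => u t * u' t)).
    destruct (HS s). exists (u' s ^ 2 + q s * u s ^ 2). derive_tac.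
  - rewrite Rmin_left, Rmax_right in Hc by lra.
    assert (H1 : u (t + 1) ^ 2 <= u c ^ 2).
    { apply (deriv_nonpos_le (fun t => u t ^ 2) (fun t => 2 * (u t * u' t))); [lra| |].
      - intros s _. destruct (HS s). derive_tac.
      - intros s Hs. specialize (Hgood s ltac:(lra)). lra. }
    assert (H2 : u' (t + 1) ^ 2 <= u' c ^ 2).
    { apply (deriv_nonpos_le (fun t => u' t ^ 2) (fun t => 2 * q t * (u t * u' t))); [lra| |].
      - intros s _. destruct (HS s). derive_tac.
      - intros s Hs. specialize (Hgood s ltac:(lra)). assert (Y := Hq s ltac:(lra)). nra. }
    assert (H3 := Hgood (t + 1) ltac:(lra)).
    assert (Y := Hq c ltac:(lra)). assert (Z := pow2_ge_0 (u c)).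
    nra.
Qed.

Lemma decay_exp (t : R) : T + 1 <= t ->
  u t ^ 2 + u' t ^ 2 <= (u T ^ 2 + u' T ^ 2) * exp (- (2 * (t - 1 - T))).
Proof.
  intros Ht.
  assert (H := decay_step (t - 1) ltac:(lra)).
  replace (t - 1 + 1) with t in H by ring.
  assert (H' := decay_product (t - 1) ltac:(lra)).
  assert (X := two_mul_between (u T) (u' T)).
  assert (P := exp_pos (- (2 * (t - 1 - T)))).
  assert (Z1 := pow2_ge_0 (u T)). assert (Z2 := pow2_ge_0 (u' T)).
  nra.
Qed.

End decay.

Lemma exp_INR_mult (n : nat) (x : R) : exp (INR n * x) = exp x ^ n.
Proof.
  induction n as [|n IH]; [simpl; rewrite Rmult_0_l; apply exp_0|].
  rewrite S_INR, Rmult_plus_distr_r, exp_plus, IH, Rmult_1_l. simpl. ring.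
Qed.

Lemma pow_le_exp (n : nat) : exists C, 0 <= C /\ forall t, 0 <= t -> (1 + t) ^ n <= C * exp t.
Proof.
  destruct n as [|n].
  - exists 1. split; [lra|]. intros t Ht. simpl.
    assert (exp 0 <= exp t) by (apply exp_le; lra). rewrite exp_0 in *. lra.
  - exists (INR (S n) ^ S n). assert (Hn : 1 <= INR (S n)) by (rewrite S_INR; assert (X := pos_INR n); lra).
    split; [apply pow_le; lra|]. intros t Ht.
    replace t with (INR (S n) * (t / INR (S n))) at 2 by (field; lra).
    rewrite exp_INR_mult, <- Rpow_mult_distr.
    apply pow_incr. split; [lra|].
    assert (X := exp_ineq1_le (t / INR (S n))).
    apply (Rle_trans _ (INR (S n) * (1 + t / INR (S n)))); [|apply Rmult_le_compat_l; lra].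
    rewrite Rmult_plus_distr_l. replace (INR (S n) * (t / INR (S n))) with t by (field; lra). lra.
Qed.

(** C depends on n, T and M but not on q or on the solution: this is the domination that later
    limits in the parameters rest on. Gronwall covers [0, T + 1]; beyond, exponential decay absorbs
    any power. *)
Lemma sol_decay_uniform (n : nat) (T M : R) : 0 <= T -> 0 <= M ->
  exists C, 0 <= C /\ forall q u u', Sol q u u' ->
    (forall t, 0 <= t <= T + 1 -> Rabs (q t) <= M) ->
    (forall t, T <= t -> 1 <= q t) -> (forall t, T <= t -> u t * u' t <= 0) ->
    forall t, 0 <= t -> (u t ^ 2 + u' t ^ 2) * (1 + t) ^ n <= C * (u 0 ^ 2 + u' 0 ^ 2).
Proof.
  intros HT HM. destruct (pow_le_exp n) as [C1 [HC1 Hexp]].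
  set (G := exp ((1 + M) * (T + 1))).
  assert (HG : 0 < G) by apply exp_pos.
  assert (HE : 0 < exp (2 + 2 * T)) by apply exp_pos.
  assert (HP : 0 <= (2 + T) ^ n) by (apply pow_le; lra).
  exists (G * ((2 + T) ^ n + C1 * exp (2 + 2 * T))).
  split; [apply Rmult_le_pos; nra|].
  intros q u u' HS Hb Hq Hg t Ht.
  set (r0 := u 0 ^ 2 + u' 0 ^ 2).
  assert (Hr0 : 0 <= r0) by (unfold r0; nra).
  assert (HB : forall t, 0 <= t <= T + 1 -> u t ^ 2 + u' t ^ 2 <= r0 * G).
  { intros s Hs. eapply Rle_trans; [apply (sol_bound q u u' (T + 1) M HS HM Hb s Hs)|].
    apply Rmult_le_compat_l; trivial. apply exp_le. nra. }
  assert (Hp : 0 <= (1 + t) ^ n) by (apply pow_le; lra).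
  destruct (Rle_dec t (T + 1)) as [Hle|Hgt].
  - specialize (HB t (conj Ht Hle)).
    assert ((1 + t) ^ n <= (2 + T) ^ n) by (apply pow_incr; lra).
    apply (Rle_trans _ (r0 * G * (2 + T) ^ n)).
    + apply Rmult_le_compat; nra.
    + replace (G * _ * r0) with (r0 * G * (2 + T) ^ n + r0 * G * (C1 * exp (2 + 2 * T))) by ring.
      assert (0 <= r0 * G) by nra. assert (0 <= C1 * exp (2 + 2 * T)) by nra. nra.
  - assert (HD := decay_exp q u u' T HS Hq Hg t ltac:(lra)).
    specialize (HB T ltac:(lra)). specialize (Hexp t Ht).
    assert (E : exp (- (2 * (t - 1 - T))) * exp t <= exp (2 + 2 * T)).
    { rewrite <- exp_plus. apply exp_le. lra. }
    assert (P := exp_pos (- (2 * (t - 1 - T)))).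
    apply (Rle_trans _ (r0 * G * exp (- (2 * (t - 1 - T))) * (C1 * exp t))).
    + apply Rmult_le_compat; trivial; [nra|].
      eapply Rle_trans; [exact HD|]. apply Rmult_le_compat_r; lra.
    + apply (Rle_trans _ (r0 * G * C1 * exp (2 + 2 * T))).
      * replace (r0 * G * exp (- (2 * (t - 1 - T))) * (C1 * exp t))
          with (r0 * G * C1 * (exp (- (2 * (t - 1 - T))) * exp t)) by ring.
        apply Rmult_le_compat_l; trivial. repeat apply Rmult_le_pos; lra.
      * assert (0 <= r0 * G) by nra. assert (0 <= r0 * G * (2 + T) ^ n) by nra. lra.
Qed.

(** * Improper integrals over the half line *)

Lemma RInt_correct_R (f : R -> R) (a b : R) : ex_RInt f a b -> is_RInt f a b (RInt f a b).
Proof. exact (RInt_correct (V := R_CompleteNormedModule) f a b). Qed.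

Lemma ex_RInt_cont (f : R -> R) (a b : R) : (forall t, continuous f t) -> ex_RInt f a b.
Proof. intros Hc. apply (ex_RInt_continuous f). intros; apply Hc. Qed.

Lemma RInt_nonneg (f : R -> R) (a b : R) : (forall t, continuous f t) -> a <= b ->
  (forall t, a < t < b -> 0 <= f t) -> 0 <= RInt f a b.
Proof. intros Hc Hab Hp. apply RInt_ge_0; trivial. now apply ex_RInt_cont. Qed.

Lemma RInt_split (f : R -> R) (a b c : R) : (forall t, continuous f t) ->
  RInt f a c = RInt f a b + RInt f b c.
Proof. intros Hc. symmetry. apply (RInt_Chasles f a b c); now apply ex_RInt_cont. Qed.

Lemma RInt_split_minus (f : R -> R) (a b c : R) : (forall t, continuous f t) ->
  RInt f a c - RInt f a b = RInt f b c.
Proof. intros Hc. rewrite (RInt_split f a b c Hc). ring. Qed.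

Lemma is_derive_RInt_cont (f : R -> R) (a t : R) : (forall t, continuous f t) ->
  is_derive (fun x => RInt f a x) t (f t).
Proof.
  intros Hc. apply (is_derive_RInt f (fun x => RInt f a x) a t).
  - apply filter_forall. intros x.
    now apply RInt_correct_R, ex_RInt_cont.
  - apply Hc.
Qed.

Lemma weighted_bound_nonneg (f : R -> R) (C : R) :
  (forall t, 0 <= t -> Rabs (f t) * (1 + t) ^ 2 <= C) -> 0 <= C.
Proof.
  intros Hb. eapply Rle_trans; [|apply (Hb 0); lra].
  apply Rmult_le_pos; [apply Rabs_pos | apply pow_le; lra].
Qed.

(** Adding or subtracting C / (1 + t), whose derivative is -C / (1 + t)^2, makes the integral
    monotone in its upper end. *)
Lemma tail_bound (f : R -> R) (C a b : R) :
  (forall t, continuous f t) -> (forall t, 0 <= t -> Rabs (f t) * (1 + t) ^ 2 <= C) ->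
  0 <= a <= b -> Rabs (RInt f a b) <= C / (1 + a).
Proof.
  intros Hc Hb Hab.
  assert (HC := weighted_bound_nonneg f C Hb).
  assert (HI : forall t, is_derive (fun x => RInt f a x) t (f t)).
  { intros t. now apply is_derive_RInt_cont. }
  assert (Hf : forall t, a <= t -> Rabs (f t) <= C / (1 + t) ^ 2).
  { intros t Ht. apply Rle_div_r; [apply pow_lt; lra | apply Hb; lra]. }
  assert (H0 : RInt f a a = 0) by apply (RInt_point a f).
  assert (Hpos : 0 <= C / (1 + b)).
  { apply Rdiv_le_0_compat; lra. }
  apply Rabs_le_between. split.
  - assert (H : RInt f a a - C / (1 + a) <= RInt f a b - C / (1 + b)).
    { apply (deriv_nonneg_le (fun t => RInt f a t - C / (1 + t))
        (fun t => f t + C / (1 + t) ^ 2)); [lra| |].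
      - intros t Ht. specialize (HI t). set (F := fun x => RInt f a x) in *.
        change (is_derive (fun t0 => F t0 - C / (1 + t0)) t (f t + C / (1 + t) ^ 2)).
        derive_tac; [lra|]. field. lra.
      - intros t Ht. specialize (Hf t ltac:(lra)). apply Rabs_le_between in Hf. lra. }
    lra.
  - assert (H : RInt f a b + C / (1 + b) <= RInt f a a + C / (1 + a)).
    { apply (deriv_nonpos_le (fun t => RInt f a t + C / (1 + t))
        (fun t => f t - C / (1 + t) ^ 2)); [lra| |].
      - intros t Ht. specialize (HI t). set (F := fun x => RInt f a x) in *.
        change (is_derive (fun t0 => F t0 + C / (1 + t0)) t (f t - C / (1 + t) ^ 2)).
        derive_tac; [lra|]. field. lra.
      - intros t Ht. specialize (Hf t ltac:(lra)). apply Rabs_le_between in Hf. lra. }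
    lra.
Qed.

Lemma is_lim_ge_eventually (f : R -> R) (c l r0 : R) :
  is_lim f p_infty l -> (forall r, r0 < r -> c <= f r) -> c <= l.
Proof.
  intros Hl Hf. apply (is_lim_le_loc (fun _ => c) f p_infty c l); trivial.
  - now exists r0.
  - apply is_lim_const.
Qed.

Lemma is_lim_le_eventually (f : R -> R) (c l r0 : R) :
  is_lim f p_infty l -> (forall r, r0 < r -> f r <= c) -> l <= c.
Proof.
  intros Hl Hf. apply (is_lim_le_loc f (fun _ => c) p_infty l c); trivial.
  - now exists r0.
  - apply is_lim_const.
Qed.

(** Continuity is bundled with convergence so that every integral over a segment exists without
    further hypotheses. *)
Definition HI (f : R -> R) (l : R) : Prop :=
  (forall t, continuous f t) /\ is_lim (fun r => RInt f 0 r) p_infty l.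

Lemma HI_unique f l1 l2 : HI f l1 -> HI f l2 -> l1 = l2.
Proof.
  intros [_ H1] [_ H2]. apply is_lim_unique in H1. apply is_lim_unique in H2.
  rewrite H1 in H2. now injection H2.
Qed.

Lemma HI_ext f g l : (forall t, f t = g t) -> HI f l -> HI g l.
Proof.
  intros E [Hc Hl]. split.
  - intros t. apply (continuous_ext f); trivial.
  - apply (is_lim_ext (fun r => RInt f 0 r)); trivial.
    intros r. apply RInt_ext. intros; apply E.
Qed.

Lemma HI_plus f g l m : HI f l -> HI g m -> HI (fun t => f t + g t) (l + m).
Proof.
  intros [Hf Lf] [Hg Lg]. split.
  - intros t. apply (continuous_plus f g); trivial.
  - apply (is_lim_ext (fun r => RInt f 0 r + RInt g 0 r)).
    + intros r. symmetry. apply (RInt_plus f g); now apply ex_RInt_cont.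
    + apply (is_lim_plus _ _ _ l m); trivial. reflexivity.
Qed.

Lemma HI_scal c f l : HI f l -> HI (fun t => c * f t) (c * l).
Proof.
  intros [Hf Lf]. split.
  - intros t. apply (continuous_scal_r c f); trivial.
  - apply (is_lim_ext (fun r => c * RInt f 0 r)).
    + intros r. symmetry. apply (RInt_scal f 0 r c). now apply ex_RInt_cont.
    + apply (is_lim_scal_l (fun r => RInt f 0 r) c p_infty l Lf).
Qed.

Lemma HI_ge0 f l : (forall t, 0 <= t -> 0 <= f t) -> HI f l -> 0 <= l.
Proof.
  intros Hp [Hc Hl].
  apply (is_lim_ge_eventually _ 0 l 0 Hl).
  intros r Hr. apply RInt_nonneg; [trivial | lra |].
  intros x Hx. apply Hp. lra.
Qed.

Lemma HI_pos f l : (forall t, 0 <= t -> 0 <= f t) -> (exists t, 0 <= t /\ 0 < f t) ->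
  HI f l -> 0 < l.
Proof.
  intros Hp [t0 [Ht0 Hf0]] [Hc Hl].
  assert (H0 : 0 < RInt f 0 (t0 + 1)).
  { rewrite (RInt_split f 0 t0 (t0 + 1) Hc).
    assert (X : 0 <= RInt f 0 t0).
    { apply RInt_nonneg; trivial. intros x Hx. apply Hp; lra. }
    destruct (Hc t0 (ball (f t0) (mkposreal _ (Rdiv_lt_0_compat _ 2 Hf0 Rlt_0_2)))
      (locally_ball _ _)) as [d Hd].
    set (d' := Rmin (d / 2) 1).
    assert (Hd' : 0 < d' <= 1 /\ d' < d).
    { assert (Q := cond_pos d). unfold d'. split; [split|].
      - apply Rmin_case; lra.
      - apply Rmin_r.
      - apply (Rle_lt_trans _ (d / 2)); [apply Rmin_l | lra]. }
    rewrite (RInt_split f t0 (t0 + d') (t0 + 1) Hc).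
    assert (Y : 0 <= RInt f (t0 + d') (t0 + 1)).
    { apply RInt_nonneg; [trivial | lra |]. intros x Hx. apply Hp; lra. }
    assert (Z : d' * (f t0 / 2) <= RInt f t0 (t0 + d')).
    { replace (d' * (f t0 / 2)) with (RInt (fun _ => f t0 / 2) t0 (t0 + d')).
      2:{ rewrite (RInt_const t0 (t0 + d') (f t0 / 2)).
          change ((t0 + d' - t0) * (f t0 / 2) = d' * (f t0 / 2)). ring. }
      apply RInt_le; [lra | apply ex_RInt_const | now apply ex_RInt_cont|].
      intros x Hx. assert (B : ball t0 d x).
      { change (Rabs (x - t0) < d). rewrite Rabs_pos_eq; lra. }
      specialize (Hd x B). change (Rabs (f x - f t0) < f t0 / 2) in Hd.
      apply Rabs_lt_between in Hd. lra. }
    assert (0 < d' * (f t0 / 2)) by (apply Rmult_lt_0_compat; lra).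
    lra. }
  apply (Rlt_le_trans _ _ _ H0).
  apply (is_lim_ge_eventually _ _ l (t0 + 1) Hl). intros r Hr.
  rewrite (RInt_split f 0 (t0 + 1) r Hc).
  assert (X : 0 <= RInt f (t0 + 1) r).
  { apply RInt_nonneg; [trivial | lra |]. intros x Hx. apply Hp; lra. }
  lra.
Qed.

Lemma HI_exists (f : R -> R) (C : R) :
  (forall t, continuous f t) -> (forall t, 0 <= t -> Rabs (f t) * (1 + t) ^ 2 <= C) ->
  exists l, HI f l.
Proof.
  intros Hc Hb.
  assert (HC := weighted_bound_nonneg f C Hb).
  destruct (proj1 (filterlim_locally_cauchy (F := Rbar_locally' p_infty) (fun r => RInt f 0 r)))
    as [l Hl].
  - intros eps. assert (He := cond_pos eps).
    exists (fun r => C / eps < r). split; [now exists (C / eps)|].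
    assert (W : forall x y, C / eps < x <= y -> ball (RInt f 0 x) eps (RInt f 0 y)).
    { intros x y Hxy. assert (0 <= C / eps) by (apply Rdiv_le_0_compat; lra).
      change (Rabs (RInt f 0 y - RInt f 0 x) < eps).
      rewrite (RInt_split_minus f 0 x y Hc).
      eapply Rle_lt_trans; [apply (tail_bound f C); trivial; lra|].
      apply Rlt_div_l; [lra|]. destruct Hxy as [Hx _]. apply Rlt_div_l in Hx; [|lra]. lra. }
    intros x y Hx Hy. destruct (Rle_dec x y).
    + apply W. lra.
    + apply ball_sym, W. lra.
  - exists l. split; trivial.
Qed.

Lemma HI_tail (f : R -> R) (C l r : R) :
  (forall t, 0 <= t -> Rabs (f t) * (1 + t) ^ 2 <= C) -> HI f l -> 0 <= r ->
  Rabs (l - RInt f 0 r) <= C / (1 + r).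
Proof.
  intros Hb [Hc Hl] Hr.
  assert (X : forall y, r < y -> Rabs (RInt f 0 y - RInt f 0 r) <= C / (1 + r)).
  { intros y Hy. rewrite (RInt_split_minus f 0 r y Hc).
    apply tail_bound; trivial. lra. }
  assert (Y := is_lim_minus' _ _ _ _ _ Hl (is_lim_const (RInt f 0 r) _)).
  apply Rabs_le_between. split.
  - apply (is_lim_ge_eventually _ _ _ r Y). intros y Hy.
    specialize (X y Hy). apply Rabs_le_between in X. apply X.
  - apply (is_lim_le_eventually _ _ _ r Y). intros y Hy.
    specialize (X y Hy). apply Rabs_le_between in X. apply X.
Qed.

Lemma is_lim_0_of_bound (f : R -> R) (C : R) :
  (forall t, 0 <= t -> Rabs (f t) * (1 + t) <= C) -> is_lim f p_infty 0.
Proof.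
  intros HC. apply is_lim_spec. intros eps. assert (He := cond_pos eps).
  exists (Rmax 0 (C / eps)). intros x Hx.
  assert (R1 := Rmax_l 0 (C / eps)). assert (R2 := Rmax_r 0 (C / eps)).
  rewrite Rminus_0_r. specialize (HC x ltac:(lra)).
  assert (Hr' : C / eps < x) by lra. apply Rlt_div_l in Hr'; [|lra].
  apply (Rmult_lt_reg_r (1 + x)); [lra|]. nra.
Qed.

Lemma HI_FTC (B g : R -> R) (C : R) :
  (forall t, is_derive B t (g t)) -> (forall t, continuous g t) ->
  (forall t, 0 <= t -> Rabs (B t) * (1 + t) <= C) -> HI g (- B 0).
Proof.
  intros Hd Hc Hb. split; trivial.
  apply (is_lim_ext_loc (fun r => B r - B 0)).
  - exists 0. intros r Hr. symmetry.
    apply is_RInt_unique, (is_RInt_derive B g); intros; [apply Hd | apply Hc].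
  - replace (- B 0) with (0 - B 0) by ring.
    apply is_lim_minus'; [|apply is_lim_const].
    now apply (is_lim_0_of_bound B C).
Qed.

(* A dominated-convergence principle, in the form of a closure property. *)
Lemma HI_zero_closed (f : R -> R) (C : R) :
  (forall t, continuous f t) -> (forall t, 0 <= t -> Rabs (f t) * (1 + t) ^ 2 <= C) ->
  (forall eps r, 0 < eps -> 0 <= r -> exists g, HI g 0 /\
     (forall t, 0 <= t -> Rabs (g t) * (1 + t) ^ 2 <= C) /\
     (forall t, 0 <= t <= r -> Rabs (f t - g t) <= eps)) ->
  HI f 0.
Proof.
  intros Hc Hb Happ. destruct (HI_exists f C Hc Hb) as [l Hl].
  replace 0 with l; trivial.
  assert (HC := weighted_bound_nonneg f C Hb).
  apply cond_eq. intros eps He. rewrite Rminus_0_r.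
  (* Beyond r the tails of f and g are each below eps / 3; on [0, r] their integrals differ by at
     most eps / 4. *)
  set (r := 3 * C / eps).
  assert (Hr : 0 <= r) by (unfold r; apply Rdiv_le_0_compat; lra).
  assert (Hr2 : C / (1 + r) < eps / 3).
  { apply Rlt_div_l; [lra|]. assert (r * eps = 3 * C) by (unfold r; field; lra). nra. }
  destruct (Happ (eps / (4 * (1 + r))) r) as [g [Hg [Hgb Hfg]]]; trivial.
  { apply Rdiv_lt_0_compat; lra. }
  assert (T1 := HI_tail f C l r Hb Hl Hr).
  assert (T2 := HI_tail g C 0 r Hgb Hg Hr).
  assert (T3 : Rabs (RInt f 0 r - RInt g 0 r) <= r * (eps / (4 * (1 + r)))).
  { assert (Ef : ex_RInt f 0 r) by now apply ex_RInt_cont.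
    assert (Eg : ex_RInt g 0 r) by (apply ex_RInt_cont, Hg).
    replace (RInt f 0 r - RInt g 0 r) with (RInt (fun t => f t - g t) 0 r)
      by now apply (RInt_minus f g).
    replace r with (r - 0) at 2 by ring.
    apply (norm_RInt_le_const (fun t => f t - g t) 0 r).
    - lra.
    - intros x Hx. apply Hfg. lra.
    - now apply RInt_correct_R, (ex_RInt_minus f g). }
  assert (T4 : r * (eps / (4 * (1 + r))) <= eps / 4).
  { replace (r * (eps / (4 * (1 + r)))) with (r * eps / (4 * (1 + r))) by (field; lra).
    apply Rle_div_l; [lra|]. nra. }
  apply Rabs_le_between in T1. apply Rabs_le_between in T2. apply Rabs_le_between in T3.
  apply Rabs_lt_between. split; lra.
Qed.

Definition rapid (f : R -> R) : Prop :=
  forall n : nat, exists C, forall t, 0 <= t -> Rabs (f t) * (1 + t) ^ n <= C.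

Lemma rapid_HI f : (forall t, continuous f t) -> rapid f -> exists l, HI f l.
Proof. intros Hc Hr. destruct (Hr 2%nat) as [C HC]. now apply (HI_exists f C). Qed.

Lemma rapid_plus f g : rapid f -> rapid g -> rapid (fun t => f t + g t).
Proof.
  intros Hf Hg n. destruct (Hf n) as [C HC], (Hg n) as [D HD].
  exists (C + D). intros t Ht. specialize (HC t Ht). specialize (HD t Ht).
  assert (0 <= (1 + t) ^ n) by (apply pow_le; lra).
  assert (X := Rabs_triang (f t) (g t)). nra.
Qed.

Lemma rapid_mult (p f : R -> R) (C : R) (k : nat) :
  (forall t, 0 <= t -> Rabs (p t) <= C * (1 + t) ^ k) -> rapid f ->
  rapid (fun t => p t * f t).
Proof.
  intros Hp Hf n. destruct (Hf (k + n)%nat) as [D HD].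
  exists (C * D). intros t Ht. specialize (Hp t Ht). specialize (HD t Ht).
  assert (P1 : 0 <= (1 + t) ^ n) by (apply pow_le; lra).
  assert (P2 : 0 < (1 + t) ^ k) by (apply pow_lt; lra).
  rewrite Rabs_mult. assert (X := Rabs_pos (f t)). assert (Y := Rabs_pos (p t)).
  assert (HC : 0 <= C) by (destruct (Rle_dec 0 C); trivial; nra).
  rewrite pow_add in HD.
  apply (Rle_trans _ (C * (1 + t) ^ k * Rabs (f t) * (1 + t) ^ n)).
  - apply Rmult_le_compat_r; trivial. apply Rmult_le_compat_r; trivial.
  - replace (C * (1 + t) ^ k * Rabs (f t) * (1 + t) ^ n) with
      (C * (Rabs (f t) * ((1 + t) ^ k * (1 + t) ^ n))) by ring.
    apply Rmult_le_compat_l; trivial.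
Qed.

Lemma rapid_dom (f g : R -> R) (C : R) :
  (forall t, 0 <= t -> Rabs (f t) <= C * g t) -> rapid g -> rapid f.
Proof.
  intros Hp Hg n. destruct (Hg n) as [D HD].
  exists (Rabs C * D). intros t Ht. specialize (Hp t Ht). specialize (HD t Ht).
  assert (P1 : 0 <= (1 + t) ^ n) by (apply pow_le; lra).
  assert (Hp' : Rabs (f t) <= Rabs C * Rabs (g t)).
  { rewrite <- Rabs_mult. eapply Rle_trans; [exact Hp | apply Rle_abs]. }
  assert (X := Rabs_pos C).
  apply (Rle_trans _ (Rabs C * (Rabs (g t) * (1 + t) ^ n))); [|apply Rmult_le_compat_l; trivial].
  rewrite <- Rmult_assoc. apply Rmult_le_compat_r; trivial.
Qed.

Lemma rapid_bound1 f : rapid f -> exists C, forall t, 0 <= t -> Rabs (f t) * (1 + t) <= C.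
Proof. intros H. destruct (H 1%nat) as [C HC]. exists C. intros t Ht. specialize (HC t Ht). lra. Qed.

(** * Eigenfunctions of the operator *)

Lemma Sol_cont q u u' : Sol q u u' -> forall t, continuous u t /\ continuous u' t.
Proof.
  intros HS t. destruct (HS t) as [H1 H2]. split.
  - apply (ex_derive_continuous u). now exists (u' t).
  - apply (ex_derive_continuous u'). now exists (q t * u t).
Qed.

Lemma Sol_ext q q1 u u' : (forall t, q t = q1 t) -> Sol q u u' -> Sol q1 u u'.
Proof. intros E H t. rewrite <- E. apply H. Qed.

Lemma Sol_lin q u u' v v' c d : Sol q u u' -> Sol q v v' ->
  Sol q (fun t => c * u t + d * v t) (fun t => c * u' t + d * v' t).
Proof. intros H1 H2 t. destruct (H1 t), (H2 t). split; derive_tac. Qed.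

Lemma is_derive_reflect (f : R -> R) (t l : R) :
  is_derive f (- t) l -> is_derive (fun s => f (- s)) t (- l).
Proof. intros H. derive_tac. Qed.

Lemma Sol_reflect q u u' : (forall t, q (- t) = q t) -> Sol q u u' ->
  Sol q (fun t => u (- t)) (fun t => - u' (- t)).
Proof.
  intros E H t. destruct (H (- t)) as [H1 H2]. rewrite E in H2. split.
  - now apply is_derive_reflect.
  - replace (q t * u (- t)) with (- - (q t * u (- t))) by ring.
    apply (is_derive_opp (fun s => u' (- s))). now apply is_derive_reflect.
Qed.

Lemma bounded_on_segment (f : R -> R) (a b : R) : a <= b ->
  (forall x, a <= x <= b -> continuous f x) ->
  exists C, 0 <= C /\ forall x, a <= x <= b -> Rabs (f x) <= C.
Proof.
  intros Hab Hc.
  destruct (continuity_ab_maj (fun x => Rabs (f x)) a b Hab) as [m [Hm _]].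
  { intros c Hcab. apply (continuity_pt_comp f Rabs); [|apply Rcontinuity_abs].
    apply continuity_pt_filterlim, Hc, Hcab. }
  exists (Rabs (f m)). split; [apply Rabs_pos | exact Hm].
Qed.

Lemma Sol_zero q u u' : (forall t, continuous q t) -> (forall t, q (- t) = q t) ->
  Sol q u u' -> u 0 = 0 -> u' 0 = 0 -> forall t, u t = 0 /\ u' t = 0.
Proof.
  intros Hc He HS E0 E1.
  assert (Pos : forall u u', Sol q u u' -> u 0 = 0 -> u' 0 = 0 ->
     forall t, 0 <= t -> u t = 0 /\ u' t = 0).
  { clear u u' HS E0 E1. intros u u' HS E0 E1 t Ht.
    destruct (bounded_on_segment q 0 t Ht) as [m [Hm0 Hm]]; [intros; apply Hc|].
    assert (H := sol_bound q u u' t m HS Hm0 Hm t (conj Ht (Rle_refl t))).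
    rewrite E0, E1 in H.
    assert (Z1 := pow2_ge_0 (u t)). assert (Z2 := pow2_ge_0 (u' t)).
    replace ((0 ^ 2 + 0 ^ 2) * exp ((1 + m) * t)) with 0 in H by ring.
    split; nra. }
  intros t. destruct (Rle_dec 0 t) as [Ht|Ht]; [now apply Pos|].
  destruct (Pos _ _ (Sol_reflect q u u' He HS)) with (t := - t) as [H1 H2].
  - now rewrite Ropp_0.
  - rewrite Ropp_0, E1. ring.
  - lra.
  - rewrite Ropp_involutive in H1, H2. split; [trivial | lra].
Qed.

Lemma Sol_unique q u u' v v' : (forall t, continuous q t) -> (forall t, q (- t) = q t) ->
  Sol q u u' -> Sol q v v' -> u 0 = v 0 -> u' 0 = v' 0 ->
  forall t, u t = v t /\ u' t = v' t.
Proof.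
  intros Hc He HS HS1 E0 E1 t.
  destruct (Sol_zero q _ _ Hc He (Sol_lin q u u' v v' 1 (-1) HS HS1)) with (t := t); lra.
Qed.

Lemma product_nondecreasing q u u' s t : Sol q u u' -> s <= t ->
  (forall r, s <= r <= t -> 0 <= q r) -> u s * u' s <= u t * u' t.
Proof.
  intros HS Hst Hq.
  apply (deriv_nonneg_le (fun t => u t * u' t) (fun t => u' t ^ 2 + q t * u t ^ 2)); trivial.
  - intros r Hr. destruct (HS r). derive_tac.
  - intros r Hr. specialize (Hq r Hr). assert (Z := pow2_ge_0 (u r)).
    assert (Z' := pow2_ge_0 (u' r)). nra.
Qed.

(** Where q >= 0 the product u u' is nondecreasing, so its sign far out decides its sign from T on:
    the exact threshold in the decay condition is immaterial. *)
Lemma good_of_eventually q u u' T T1 : Sol q u u' -> (forall t, T <= t -> 0 <= q t) ->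
  (forall t, T1 <= t -> u t * u' t <= 0) -> forall t, T <= t -> u t * u' t <= 0.
Proof.
  intros HS Hq Hg t Ht.
  apply (Rle_trans _ (u (Rmax t T1) * u' (Rmax t T1))).
  - apply (product_nondecreasing q u u' _ _ HS (Rmax_l _ _)). intros r Hr. apply Hq. lra.
  - apply Hg, Rmax_r.
Qed.

Lemma continuous_sq (f : R -> R) : (forall t, continuous f t) ->
  forall t : R, continuous (fun t : R => f t ^ 2) t.
Proof.
  intros H t. apply (continuous_ext (fun t => f t * f t)); [intros; simpl; ring|].
  apply (continuous_mult f f); apply H.
Qed.

(** If u u' = p > 0 at t, it remains at least p, so u^2 grows at rate at least 2 p and its integral
    over [t, t + d] is at least p d^2. The chosen d >= 1 gives p d^2 >= p d = p + Mb, above the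
    assumed bound. *)
Lemma good_of_L2 q u u' T Mb : Sol q u u' -> 0 <= T -> (forall t, T <= t -> 1 <= q t) ->
  (forall r, 0 <= r -> RInt (fun t => u t ^ 2) 0 r <= Mb) ->
  forall t, T <= t -> u t * u' t <= 0.
Proof.
  intros HS HT Hq HM t Ht. apply Rnot_lt_le. intros Hp.
  set (p := u t * u' t) in *.
  assert (Hc := continuous_sq u (fun t => proj1 (Sol_cont q u u' HS t))).
  assert (Hw : forall r, t <= r -> 2 * p * (r - t) <= u r ^ 2).
  { intros r Hr.
    assert (H : u t ^ 2 - 2 * p * (t - t) <= u r ^ 2 - 2 * p * (r - t)).
    { apply (deriv_nonneg_le (fun r => u r ^ 2 - 2 * p * (r - t))
        (fun r => 2 * (u r * u' r) - 2 * p)); trivial.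
      - intros s Hs. destruct (HS s). derive_tac.
      - intros s Hs.
        assert (H : p <= u s * u' s); [|lra].
        apply (product_nondecreasing q u u' t s HS); [lra|].
        intros x Hx. specialize (Hq x ltac:(lra)). lra. }
    assert (Z := pow2_ge_0 (u t)). lra. }
  assert (M0 : 0 <= Mb).
  { specialize (HM 0 (Rle_refl 0)). rewrite (RInt_point 0) in HM. exact HM. }
  set (d := 1 + Mb / p). assert (Hd : 1 <= d) by
    (assert (0 <= Mb / p) by (apply Rdiv_le_0_compat; lra); unfold d; lra).
  assert (H : RInt (fun t => u t ^ 2) 0 t - p * (t - t) ^ 2 <=
     RInt (fun t => u t ^ 2) 0 (t + d) - p * (t + d - t) ^ 2).
  { apply (deriv_nonneg_le (fun r => RInt (fun t => u t ^ 2) 0 r - p * (r - t) ^ 2)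
      (fun r => u r ^ 2 - 2 * p * (r - t))); [lra| |].
    - intros s Hs. assert (D := is_derive_RInt_cont _ 0 s Hc).
      set (F := fun x => RInt (fun t0 => u t0 ^ 2) 0 x) in *.
      change (is_derive (fun r => F r - p * (r - t) ^ 2) s (u s ^ 2 - 2 * p * (s - t))).
      derive_tac.
    - intros s Hs. specialize (Hw s ltac:(lra)). lra. }
  assert (X : 0 <= RInt (fun t => u t ^ 2) 0 t).
  { apply RInt_nonneg; [trivial | lra |]. intros; apply pow2_ge_0. }
  specialize (HM (t + d) ltac:(lra)).
  assert (Y : p * d = p + Mb) by (unfold d; field; lra).
  assert (p * d <= p * d * d) by nra.
  replace (t + d - t) with d in H by ring. nra.
Qed.

Definition qM (a e t : R) : R := VM a t - e.

(** Cauchy data (1, 0) or (0, 1) at the origin fix the parity; the function exists at every energy,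
    eigenvalue or not. *)
Definition solM (b : bool) (a e : R) : R -> R :=
  ode_sol (a ^ 2 - e) (- a) (/ 4) (if b then 1 else 0) (if b then 0 else 1).
Definition solM' (b : bool) (a e : R) : R -> R :=
  ode_sol' (a ^ 2 - e) (- a) (/ 4) (if b then 1 else 0) (if b then 0 else 1).

Lemma solM_Sol b a e : Sol (qM a e) (solM b a e) (solM' b a e).
Proof.
  eapply Sol_ext; [|apply ode_sol_Sol]. intros t. unfold qM, VM. field.
Qed.

Lemma solM_0 b a e : solM b a e 0 = (if b then 1 else 0) /\ solM' b a e 0 = (if b then 0 else 1).
Proof. apply ode_sol_0. Qed.

Global Opaque solM solM'.

Lemma solM_norm_0 b a e : solM b a e 0 ^ 2 + solM' b a e 0 ^ 2 = 1.
Proof. destruct (solM_0 b a e) as [-> ->]. destruct b; ring. Qed.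

Lemma qM_cont a e t : continuous (qM a e) t.
Proof.
  apply (ex_derive_continuous (qM a e)). unfold qM, VM. auto_derive. trivial.
Qed.

Lemma qM_even a e t : qM a e (- t) = qM a e t.
Proof. unfold qM, VM. field. Qed.

(** Not the true turning point but a crude abscissa past which V - e >= 1, the margin that
    exponential decay uses. *)
Definition turning (a e : R) : R := 2 + Rabs a + Rabs e.

Lemma turning_ge0 a e : 0 <= turning a e.
Proof. unfold turning. assert (X := Rabs_pos a). assert (Y := Rabs_pos e). lra. Qed.

Lemma qM_ge1 a e t : turning a e <= t -> 1 <= qM a e t.
Proof.
  unfold turning, qM, VM. intros Ht.
  assert (X := Rabs_pos a). assert (Y := Rabs_pos e).
  assert (X' := Rle_abs a). assert (Y' := Rle_abs e).
  set (A := Rabs a) in *. set (E := Rabs e) in *.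
  assert (H : (2 + A + E) ^ 2 <= t ^ 2) by (apply pow_incr; lra).
  assert (H1 : 1 + E <= t ^ 2 / 2 - a) by nra.
  assert (H2 : (1 + E) ^ 2 <= (t ^ 2 / 2 - a) ^ 2) by (apply pow_incr; lra).
  nra.
Qed.

Lemma qM_bound A E L a e t : Rabs a <= A -> Rabs e <= E -> 0 <= t <= L ->
  Rabs (qM a e t) <= (L ^ 2 / 2 + A) ^ 2 + E.
Proof.
  intros Ha He Ht. unfold qM, VM.
  apply Rabs_le_between in Ha. apply Rabs_le_between in He.
  assert (H0 : 0 <= t ^ 2 <= L ^ 2) by (split; [apply pow_le | apply pow_incr]; lra).
  assert (H1 : (t ^ 2 / 2 - a) ^ 2 <= (L ^ 2 / 2 + A) ^ 2).
  { apply pow_maj_Rabs. apply Rabs_le_between. lra. }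
  assert (H2 := pow2_ge_0 (t ^ 2 / 2 - a)).
  assert (H3 := pow2_ge_0 (L ^ 2 / 2 + A)).
  apply Rabs_le_between. lra.
Qed.

(* [eigt b a e]: the even (b = true) or odd (b = false) solution at energy e is
   an eigenfunction; square integrability is encoded by u u' <= 0 beyond the
   turning point, a condition that is stable under pointwise limits. *)
Definition eigt (b : bool) (a e : R) : Prop :=
  forall t, turning a e <= t -> solM b a e t * solM' b a e t <= 0.

Lemma solM_decay_uniform (n : nat) (A E : R) : 0 <= A -> 0 <= E ->
  exists C, 0 <= C /\ forall b a e, Rabs a <= A -> Rabs e <= E -> eigt b a e ->
   forall t, 0 <= t -> (solM b a e t ^ 2 + solM' b a e t ^ 2) * (1 + t) ^ n <= C.
Proof.
  intros HA HE. set (T := 2 + A + E).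
  destruct (sol_decay_uniform n T (((T + 1) ^ 2 / 2 + A) ^ 2 + E)) as [C [HC H]].
  - unfold T; lra.
  - assert (Z := pow2_ge_0 ((T + 1) ^ 2 / 2 + A)). lra.
  - exists C. split; trivial. intros b a e Ha He Hg t Ht.
    assert (HT : forall s, T <= s -> turning a e <= s) by (unfold T, turning; intros; lra).
    specialize (H (qM a e) _ _ (solM_Sol b a e)). rewrite solM_norm_0, Rmult_1_r in H.
    apply H; trivial.
    + intros s Hs. now apply qM_bound.
    + intros s Hs. now apply qM_ge1, HT.
    + intros s Hs. now apply Hg, HT.
Qed.

Lemma eigt_rapid b a e : eigt b a e ->
  rapid (fun t => solM b a e t ^ 2 + solM' b a e t ^ 2).
Proof.
  intros Hg n. destruct (solM_decay_uniform n (Rabs a) (Rabs e)) as [C [_ H]]; try apply Rabs_pos.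
  exists C. intros t Ht. rewrite Rabs_pos_eq.
  - apply H; trivial; apply Rle_refl.
  - assert (X := pow2_ge_0 (solM b a e t)). assert (Y := pow2_ge_0 (solM' b a e t)). lra.
Qed.

Lemma solM_cont b a e t : continuous (solM b a e) t /\ continuous (solM' b a e) t.
Proof. apply (Sol_cont _ _ _ (solM_Sol b a e)). Qed.

Lemma solM_sq_even b a e t :
  solM b a e (- t) ^ 2 = solM b a e t ^ 2 /\ solM' b a e (- t) ^ 2 = solM' b a e t ^ 2.
Proof.
  set (c := if b then 1 else -1).
  assert (H := Sol_lin _ _ _ _ _ c 0 (Sol_reflect _ _ _ (qM_even a e) (solM_Sol b a e))
     (solM_Sol b a e)).
  destruct (Sol_unique _ _ _ _ _ (qM_cont a e) (qM_even a e) H (solM_Sol b a e)) with (t := t)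
    as [E E'].
  - cbv beta. rewrite Ropp_0. destruct (solM_0 b a e) as [-> _]. unfold c. destruct b; ring.
  - cbv beta. rewrite Ropp_0. destruct (solM_0 b a e) as [_ ->]. unfold c. destruct b; ring.
  - rewrite <- E, <- E'. unfold c. destruct b; split; ring.
Qed.

(** Gronwall run backwards: (u^2 + u'^2) exp((1 + M) s) is nondecreasing on [0, t] and equals 1 at
    the origin. *)
Lemma solM_nontrivial b a e t : 0 < solM b a e t ^ 2 + solM' b a e t ^ 2.
Proof.
  assert (P : forall t, 0 <= t -> 0 < solM b a e t ^ 2 + solM' b a e t ^ 2).
  { clear t. intros t Ht. assert (HS := solM_Sol b a e).
    set (M := (t ^ 2 / 2 + Rabs a) ^ 2 + Rabs e).
    set (u := solM b a e) in *. set (u' := solM' b a e) in *.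
    assert (H : (u 0 ^ 2 + u' 0 ^ 2) * exp ((1 + M) * 0) <= (u t ^ 2 + u' t ^ 2) * exp ((1 + M) * t)).
    { apply (deriv_nonneg_le (fun t => (u t ^ 2 + u' t ^ 2) * exp ((1 + M) * t))
        (fun t => (2 * u t * u' t * (1 + qM a e t) + (1 + M) * (u t ^ 2 + u' t ^ 2))
            * exp ((1 + M) * t))); trivial.
      - intros s Hs. destruct (HS s). derive_tac.
      - intros s Hs. apply Rmult_le_pos; [|left; apply exp_pos].
        assert (Hq := qM_bound (Rabs a) (Rabs e) t a e s (Rle_refl _) (Rle_refl _) Hs).
        fold M in Hq. apply Rabs_le_between in Hq.
        assert (X := two_mul_between (u s) (u' s)).
        assert (Y : - (2 * u s * u' s) * (1 + qM a e s) <= (1 + M) * (u s ^ 2 + u' s ^ 2)).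
        { apply mult_le_of_between; lra. }
        lra. }
    rewrite Rmult_0_r, exp_0, Rmult_1_r in H. change (u 0 ^ 2 + u' 0 ^ 2) with (solM b a e 0 ^ 2 + solM' b a e 0 ^ 2) in H.
    rewrite solM_norm_0 in H. assert (E := exp_pos ((1 + M) * t)).
    apply Rnot_le_lt. intros X. nra. }
  destruct (Rle_dec 0 t) as [Ht|Ht]; [now apply P|].
  destruct (solM_sq_even b a e t) as [<- <-]. apply P. lra.
Qed.

Lemma solM_nonzero_point b a e : exists t, 0 < t /\ solM b a e t <> 0.
Proof.
  apply NNPP. intros N.
  assert (Z : forall t, 0 < t -> solM b a e t = 0).
  { intros t Ht. apply NNPP. intros X. apply N. now exists t. }
  assert (D0 : is_derive (solM b a e) 1 0).
  { apply (is_derive_ext_loc (fun _ => 0)).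
    - exists (mkposreal 1 Rlt_0_1). intros y Hy. change (Rabs (y - 1) < 1) in Hy.
      apply Rabs_lt_between in Hy. symmetry. apply Z. lra.
    - apply (is_derive_const (V := R_NormedModule) 0). }
  destruct (solM_Sol b a e 1) as [D _]. apply is_derive_unique in D. apply is_derive_unique in D0.
  assert (X := solM_nontrivial b a e 1). rewrite <- D, D0, (Z 1) in X by lra. lra.
Qed.

Lemma continuous_linear (f : R -> R) (c : R) : (forall t, continuous f t) ->
  forall t, continuous (fun x : R => f (c * x)) t.
Proof.
  intros Hf t. apply (continuous_comp (fun x => c * x) f); [|apply Hf].
  apply (ex_derive_continuous (fun x => c * x)). auto_derive. trivial.
Qed.

Lemma continuous_reflect (f : R -> R) : (forall t, continuous f t) ->
  forall t, continuous (fun t => f (- t)) t.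
Proof.
  intros Hf t. apply (continuous_ext (fun x => f (-1 * x))); [intros x; f_equal; ring|].
  now apply continuous_linear.
Qed.

Lemma RInt_linear (f : R -> R) (c r : R) : c <> 0 -> (forall t, continuous f t) ->
  RInt (fun x => f (c * x)) 0 r = / c * RInt f 0 (c * r).
Proof.
  intros Hc Hf.
  assert (Cf := continuous_linear f c Hf).
  assert (H := RInt_comp_lin f c 0 0 r (ex_RInt_cont f _ _ Hf)).
  rewrite (RInt_ext _ (fun y => scal c (f (c * y)))) in H.
  2:{ intros x _. rewrite Rplus_0_r. reflexivity. }
  assert (H2 := RInt_scal (fun y => f (c * y)) 0 r c (ex_RInt_cont _ _ _ Cf)).
  apply (eq_trans (eq_sym H2)) in H. clear H2.
  change (c * RInt (fun y => f (c * y)) 0 r = RInt f (c * 0 + 0) (c * r + 0)) in H.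
  rewrite Rmult_0_r, !Rplus_0_r in H.
  assert (K : forall A B : R, c * A = B -> A = / c * B) by (intros A B <-; field; trivial).
  apply K, H.
Qed.

Lemma RInt_reflect (f : R -> R) (r : R) : (forall t, continuous f t) ->
  RInt (fun t => f (- t)) 0 r = RInt f (- r) 0.
Proof.
  intros Hc.
  rewrite (RInt_ext _ (fun t => f (-1 * t))) by (intros x _; f_equal; ring).
  rewrite RInt_linear by (trivial; lra). replace (-1 * r) with (- r) by ring.
  assert (E := RInt_split f 0 (- r) 0 Hc). rewrite (RInt_point 0 f) in E.
  change (0 = RInt f 0 (- r) + RInt f (- r) 0) in E.
  replace (/ -1) with (-1) by field. lra.
Qed.

Lemma L2_half_bounds (f : R -> R) :
  (forall t, continuous f t) -> (forall t, 0 <= f t) ->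
  ex_RInt_gen f (Rbar_locally m_infty) (Rbar_locally p_infty) ->
  exists Mb, (forall r, 0 <= r -> RInt f 0 r <= Mb) /\
     (forall r, 0 <= r -> RInt f (- r) 0 <= Mb).
Proof.
  intros Hc Hp [l Hl].
  (* Integrals over large segments are within 1 of l, and nonnegativity bounds every smaller segment
     by a larger one. *)
  destruct (Hl (ball l (mkposreal 1 Rlt_0_1)) (locally_ball _ _)) as [Q1 Q2 [M1 H1] [M2 H2] H].
  exists (l + 1).
  assert (HB : forall a b, a <= 0 <= b -> RInt f a b <= l + 1).
  { intros a b Hab.
    set (a' := Rmin a (M1 - 1)). set (b' := Rmax b (M2 + 1)).
    assert (A1 := Rmin_l a (M1 - 1)). assert (A2 := Rmin_r a (M1 - 1)).
    assert (B1 := Rmax_l b (M2 + 1)). assert (B2 := Rmax_r b (M2 + 1)).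
    fold a' in A1, A2. fold b' in B1, B2.
    destruct (H a' b') as [y [Hy1 Hy2]]; [apply H1; lra | apply H2; lra|].
    apply (is_RInt_unique f a' b' y) in Hy1.
    change (Rabs (y - l) < 1) in Hy2. apply Rabs_lt_between in Hy2.
    assert (E1 := RInt_split f a' a b' Hc). assert (E2 := RInt_split f a b b' Hc).
    assert (P1 : 0 <= RInt f a' a)
      by (apply RInt_nonneg; [trivial | lra | intros; apply Hp]).
    assert (P2 : 0 <= RInt f b b')
      by (apply RInt_nonneg; [trivial | lra | intros; apply Hp]).
    lra. }
  split; intros r Hr; apply HB; lra.
Qed.

Lemma scaled_product_le0 (c x y x' y' : R) : c <> 0 ->
  (c * x + 0 * y) * (c * x' + 0 * y') <= 0 -> x * x' <= 0.
Proof.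
  intros Hc H. assert (Z : 0 < c ^ 2) by now apply pow2_gt_0.
  apply Rnot_lt_le. intros P. assert (0 < c ^ 2 * (x * x')) by now apply Rmult_lt_0_compat.
  lra.
Qed.

(** If u 0 <> 0, the even part of u is a nonzero multiple of the even solution and is still square
    integrable; otherwise u itself is a nonzero multiple of the odd solution. *)
Lemma eigt_of_is_eigM a e : is_eigM a e -> eigt true a e \/ eigt false a e.
Proof.
  intros [u [u' [u'' [HS [[t0 Ht0] HL]]]]].
  assert (Su : Sol (qM a e) u u').
  { intros t. destruct (HS t) as [H1 [H2 H3]]. split; trivial.
    replace (qM a e t * u t) with (u'' t) by (unfold qM; lra). exact H2. }
  assert (Hc := fun t => proj1 (Sol_cont _ _ _ Su t)).
  destruct (L2_half_bounds _ (continuous_sq u Hc) (fun t => pow2_ge_0 (u t)) HL)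
    as [Mb [M1 M2]].
  destruct (Req_dec (u 0) 0) as [E0|N0].
  - right.
    assert (N1 : u' 0 <> 0).
    { intros E1. apply Ht0. now apply (Sol_zero _ u u' (qM_cont a e) (qM_even a e) Su). }
    assert (Hg := good_of_L2 _ _ _ _ _ Su (turning_ge0 a e) (qM_ge1 a e) M1).
    intros t Ht. specialize (Hg t Ht).
    destruct (Sol_unique _ _ _ _ _ (qM_cont a e) (qM_even a e) Su
      (Sol_lin _ _ _ _ _ (u' 0) 0 (solM_Sol false a e) (solM_Sol false a e))) with (t := t)
      as [X1 X2].
    + destruct (solM_0 false a e) as [-> _]. rewrite E0. ring.
    + destruct (solM_0 false a e) as [_ ->]. ring.
    + rewrite X1, X2 in Hg. now apply scaled_product_le0 in Hg.
  - left.
    assert (Sv := Sol_lin _ _ _ _ _ 1 1 Su (Sol_reflect _ _ _ (qM_even a e) Su)).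
    set (v := fun t => 1 * u t + 1 * u (- t)) in *.
    set (v' := fun t => 1 * u' t + 1 * - u' (- t)) in *.
    assert (Hcr := continuous_reflect u Hc).
    assert (Mv : forall r, 0 <= r -> RInt (fun t => v t ^ 2) 0 r <= 4 * Mb).
    { intros r Hr. specialize (M1 r Hr). specialize (M2 r Hr).
      rewrite <- (RInt_reflect _ r (continuous_sq u Hc)) in M2. cbv beta in M2.
      apply (Rle_trans _ (RInt (fun t => 2 * (u t ^ 2 + u (- t) ^ 2)) 0 r)).
      - apply RInt_le; trivial.
        + apply ex_RInt_cont, continuous_sq. intros t. apply (Sol_cont _ _ _ Sv t).
        + apply ex_RInt_cont. intros t.
          apply (continuous_scal_r 2 (fun t => u t ^ 2 + u (- t) ^ 2)).
          apply (continuous_plus (fun t => u t ^ 2) (fun t => u (- t) ^ 2));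
          now apply continuous_sq.
        + intros x _. unfold v.
          assert (Z := pow2_ge_0 (u x - u (- x))). nra.
      - rewrite (RInt_scal (V := R_CompleteNormedModule) (fun t => u t ^ 2 + u (- t) ^ 2)),
          (RInt_plus (V := R_CompleteNormedModule) (fun t => u t ^ 2)).
        + change (2 * (RInt (fun t => u t ^ 2) 0 r + RInt (fun t => u (- t) ^ 2) 0 r) <= 4 * Mb).
          lra.
        + now apply ex_RInt_cont, continuous_sq.
        + now apply ex_RInt_cont, (continuous_sq (fun t => u (- t))).
        + apply ex_RInt_cont. intros t.
          apply (continuous_plus (fun t => u t ^ 2) (fun t => u (- t) ^ 2));
          now apply continuous_sq. }
    assert (Hg := good_of_L2 _ _ _ _ _ Sv (turning_ge0 a e) (qM_ge1 a e) Mv).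
    intros t Ht. specialize (Hg t Ht).
    destruct (Sol_unique _ _ _ _ _ (qM_cont a e) (qM_even a e) Sv
      (Sol_lin _ _ _ _ _ (2 * u 0) 0 (solM_Sol true a e) (solM_Sol true a e))) with (t := t)
      as [X1 X2].
    + destruct (solM_0 true a e) as [-> _]. unfold v. rewrite Ropp_0. ring.
    + destruct (solM_0 true a e) as [_ ->]. unfold v'. rewrite Ropp_0. ring.
    + rewrite X1, X2 in Hg. apply scaled_product_le0 in Hg; [trivial|].
      intros Y. apply N0. lra.
Qed.

Lemma eigt_HI_sq b a e : eigt b a e -> exists l, HI (fun t => solM b a e t ^ 2) l.
Proof.
  intros Hg. apply rapid_HI.
  - apply continuous_sq. intros t. exact (proj1 (solM_cont b a e t)).
  - apply (rapid_dom _ _ 1) with (2 := eigt_rapid b a e Hg).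
    intros t _. rewrite Rabs_pos_eq by apply pow2_ge_0.
    assert (Z := pow2_ge_0 (solM' b a e t)). lra.
Qed.

Lemma is_eigM_of_eigt b a e : eigt b a e -> is_eigM a e.
Proof.
  intros Hg. assert (HS := solM_Sol b a e).
  exists (solM b a e), (solM' b a e), (fun t => qM a e t * solM b a e t).
  assert (Hc := continuous_sq (solM b a e) (fun t => proj1 (solM_cont b a e t))).
  split; [|split].
  - intros t. destruct (HS t). split; [trivial | split; [trivial|]]. unfold qM. ring.
  - destruct (solM_nonzero_point b a e) as [t [_ Ht]]. now exists t.
  - destruct (eigt_HI_sq b a e Hg) as [l [_ Hl]].
    set (f := fun t => solM b a e t ^ 2) in *.
    exists (l + l). intros P [eps HP].
    apply is_lim_spec in Hl.
    assert (He : 0 < eps / 2) by (assert (Q := cond_pos eps); lra).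
    destruct (Hl (mkposreal _ He)) as [M HM]. simpl in HM.
    exists (fun x => x < - M) (fun x => M < x).
    { now exists (- M). } { now exists M. }
    intros x y Hx Hy. exists (RInt f x y). split.
    { now apply RInt_correct_R, ex_RInt_cont. }
    apply HP. change (Rabs (RInt f x y - (l + l)) < eps).
    rewrite (RInt_split f x 0 y Hc).
    replace x with (- - x) by ring. rewrite <- (RInt_reflect f (- x) Hc).
    rewrite (RInt_ext (fun t => f (- t)) f) by (intros; apply solM_sq_even).
    assert (H1 := HM y Hy). assert (H2 := HM (- x) ltac:(lra)).
    apply Rabs_lt_between in H1. apply Rabs_lt_between in H2.
    apply Rabs_lt_between. split; lra.
Qed.

(** For e <= 0 the coefficient is nonnegative everywhere and u u' starts at 0, so u^2 never
    decreases on the half line, against its decay. *)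
Lemma eigt_pos b a e : eigt b a e -> 0 < e.
Proof.
  intros Hg. apply Rnot_le_lt. intros He.
  assert (HS := solM_Sol b a e).
  destruct (solM_nonzero_point b a e) as [t0 [Ht0 Hn]].
  destruct (eigt_rapid b a e Hg 1%nat) as [C HC].
  assert (H0 : solM b a e 0 * solM' b a e 0 = 0).
  { destruct (solM_0 b a e) as [-> ->]. destruct b; ring. }
  set (u := solM b a e) in *. set (u' := solM' b a e) in *.
  assert (Hq : forall t, 0 <= qM a e t).
  { intros t. unfold qM, VM. assert (Z := pow2_ge_0 (t ^ 2 / 2 - a)). lra. }
  assert (Hz : forall t, 0 <= t -> 0 <= u t * u' t).
  { intros t Ht. rewrite <- H0. apply (product_nondecreasing _ u u' 0 t HS Ht). intros; apply Hq. }
  assert (Hc : forall t, t0 <= t -> u t0 ^ 2 <= u t ^ 2).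
  { intros t Ht. apply (deriv_nonneg_le (fun t => u t ^ 2) (fun t => 2 * (u t * u' t))); trivial.
    - intros x _. destruct (HS x). derive_tac.
    - intros x Hx. specialize (Hz x ltac:(lra)). lra. }
  assert (P : 0 < u t0 ^ 2) by now apply pow2_gt_0.
  set (t := t0 + Rabs C / u t0 ^ 2).
  assert (Hd : 0 <= Rabs C / u t0 ^ 2) by (apply Rdiv_le_0_compat; [apply Rabs_pos | trivial]).
  specialize (HC t ltac:(unfold t; lra)). specialize (Hc t ltac:(unfold t; lra)).
  assert (Z := pow2_ge_0 (u' t)). rewrite Rabs_pos_eq in HC by lra.
  assert (X : Rabs C < u t0 ^ 2 * (1 + t) ^ 1).
  { unfold t. replace (u t0 ^ 2 * (1 + (t0 + Rabs C / u t0 ^ 2)) ^ 1) with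
      (Rabs C + u t0 ^ 2 * (1 + t0)) by (field; lra).
    assert (0 < u t0 ^ 2 * (1 + t0)) by (apply Rmult_lt_0_compat; lra). lra. }
  assert (Y : u t0 ^ 2 * (1 + t) ^ 1 <= (u t ^ 2 + u' t ^ 2) * (1 + t) ^ 1).
  { apply Rmult_le_compat_r; [apply pow_le; unfold t; lra | lra]. }
  assert (W := Rle_abs C). lra.
Qed.

Lemma continuous_mult_R (f g : R -> R) (t : R) :
  continuous f t -> continuous g t -> continuous (fun t => f t * g t) t.
Proof. intros; now apply (continuous_mult f g). Qed.

Lemma Rabs_le_of_sq (x y : R) : 0 <= y -> x ^ 2 <= y ^ 2 -> Rabs x <= y.
Proof.
  intros Hy H. rewrite <- (Rabs_pos_eq y Hy). apply Rsqr_le_abs_0. unfold Rsqr. lra.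
Qed.

Lemma solM_bound (A E L : R) : 0 <= A -> 0 <= E -> 0 <= L ->
  exists M G, 0 <= M /\ 0 < G /\ forall b a e, Rabs a <= A -> Rabs e <= E ->
    forall t, 0 <= t <= L ->
    Rabs (qM a e t) <= M /\ Rabs (solM b a e t) <= G /\ Rabs (solM' b a e t) <= G.
Proof.
  intros HA HE HL.
  set (M := (L ^ 2 / 2 + A) ^ 2 + E).
  assert (HM : 0 <= M) by (assert (Z := pow2_ge_0 (L ^ 2 / 2 + A)); unfold M; lra).
  set (G := exp ((1 + M) * L)). assert (HG : 0 < G) by apply exp_pos.
  exists M, (1 + G). split; [trivial|]. split; [lra|]. intros b a e Ha He t Ht.
  assert (Hq := fun t Ht => qM_bound A E L a e t Ha He Ht). fold M in Hq.
  split; [now apply Hq|].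
  assert (Hb := sol_bound _ _ _ L M (solM_Sol b a e) HM Hq t Ht).
  rewrite solM_norm_0, Rmult_1_l in Hb.
  assert (Ht' : exp ((1 + M) * t) <= G) by (apply exp_le; nra).
  assert (Z := pow2_ge_0 (solM' b a e t)). assert (Z' := pow2_ge_0 (solM b a e t)).
  split; apply Rabs_le_of_sq; nra.
Qed.

(** * The Hellmann-Feynman formula *)

(** Takes the place of differentiability in the parameters; what matters is that K is uniform over
    the box and over [0, L]. *)
Lemma solM_param_lipschitz (A E L : R) : 0 <= A -> 0 <= E -> 0 <= L ->
  exists K, 0 <= K /\ forall b a e a1 e1,
    Rabs a <= A -> Rabs e <= E -> Rabs a1 <= A -> Rabs e1 <= E ->
    forall t, 0 <= t <= L ->
    Rabs (solM b a e t - solM b a1 e1 t) <= K * (Rabs (a - a1) + Rabs (e - e1)) /\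
    Rabs (solM' b a e t - solM' b a1 e1 t) <= K * (Rabs (a - a1) + Rabs (e - e1)).
Proof.
  intros HA HE HL.
  destruct (solM_bound A E L HA HE HL) as [M [G [HM [HG Hbd]]]].
  set (X := L * exp ((2 + M) * L)).
  assert (HX : 0 <= X) by (apply Rmult_le_pos; [trivial | left; apply exp_pos]).
  exists ((L ^ 2 + 2 * A + 1) * G * (1 + X)).
  assert (HL2 := pow2_ge_0 L).
  split; [repeat apply Rmult_le_pos; lra|].
  intros b a e a1 e1 Ha He Ha1 He1 t Ht.
  assert (Hv := fun s Hs => proj1 (proj2 (Hbd b a1 e1 Ha1 He1 s Hs))).
  set (D := Rabs (a - a1) + Rabs (e - e1)).
  assert (D1 := Rabs_pos (a - a1)). assert (D2 := Rabs_pos (e - e1)).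
  set (eps := (L ^ 2 + 2 * A + 1) * D * G).
  assert (Heps : 0 <= eps) by (unfold eps, D; repeat apply Rmult_le_pos; lra).
  assert (Hd := sol_diff _ _ _ _ _ _ L M eps (solM_Sol b a e) (solM_Sol b a1 e1)).
  destruct (solM_0 b a e) as [I1 I2]. destruct (solM_0 b a1 e1) as [J1 J2].
  specialize (Hd ltac:(congruence) ltac:(congruence) HM
     (fun t Ht => proj1 (Hbd b a e Ha He t Ht))).
  assert (Hq : forall s, 0 <= s <= L ->
     Rabs (qM a e s - qM a1 e1 s) * Rabs (solM b a1 e1 s) <= eps).
  { intros s Hs. unfold eps.
    apply Rmult_le_compat; try apply Rabs_pos; [|now apply Hv].
    replace (qM a e s - qM a1 e1 s) with ((a - a1) * (a + a1 - s ^ 2) + - (e - e1))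
      by (unfold qM, VM; field).
    eapply Rle_trans; [apply Rabs_triang|]. rewrite Rabs_mult, Rabs_Ropp.
    assert (Hs2 : 0 <= s ^ 2 <= L ^ 2) by (split; [apply pow_le | apply pow_incr]; lra).
    assert (Y : Rabs (a + a1 - s ^ 2) <= L ^ 2 + 2 * A).
    { apply Rabs_le_between in Ha. apply Rabs_le_between in Ha1.
      apply Rabs_le_between. lra. }
    assert (Y0 := Rabs_pos (a + a1 - s ^ 2)). unfold D. nra. }
  specialize (Hd Hq t Ht).
  assert (HB : eps ^ 2 * t * exp ((2 + M) * t) <= (eps * (1 + X)) ^ 2).
  { assert (Ht' : t * exp ((2 + M) * t) <= X).
    { unfold X. apply Rmult_le_compat; try lra; [left; apply exp_pos|]. apply exp_le. nra. }
    assert (Z := pow2_ge_0 eps). rewrite Rpow_mult_distr, Rmult_assoc.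
    apply Rmult_le_compat_l; trivial. nra. }
  assert (Z1 := pow2_ge_0 (solM b a e t - solM b a1 e1 t)).
  assert (Z2 := pow2_ge_0 (solM' b a e t - solM' b a1 e1 t)).
  replace ((L ^ 2 + 2 * A + 1) * G * (1 + X) * D) with (eps * (1 + X)) by (unfold eps; ring).
  assert (0 <= eps * (1 + X)) by (apply Rmult_le_pos; lra).
  split; apply Rabs_le_of_sq; lra.
Qed.

(** The Wronskian vanishes at 0 because both solutions share their Cauchy data, and at infinity by
    decay. *)
Lemma wronskian_HI b a e a1 e1 : eigt b a e -> eigt b a1 e1 ->
  HI (fun t => solM b a e t * solM b a1 e1 t * (qM a1 e1 t - qM a e t)) 0.
Proof.
  intros H H1.
  set (B := fun t => solM b a e t * solM' b a1 e1 t - solM' b a e t * solM b a1 e1 t).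
  replace 0 with (- B 0).
  2:{ unfold B. destruct (solM_0 b a e) as [-> ->]. destruct (solM_0 b a1 e1) as [-> ->]. ring. }
  destruct (rapid_bound1 B) as [C HC].
  - apply (rapid_dom _ _ 1) with (2 := rapid_plus _ _ (eigt_rapid b a e H) (eigt_rapid b a1 e1 H1)).
    intros t _. unfold B.
    assert (X1 := two_mul_between (solM b a e t) (solM' b a1 e1 t)).
    assert (X2 := two_mul_between (solM' b a e t) (solM b a1 e1 t)).
    apply Rabs_le_between. lra.
  - apply (HI_FTC B _ C); trivial.
    + intros t. destruct (solM_Sol b a e t), (solM_Sol b a1 e1 t). unfold B. derive_tac.
    + intros t. repeat apply continuous_mult_R; try apply solM_cont.
      apply (continuous_minus (qM a1 e1) (qM a e)); apply qM_cont.
Qed.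

Section hellmann_feynman.
Variables (lam : R -> R) (a : R).
Hypothesis Heig : forall x, is_eigM x (lam x).
Hypothesis Hder : is_derive lam a 0.

(** Pigeonhole on the two parities: if each were absent from a punctured neighbourhood of a, a point
    in both neighbourhoods would contradict [Heig]. *)
Lemma frequent_type : exists b, forall d, 0 < d ->
  exists x, 0 < Rabs (x - a) < d /\ eigt b x (lam x).
Proof.
  apply NNPP. intros N.
  assert (X : forall b, exists d, 0 < d /\ forall x, 0 < Rabs (x - a) < d -> ~ eigt b x (lam x)).
  { intros b. apply NNPP. intros Nb. apply N. exists b. intros d Hd.
    apply NNPP. intros Nx. apply Nb. exists d. split; trivial.
    intros x Hx He. apply Nx. now exists x. }
  destruct (X true) as [d1 [P1 H1]], (X false) as [d2 [P2 H2]].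
  set (d := Rmin d1 d2). assert (Hd : 0 < d) by now apply Rmin_glb_lt.
  assert (L1 := Rmin_l d1 d2). assert (L2 := Rmin_r d1 d2). fold d in L1, L2.
  assert (E : Rabs (a + d / 2 - a) = d / 2).
  { replace (a + d / 2 - a) with (d / 2) by ring. apply Rabs_pos_eq. lra. }
  destruct (eigt_of_is_eigM _ _ (Heig (a + d / 2))) as [Y|Y].
  - apply (H1 (a + d / 2)); [rewrite E; lra | trivial].
  - apply (H2 (a + d / 2)); [rewrite E; lra | trivial].
Qed.

Lemma critical_slope (eta : R) : 0 < eta ->
  exists d, 0 < d /\ forall x, 0 < Rabs (x - a) < d ->
    Rabs ((lam x - lam a) / (x - a)) <= eta.
Proof.
  intros Heta. apply is_derive_Reals in Hder.
  destruct (Hder eta Heta) as [d Hd]. exists d. split; [apply cond_pos|].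
  intros x [H1 H2].
  assert (Hx : x - a <> 0) by (intros E; rewrite E, Rabs_R0 in H1; lra).
  specialize (Hd (x - a) Hx H2). replace (a + (x - a)) with x in Hd by ring.
  rewrite Rminus_0_r in Hd. lra.
Qed.

Lemma eigt_near (b : bool) : (forall d, 0 < d ->
    exists x, 0 < Rabs (x - a) < d /\ eigt b x (lam x)) ->
  forall eta, 0 < eta -> exists x, 0 < Rabs (x - a) <= eta /\
    Rabs ((lam x - lam a) / (x - a)) <= eta /\ Rabs (lam x - lam a) <= eta * Rabs (x - a) /\
    Rabs x <= Rabs a + Rabs (x - a) /\ Rabs (lam x) <= Rabs (lam a) + Rabs (lam x - lam a) /\
    eigt b x (lam x).
Proof.
  intros Hf eta Heta. destruct (critical_slope eta Heta) as [d [Hd Hs]].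
  destruct (Hf (Rmin d eta)) as [x [[H1 H2] Hx]]; [now apply Rmin_glb_lt|].
  assert (L1 := Rmin_l d eta). assert (L2 := Rmin_r d eta).
  specialize (Hs x ltac:(lra)).
  exists x. split; [lra|]. split; [trivial|]. split.
  2:{ split; [|split; [|trivial]].
      - replace x with (a + (x - a)) at 1 by ring. apply Rabs_triang.
      - replace (lam x) with (lam a + (lam x - lam a)) at 1 by ring. apply Rabs_triang. }
  assert (Hx0 : x - a <> 0) by (intros E; rewrite E, Rabs_R0 in H1; lra).
  replace (lam x - lam a) with ((lam x - lam a) / (x - a) * (x - a)) by (field; trivial).
  rewrite Rabs_mult. apply Rmult_le_compat_r; [apply Rabs_pos | trivial].
Qed.

Lemma eigt_limit (b : bool) : (forall d, 0 < d ->
    exists x, 0 < Rabs (x - a) < d /\ eigt b x (lam x)) ->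
  eigt b a (lam a).
Proof.
  intros Hf. unfold eigt.
  (* The shift by 2 puts t past the turning abscissa of every pair (x, lam x) whose coordinates are
     each within 1 of those of (a, lam a). *)
  apply (good_of_eventually (qM a (lam a)) _ _ _ (turning a (lam a) + 2) (solM_Sol b a (lam a))).
  { intros t Ht. assert (X := qM_ge1 a (lam a) t Ht). lra. }
  intros t Ht. apply Rnot_lt_le. intros Hp.
  set (p := solM b a (lam a) t * solM' b a (lam a) t) in *.
  assert (Ht0 : 0 <= t) by (assert (X := turning_ge0 a (lam a)); lra).
  set (A := Rabs a + 1). set (E := Rabs (lam a) + 1).
  assert (Aa := Rabs_pos a). assert (Al := Rabs_pos (lam a)).
  destruct (solM_param_lipschitz A E t) as [K [HK Hlip]]; [unfold A; lra | unfold E; lra | trivial|].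
  set (U := Rabs (solM b a (lam a) t) + Rabs (solM' b a (lam a) t)).
  assert (HU1 := Rabs_pos (solM b a (lam a) t)). assert (HU2 := Rabs_pos (solM' b a (lam a) t)).
  assert (HU : 0 <= U) by (unfold U; lra).
  (* When u and u' each move by at most 2 K eta, the product u u' moves by at most eta * den; eta is
     chosen to keep this at most p / 2. *)
  set (den := 2 * K * U + 4 * K ^ 2 + 1).
  assert (Hden : 1 <= den) by (unfold den; assert (0 <= K * U) by nra; nra).
  set (eta := Rmin 1 (p / (2 * den))).
  assert (Heta : 0 < eta).
  { apply Rmin_glb_lt; [lra|]. apply Rdiv_lt_0_compat; lra. }
  assert (E1 : eta <= 1) by apply Rmin_l.
  assert (E2 : eta * den <= p / 2).
  { apply (Rle_trans _ (p / (2 * den) * den)).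
    - apply Rmult_le_compat_r; [lra | apply Rmin_r].
    - right. field. lra. }
  destruct (eigt_near b Hf eta Heta) as [x [Hx [_ [Hlx [Tx [Tl Hex]]]]]].
  assert (Hlx' : Rabs (lam x - lam a) <= eta) by nra.
  specialize (Hex t ltac:(unfold turning in *; lra)).
  destruct (Hlip b a (lam a) x (lam x)) with (t := t) as [L1 L2];
    try (unfold A, E; lra).
  rewrite (Rabs_minus_sym a x), (Rabs_minus_sym (lam a)) in L1, L2.
  set (u := solM b a (lam a) t) in *. set (u' := solM' b a (lam a) t) in *.
  set (v := solM b x (lam x) t) in *. set (v' := solM' b x (lam x) t) in *.
  assert (B1 : Rabs (u - v) <= K * (2 * eta)).
  { eapply Rle_trans; [exact L1|]. apply Rmult_le_compat_l; lra. }
  assert (B2 : Rabs (u' - v') <= K * (2 * eta)).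
  { eapply Rle_trans; [exact L2|]. apply Rmult_le_compat_l; lra. }
  assert (D : Rabs (u * u' - v * v') <= eta * den).
  { replace (u * u' - v * v') with (u * (u' - v') + u' * (u - v) - (u - v) * (u' - v')) by ring.
    eapply Rle_trans; [apply Rabs_triang|]. rewrite Rabs_Ropp, Rabs_mult.
    eapply Rle_trans; [apply Rplus_le_compat_r, Rabs_triang|]. rewrite !Rabs_mult.
    assert (Q1 := Rabs_pos (u - v)). assert (Q2 := Rabs_pos (u' - v')).
    assert (S1 : Rabs u * Rabs (u' - v') <= Rabs u * (K * (2 * eta))) by now apply Rmult_le_compat_l.
    assert (S2 : Rabs u' * Rabs (u - v) <= Rabs u' * (K * (2 * eta))) by now apply Rmult_le_compat_l.
    assert (S3 : Rabs (u - v) * Rabs (u' - v') <= K * (2 * eta) * (K * (2 * eta)))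
      by now apply Rmult_le_compat.
    assert (S4 : K * (2 * eta) * (K * (2 * eta)) <= 4 * K ^ 2 * eta).
    { replace (K * (2 * eta) * (K * (2 * eta))) with (4 * K ^ 2 * eta * eta) by ring.
      assert (Z : 0 <= 4 * K ^ 2 * eta) by (assert (Z := pow2_ge_0 K); nra). nra. }
    unfold den, U. nra. }
  apply Rabs_le_between in D. fold p in D. lra.
Qed.

(** The Wronskian identity between the parameters a and x, divided by a - x, says that u_a u_x (t^2
    - a - x + D) has integral 0, D being the difference quotient of lam. Along suitable x -> a, D
    tends to 0 and u_x to u_a; [HI_zero_closed] gives the limit. *)
Lemma hellmann_feynman_critical : exists b, eigt b a (lam a) /\
  HI (fun t => solM b a (lam a) t ^ 2 * (t ^ 2 - 2 * a)) 0.
Proof.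
  destruct frequent_type as [b Hf]. exists b.
  assert (Ha := eigt_limit b Hf). split; trivial.
  set (A := Rabs a + 1). set (E := Rabs (lam a) + 1).
  assert (Aa := Rabs_pos a). assert (Al := Rabs_pos (lam a)).
  assert (HA : 1 <= A) by (unfold A; lra). assert (HE : 1 <= E) by (unfold E; lra).
  (* Power 4: two for the integrability weight (1 + t)^2 and two for the growth of t^2. *)
  destruct (solM_decay_uniform 4 A E) as [C [HC Hdec]]; try lra.
  assert (Hbound : forall b x y, Rabs x <= A -> Rabs y <= E -> eigt b x y ->
    forall t, 0 <= t -> Rabs (solM b x y t) <= 1 + C).
  { intros b' x y Hx Hy Hxy t Ht. apply Rabs_le_of_sq; [lra|].
    specialize (Hdec b' x y Hx Hy Hxy t Ht).
    assert (P : 1 <= (1 + t) ^ 4) by (apply pow_R1_Rle; lra).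
    assert (Z1 := pow2_ge_0 (solM b' x y t)). assert (Z2 := pow2_ge_0 (solM' b' x y t)). nra. }
  assert (Ea : Rabs a <= A) by (unfold A; lra). assert (El : Rabs (lam a) <= E) by (unfold E; lra).
  assert (Hprod : forall x y s t, Rabs x <= A -> Rabs y <= E -> eigt b x y -> 0 <= t ->
     Rabs s <= t ^ 2 + (2 * A + 2) ->
     Rabs (solM b a (lam a) t * solM b x y t * s) * (1 + t) ^ 2 <= 2 * C * (2 * A + 2)).
  { intros x y s t Hx Hy Hxy Ht Hs.
    assert (D1 := Hdec b a (lam a) Ea El Ha t Ht).
    assert (D2 := Hdec b x y Hx Hy Hxy t Ht).
    set (u := solM b a (lam a) t) in *. set (v := solM b x y t) in *.
    rewrite Rabs_mult.
    assert (U1 : Rabs (u * v) <= u ^ 2 + v ^ 2).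
    { assert (X := two_mul_between u v). apply Rabs_le_between. nra. }
    assert (S1 : Rabs s <= (2 * A + 2) * (1 + t) ^ 2) by nra.
    assert (Z1 := pow2_ge_0 (solM' b a (lam a) t)). assert (Z2 := pow2_ge_0 (solM' b x y t)).
    assert (P : 0 <= (1 + t) ^ 2) by apply pow2_ge_0.
    assert (P4 : 0 <= (1 + t) ^ 4) by (apply pow_le; lra).
    apply (Rle_trans _ ((u ^ 2 + v ^ 2) * ((2 * A + 2) * (1 + t) ^ 2) * (1 + t) ^ 2)).
    - apply Rmult_le_compat_r; trivial. apply Rmult_le_compat; try apply Rabs_pos; trivial.
    - replace ((u ^ 2 + v ^ 2) * ((2 * A + 2) * (1 + t) ^ 2) * (1 + t) ^ 2)
        with ((2 * A + 2) * (u ^ 2 * (1 + t) ^ 4 + v ^ 2 * (1 + t) ^ 4)) by ring.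
      assert (W1 : u ^ 2 * (1 + t) ^ 4 <= C) by nra.
      assert (W2 : v ^ 2 * (1 + t) ^ 4 <= C) by nra. nra. }
  apply (HI_zero_closed _ (2 * C * (2 * A + 2))).
  { intros t. apply (continuous_mult_R (fun t => solM b a (lam a) t ^ 2)).
    - apply continuous_sq. intros s. apply (proj1 (solM_cont b a (lam a) s)).
    - apply (ex_derive_continuous (fun t => t ^ 2 - 2 * a)). auto_derive. trivial. }
  { intros t Ht. replace (solM b a (lam a) t ^ 2) with (solM b a (lam a) t * solM b a (lam a) t) by ring.
    apply Hprod; trivial. apply Rabs_le_between in Ea. apply Rabs_le_between.
    assert (Z := pow2_ge_0 t). lra. }
  intros eps r Heps Hr.
  destruct (solM_param_lipschitz A E r) as [K [HK Hlip]]; try lra.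
  set (tot := (1 + C) * (K * 2) * (r ^ 2 + 2 * A) + 2 * (1 + C) ^ 2).
  assert (Htot : 0 < tot).
  { unfold tot. assert (0 <= (1 + C) * (K * 2) * (r ^ 2 + 2 * A)).
    { repeat apply Rmult_le_pos; try lra. assert (Z := pow2_ge_0 r). lra. }
    assert (0 < (1 + C) ^ 2) by (apply pow_lt; lra). lra. }
  set (eta := Rmin 1 (eps / tot)).
  assert (Heta : 0 < eta) by (apply Rmin_glb_lt; [lra | now apply Rdiv_lt_0_compat]).
  assert (E1 : eta <= 1) by apply Rmin_l.
  assert (E2 : tot * eta <= eps).
  { apply (Rle_trans _ (tot * (eps / tot))).
    - apply Rmult_le_compat_l; [lra | apply Rmin_r].
    - right. field. lra. }
  destruct (eigt_near b Hf eta Heta) as [x [Hx [HD [Hlx [Tx' [Tl' Hex]]]]]].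
  assert (Hx0 : x - a <> 0) by (intros X; rewrite X, Rabs_R0 in Hx; lra).
  assert (Hlx' : Rabs (lam x - lam a) <= eta) by nra.
  assert (Tx : Rabs x <= A) by (unfold A; lra).
  assert (Tl : Rabs (lam x) <= E) by (unfold E; lra).
  set (D := (lam x - lam a) / (x - a)) in *.
  exists (fun t => solM b a (lam a) t * solM b x (lam x) t * (t ^ 2 - a - x + D)).
  split; [|split].
  - assert (H := HI_scal (- / (x - a)) _ _ (wronskian_HI b a (lam a) x (lam x) Ha Hex)).
    rewrite Rmult_0_r in H. eapply HI_ext; [|exact H].
    intros t. unfold qM, VM, D. cbv beta. field. trivial.
  - intros t Ht. apply Hprod; trivial.
    apply Rabs_le_between in Ea. apply Rabs_le_between in Tx. apply Rabs_le_between in HD.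
    assert (Z := pow2_ge_0 t). apply Rabs_le_between. lra.
  - intros t Ht.
    destruct (Hlip b a (lam a) x (lam x)) with (t := t) as [L1 _]; trivial.
    rewrite (Rabs_minus_sym a x), (Rabs_minus_sym (lam a)) in L1.
    assert (U1 := Hbound b a (lam a) Ea El Ha t ltac:(lra)).
    assert (U2 := Hbound b x (lam x) Tx Tl Hex t ltac:(lra)).
    set (u := solM b a (lam a) t) in *. set (v := solM b x (lam x) t) in *.
    replace (u ^ 2 * (t ^ 2 - 2 * a) - u * v * (t ^ 2 - a - x + D))
      with (u * (u - v) * (t ^ 2 - 2 * a) + u * v * (x - a - D)) by ring.
    eapply Rle_trans; [apply Rabs_triang|]. rewrite !Rabs_mult.
    assert (B1 : Rabs (u - v) <= K * 2 * eta).
    { eapply Rle_trans; [exact L1|]. rewrite Rmult_assoc. apply Rmult_le_compat_l; lra. }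
    assert (B2 : Rabs (t ^ 2 - 2 * a) <= r ^ 2 + 2 * A).
    { apply Rabs_le_between in Ea.
      assert (Hs2 : 0 <= t ^ 2 <= r ^ 2) by (split; [apply pow_le | apply pow_incr]; lra).
      apply Rabs_le_between. lra. }
    assert (B3 : Rabs (x - a - D) <= 2 * eta).
    { eapply Rle_trans; [apply Rabs_triang|]. rewrite Rabs_Ropp. lra. }
    assert (Y1 : Rabs u * Rabs (u - v) * Rabs (t ^ 2 - 2 * a)
       <= (1 + C) * (K * 2 * eta) * (r ^ 2 + 2 * A)).
    { apply Rmult_le_compat; try apply Rabs_pos; trivial.
      - apply Rmult_le_pos; apply Rabs_pos.
      - apply Rmult_le_compat; try apply Rabs_pos; trivial. }
    assert (Y2 : Rabs u * Rabs v * Rabs (x - a - D) <= (1 + C) * (1 + C) * (2 * eta)).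
    { apply Rmult_le_compat; try apply Rabs_pos; trivial.
      - apply Rmult_le_pos; apply Rabs_pos.
      - apply Rmult_le_compat; try apply Rabs_pos; trivial. }
    apply (Rle_trans _ (tot * eta)); [|trivial]. unfold tot. lra.
Qed.

End hellmann_feynman.

(** * Separation of eigenvalues *)

Lemma HI_ge_RInt (f : R -> R) (l r : R) : (forall t, 0 <= t -> 0 <= f t) -> HI f l ->
  0 <= r -> RInt f 0 r <= l.
Proof.
  intros Hp [Hc Hl] Hr. apply (is_lim_ge_eventually _ _ l r Hl). intros y Hy.
  rewrite (RInt_split f 0 r y Hc).
  assert (0 <= RInt f r y); [|lra].
  apply RInt_nonneg; [trivial | lra |]. intros; apply Hp; lra.
Qed.

(** The Cauchy data alone give mass on the short interval [tau / 2, tau]: the even solution is still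
    at least 1/2 there, and the odd one has had slope at least 1/2 since the origin. *)
Lemma solM_sq_lower (A E : R) : 0 <= A -> 0 <= E -> exists k, 0 < k /\
  forall b a e l, Rabs a <= A -> Rabs e <= E ->
    HI (fun t => solM b a e t ^ 2) l -> k <= l.
Proof.
  intros HA HE.
  destruct (solM_bound A E 1 HA HE Rle_0_1) as [M [G [HM [HG Hbd]]]].
  set (tau := / (2 * (1 + M) * (1 + G))).
  assert (Hden : 2 < 2 * (1 + M) * (1 + G)) by nra.
  assert (Ht1 : 0 < tau) by (apply Rinv_0_lt_compat; lra).
  assert (Ht2 : tau <= / 2).
  { apply Rinv_le_contravar; lra. }
  assert (Hte : tau * ((1 + M) * (1 + G)) = / 2) by (unfold tau; field; lra).
  exists (tau / 2 * (tau / 4) ^ 2). split.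
  { apply Rmult_lt_0_compat; [lra | apply pow_lt; lra]. }
  intros b a e l Ha He Hl.
  assert (HS := solM_Sol b a e). destruct (solM_0 b a e) as [I1 I2].
  assert (Hb := fun s Hs => Hbd b a e Ha He s Hs).
  assert (Hlow : forall t, tau / 2 <= t <= tau -> tau / 4 <= solM b a e t).
  { intros t Ht. destruct b.
    - assert (H : solM true a e 0 + (1 + G) * 0 <= solM true a e t + (1 + G) * t).
      { apply (deriv_nonneg_le (fun t => solM true a e t + (1 + G) * t)
           (fun t => solM' true a e t + (1 + G))); [lra| |].
        - intros s Hs. destruct (HS s). derive_tac.
        - intros s Hs. destruct (Hb s) as [_ [_ X]]; [lra|]. apply Rabs_le_between in X. lra. }
      rewrite I1 in H. assert ((1 + G) * t <= tau * ((1 + M) * (1 + G))) by nra. lra.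
    - assert (Hu' : forall t, 0 <= t <= tau -> / 2 <= solM' false a e t).
      { intros x Hx.
        assert (H : solM' false a e 0 + M * (1 + G) * 0 <= solM' false a e x + M * (1 + G) * x).
        { apply (deriv_nonneg_le (fun t => solM' false a e t + M * (1 + G) * t)
             (fun t => qM a e t * solM false a e t + M * (1 + G))); [lra| |].
          - intros s Hs. destruct (HS s). derive_tac.
          - intros s Hs. destruct (Hb s) as [Y [X _]]; [lra|].
            apply (Rle_trans _ _ (1 + G)) in X; [|lra].
            assert (W : Rabs (qM a e s * solM false a e s) <= M * (1 + G)).
            { rewrite Rabs_mult. apply Rmult_le_compat; trivial; apply Rabs_pos. }
            apply Rabs_le_between in W. lra. }
        rewrite I2 in H. assert (M * (1 + G) * x <= tau * ((1 + M) * (1 + G))) by nra. lra. }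
      assert (H : solM false a e 0 - / 2 * 0 <= solM false a e t - / 2 * t).
      { apply (deriv_nonneg_le (fun t => solM false a e t - / 2 * t)
           (fun t => solM' false a e t - / 2)); [lra| |].
        - intros s Hs. destruct (HS s). derive_tac.
        - intros s Hs. specialize (Hu' s ltac:(lra)). lra. }
      rewrite I1 in H. lra. }
  assert (Hc := continuous_sq (solM b a e) (fun t => proj1 (solM_cont b a e t))).
  apply (Rle_trans _ (RInt (fun t => solM b a e t ^ 2) 0 tau)).
  2:{ apply HI_ge_RInt; trivial; [intros; apply pow2_ge_0 | lra]. }
  rewrite (RInt_split _ 0 (tau / 2) tau Hc).
  assert (X : 0 <= RInt (fun t => solM b a e t ^ 2) 0 (tau / 2)).
  { apply RInt_nonneg; [trivial | lra | intros; apply pow2_ge_0]. }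
  assert (Y : RInt (fun _ => (tau / 4) ^ 2) (tau / 2) tau <=
     RInt (fun t => solM b a e t ^ 2) (tau / 2) tau).
  { apply RInt_le; [lra | apply ex_RInt_const | now apply ex_RInt_cont|].
    intros x Hx. apply pow_incr. specialize (Hlow x ltac:(lra)). lra. }
  rewrite (RInt_const (tau / 2) tau ((tau / 4) ^ 2)) in Y.
  change ((tau - tau / 2) * (tau / 4) ^ 2 <= RInt (fun t => solM b a e t ^ 2) (tau / 2) tau) in Y.
  lra.
Qed.

(** Eigenfunctions u, v of one parity at distinct energies are orthogonal, so (u - v)^2 has integral
    at least 2 k. Equal Cauchy data make u - v small on compact sets when the energies are close,
    and uniform decay makes its tail small. *)
Lemma eigenvalue_gap (A E : R) : 0 <= A -> 0 <= E -> exists d, 0 < d /\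
  forall b a e e1, Rabs a <= A -> Rabs e <= E -> Rabs e1 <= E ->
    eigt b a e -> eigt b a e1 -> e <> e1 -> d <= Rabs (e - e1).
Proof.
  intros HA HE.
  destruct (solM_sq_lower A E HA HE) as [k [Hk Hlow]].
  destruct (solM_decay_uniform 2 A E HA HE) as [C [HC Hdec]].
  (* The tail of (u - v)^2 beyond r is at most 4 C / (1 + r) <= k, which leaves at least k on
     [0, r]. *)
  set (r := 4 * C / k).
  assert (Hr : 0 <= r) by (unfold r; apply Rdiv_le_0_compat; lra).
  destruct (solM_param_lipschitz A E r HA HE Hr) as [K [HK Hlip]].
  set (den := r * K ^ 2 + 1).
  assert (Hden : 1 <= den) by (unfold den; assert (Z := pow2_ge_0 K); nra).
  exists (Rmin 1 (k / den)). split.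
  { apply Rmin_glb_lt; [lra | apply Rdiv_lt_0_compat; lra]. }
  intros b a e e1 Ha He He1 Hg Hg1 Hne. apply Rnot_lt_le. intros Hlt.
  assert (L1 : Rabs (e - e1) < 1) by (eapply Rlt_le_trans; [exact Hlt | apply Rmin_l]).
  assert (L2 : Rabs (e - e1) < k / den) by (eapply Rlt_le_trans; [exact Hlt | apply Rmin_r]).
  apply Rlt_div_r in L2; [|lra].
  set (u := solM b a e) in *. set (v := solM b a e1) in *.
  destruct (eigt_HI_sq b a e Hg) as [l1 H1]. destruct (eigt_HI_sq b a e1 Hg1) as [l2 H2].
  assert (K1 := Hlow b a e l1 Ha He H1). assert (K2 := Hlow b a e1 l2 Ha He1 H2).
  fold u in H1. fold v in H2.
  assert (Hd : HI (fun t => (u t - v t) ^ 2) (l1 + l2)).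
  { assert (W := HI_scal (-2 / (e - e1)) _ _ (wronskian_HI b a e a e1 Hg Hg1)).
    assert (X := HI_plus _ _ _ _ (HI_plus _ _ _ _ H1 H2) W).
    rewrite Rmult_0_r, Rplus_0_r in X. eapply HI_ext; [|exact X].
    intros t. cbv beta. fold u v. unfold qM. field. lra. }
  assert (Hdb : forall t, 0 <= t -> Rabs ((u t - v t) ^ 2) * (1 + t) ^ 2 <= 4 * C).
  { intros t Ht. rewrite Rabs_pos_eq by apply pow2_ge_0.
    assert (D1 := Hdec b a e Ha He Hg t Ht). assert (D2 := Hdec b a e1 Ha He1 Hg1 t Ht).
    fold u in D1. fold v in D2.
    assert (P := pow2_ge_0 (1 + t)).
    assert (Z1 := pow2_ge_0 (solM' b a e t)). assert (Z2 := pow2_ge_0 (solM' b a e1 t)).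
    assert (Z : (u t - v t) ^ 2 <= 2 * (u t ^ 2 + v t ^ 2))
      by (assert (X := pow2_ge_0 (u t + v t)); lra).
    assert (W1 : u t ^ 2 * (1 + t) ^ 2 <= C) by nra.
    assert (W2 : v t ^ 2 * (1 + t) ^ 2 <= C) by nra. nra. }
  assert (T := HI_tail _ (4 * C) (l1 + l2) r Hdb Hd Hr).
  assert (T2 : 4 * C / (1 + r) <= k).
  { apply Rle_div_l; [lra|]. assert (r * k = 4 * C) by (unfold r; field; lra). lra. }
  assert (Hc := proj1 Hd).
  assert (T3 : RInt (fun t => (u t - v t) ^ 2) 0 r <= r * (K ^ 2 * Rabs (e - e1))).
  { apply (Rle_trans _ (RInt (fun _ => K ^ 2 * Rabs (e - e1)) 0 r)).
    - apply RInt_le; [lra | now apply ex_RInt_cont | apply ex_RInt_const|].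
      intros x Hx. destruct (Hlip b a e a e1) with (t := x) as [L _]; trivial; [lra|].
      fold u v in L. replace (a - a) with 0 in L by ring. rewrite Rabs_R0, Rplus_0_l in L.
      assert (P := Rabs_pos (e - e1)).
      rewrite <- pow2_abs. apply (Rle_trans _ ((K * Rabs (e - e1)) ^ 2)).
      + apply pow_incr. split; [apply Rabs_pos | trivial].
      + rewrite Rpow_mult_distr. apply Rmult_le_compat_l; [apply pow2_ge_0|]. nra.
    - rewrite (RInt_const 0 r (K ^ 2 * Rabs (e - e1))). right.
      change ((r - 0) * (K ^ 2 * Rabs (e - e1)) = r * (K ^ 2 * Rabs (e - e1))). ring. }
  apply Rabs_le_between in T. assert (P := Rabs_pos (e - e1)). unfold den in L2. nra.
Qed.

(** An eigenvalue is coded by its cell of width d and a bit telling whether the even solution is an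
    eigenfunction. Equal codes mean a common parity and distance below d, hence equality, so the
    number of codes bounds the number of eigenvalues. *)
Lemma eigenvalue_count_bound (A E : R) : 0 <= A -> 0 <= E -> exists N : nat,
  forall a l, Rabs a <= A -> NoDup l -> (forall x, In x l -> is_eigM a x /\ x <= E) ->
  (length l <= N)%nat.
Proof.
  intros HA HE. destruct (eigenvalue_gap A E HA HE) as [d [Hd Hgap]].
  set (fl := fun x => Z.to_nat (Int_part (x / d))).
  exists (2 * (fl E + 1))%nat. intros a l Ha Hl Hin.
  set (g := fun x => (2 * fl x + (if excluded_middle_informative (eigt true a x) then 1 else 0))%nat).
  assert (Hpos : forall x, In x l -> 0 < x <= E).
  { intros x Hx. destruct (Hin x Hx) as [Hx1 Hx2]. split; trivial.
    destruct (eigt_of_is_eigM a x Hx1) as [Y|Y]; exact (eigt_pos _ _ _ Y). }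
  assert (Hfl : forall x, 0 <= x -> INR (fl x) <= x / d < INR (fl x) + 1).
  { intros x Hx. assert (Hxd : 0 <= x / d) by (apply Rdiv_le_0_compat; lra).
    destruct (base_Int_part (x / d)) as [B1 B2].
    assert (Z0 : (0 <= Int_part (x / d))%Z).
    { apply Z.lt_succ_r, lt_IZR. rewrite succ_IZR. lra. }
    unfold fl. rewrite INR_IZR_INZ, Z2Nat.id by trivial. lra. }
  rewrite <- (length_map g l), <- (length_seq (2 * (fl E + 1)) 0).
  apply NoDup_incl_length.
  - apply NoDup_map_NoDup_ForallPairs; trivial.
    intros x y Hx Hy Hxy. apply NNPP. intros Hne.
    assert (Px := Hpos x Hx). assert (Py := Hpos y Hy).
    assert (Ex : Rabs x <= E) by (rewrite Rabs_pos_eq; lra).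
    assert (Ey : Rabs y <= E) by (rewrite Rabs_pos_eq; lra).
    destruct (eigt_of_is_eigM a x (proj1 (Hin x Hx))) as [Tx|Tx];
    destruct (eigt_of_is_eigM a y (proj1 (Hin y Hy))) as [Ty|Ty]; unfold g in Hxy.
    all: destruct (excluded_middle_informative (eigt true a x)) as [Ux|Ux];
      destruct (excluded_middle_informative (eigt true a y)) as [Uy|Uy]; try contradiction; try lia.
    all: assert (Efl : fl x = fl y) by lia.
    all: assert (Fx := Hfl x ltac:(lra)); assert (Fy := Hfl y ltac:(lra)); rewrite Efl in Fx.
    all: assert (Hlt : Rabs (x - y) < d)
      by (apply Rabs_lt_between; replace (x - y) with ((x / d - y / d) * d) by (field; lra); nra).
    all: apply (Rlt_not_le _ _ Hlt).
    all: first [now apply (Hgap true a x y) | now apply (Hgap false a x y)].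
  - intros n Hn. apply in_map_iff in Hn. destruct Hn as [x [<- Hx]].
    assert (Px := Hpos x Hx). apply in_seq.
    assert (F : (fl x <= fl E)%nat).
    { apply Nat.lt_succ_r, INR_lt. rewrite S_INR.
      assert (Fx := Hfl x ltac:(lra)). assert (FE := Hfl E HE).
      assert (x / d <= E / d) by (apply Rmult_le_compat_r; [left; now apply Rinv_0_lt_compat | lra]).
      lra. }
    unfold g. destruct (excluded_middle_informative (eigt true a x)); lia.
Qed.

(** * The Pruefer angle *)

(** Before a first violation at t1, take the last point m with f >= c. There f = c with positive
    derivative, so f exceeds c just after m, a contradiction. *)
Lemma lower_barrier (f df : R -> R) (c t0 : R) :
  (forall t, t0 <= t -> is_derive f t (df t)) ->
  (forall t, t0 <= t -> f t = c -> 0 < df t) -> c <= f t0 ->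
  forall t, t0 <= t -> c <= f t.
Proof.
  intros Hd Hb H0 t1 Ht1. apply Rnot_lt_le. intros Hlt.
  set (S := fun s => t0 <= s <= t1 /\ c <= f s).
  assert (Hc : forall s, t0 <= s -> forall eps, 0 < eps ->
      exists d, 0 < d /\ forall y, Rabs (y - s) < d -> Rabs (f y - f s) < eps).
  { intros s Hs eps Heps.
    assert (C : continuous f s) by (apply (ex_derive_continuous f); exists (df s); now apply Hd).
    destruct (C (ball (f s) (mkposreal eps Heps)) (locally_ball _ _)) as [d Hd'].
    exists d. split; [apply cond_pos | exact Hd']. }
  destruct (completeness S) as [m [Hub Hlub]].
  { exists t1. intros s [Hs _]. lra. }
  { exists t0. split; lra. }
  assert (Hm0 : t0 <= m) by (apply Hub; split; lra).
  assert (Hm1 : m <= t1) by (apply Hlub; intros s [Hs _]; lra).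
  assert (Hgt : forall s, m < s <= t1 -> f s < c).
  { intros s Hs. apply Rnot_le_lt. intros X. assert (s <= m); [|lra].
    apply Hub. split; lra. }
  assert (Hge : c <= f m).
  { apply Rnot_lt_le. intros X.
    destruct (Hc m Hm0 (c - f m) ltac:(lra)) as [d [Pd Hd']].
    assert (m <= m - d / 2); [|lra].
    apply Hlub. intros s [Hs1 Hs2]. apply Rnot_lt_le. intros Y.
    assert (s <= m) by (apply Hub; split; trivial).
    specialize (Hd' s ltac:(apply Rabs_lt_between; lra)).
    apply Rabs_lt_between in Hd'. lra. }
  assert (Hmt : m < t1) by (destruct (Req_dec m t1) as [E|N]; [rewrite E in Hge|]; lra).
  assert (Heq : f m = c).
  { apply Rle_antisym; trivial. apply Rnot_lt_le. intros X.
    destruct (Hc m Hm0 (f m - c) ltac:(lra)) as [d [Pd Hd']].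
    set (s := m + Rmin (d / 2) (t1 - m)).
    assert (L1 := Rmin_l (d / 2) (t1 - m)). assert (L2 := Rmin_r (d / 2) (t1 - m)).
    assert (L3 : 0 < Rmin (d / 2) (t1 - m)) by (apply Rmin_glb_lt; lra).
    assert (Y := Hgt s ltac:(unfold s; lra)).
    specialize (Hd' s ltac:(unfold s; apply Rabs_lt_between; lra)).
    apply Rabs_lt_between in Hd'. lra. }
  assert (Hpos := Hb m Hm0 Heq).
  assert (D := Hd m Hm0). apply is_derive_Reals in D.
  destruct (D (df m) Hpos) as [d Hd'].
  set (h := Rmin (d / 2) (t1 - m)).
  assert (L1 := Rmin_l (d / 2) (t1 - m)). assert (L2 := Rmin_r (d / 2) (t1 - m)).
  assert (Pd := cond_pos d).
  assert (L3 : 0 < h) by (apply Rmin_glb_lt; lra). fold h in L1, L2.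
  specialize (Hd' h ltac:(lra) ltac:(rewrite Rabs_pos_eq; lra)).
  assert (Y := Hgt (m + h) ltac:(lra)).
  apply Rabs_lt_between in Hd'. destruct Hd' as [Hd' _].
  assert (Z : 0 < (f (m + h) - f m) / h) by lra.
  assert (W : (f (m + h) - f m) / h < 0); [|lra].
  apply Rlt_div_l; lra.
Qed.

Lemma sin_kPI (k : Z) : sin (IZR k * PI) = 0.
Proof. apply sin_eq_0_1. now exists k. Qed.

Lemma cos_kPI_sq (k : Z) : cos (IZR k * PI) ^ 2 = 1.
Proof. assert (H := sin2_cos2 (IZR k * PI)). rewrite sin_kPI in H. unfold Rsqr in H. lra. Qed.

Lemma sin_cos_pos_quadrant (x : R) : 0 < sin x * cos x ->
  exists k : Z, IZR k * PI < x < IZR k * PI + PI / 2.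
Proof.
  intros H. assert (HPI := PI_RGT_0).
  set (k := Int_part (x / PI)). exists k.
  destruct (base_Int_part (x / PI)) as [B1 B2]. fold k in B1, B2.
  assert (Ex : x = x / PI * PI) by (field; lra).
  assert (C1 : IZR k * PI <= x) by (rewrite Ex; apply Rmult_le_compat_r; lra).
  assert (C2 : x < IZR k * PI + PI).
  { replace (IZR k * PI + PI) with ((IZR k + 1) * PI) by ring. rewrite Ex.
    apply Rmult_lt_compat_r; lra. }
  assert (Hs : 0 < sin (2 * (x - IZR k * PI))).
  { rewrite sin_2a, sin_minus, cos_minus, sin_kPI.
    assert (E := cos_kPI_sq k).
    replace (2 * (sin x * cos (IZR k * PI) - cos x * 0) * (cos x * cos (IZR k * PI) + sin x * 0))
      with (2 * (sin x * cos x) * cos (IZR k * PI) ^ 2) by ring.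
    rewrite E. lra. }
  split.
  - apply Rnot_le_lt. intros X. replace (x - IZR k * PI) with 0 in Hs by lra.
    rewrite Rmult_0_r, sin_0 in Hs. lra.
  - apply Rnot_le_lt. intros X. assert (sin (2 * (x - IZR k * PI)) <= 0); [|lra].
    apply sin_le_0; lra.
Qed.

Lemma sin_sq_lipschitz (x y : R) : Rabs (sin x ^ 2 - sin y ^ 2) <= Rabs (x - y).
Proof.
  destruct (MVT_gen (fun t => sin t ^ 2) y x (fun t => 2 * sin t * cos t)) as [c [_ Hc]].
  - intros t _. auto_derive; trivial. ring.
  - intros t _. apply continuity_pt_filterlim, (ex_derive_continuous (fun t => sin t ^ 2)).
    auto_derive. trivial.
  - rewrite Hc, Rabs_mult. assert (X := SIN_bound (2 * c)). rewrite sin_2a in X.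
    rewrite <- (Rmult_1_l (Rabs (x - y))) at 2. apply Rmult_le_compat_r; [apply Rabs_pos|].
    apply Rabs_le_between. lra.
Qed.

Lemma continuous_nonzero_pos (f : R -> R) (t : R) : 0 <= t ->
  (forall s, 0 <= s <= t -> continuous f s) -> 0 < f 0 ->
  (forall s, 0 <= s <= t -> f s <> 0) -> 0 < f t.
Proof.
  intros Ht Hc H0 Hn. apply Rnot_le_lt. intros H.
  assert (Hlt : f t < 0) by (destruct H; trivial; exfalso; apply (Hn t); lra).
  assert (Hpos : 0 < t) by (destruct Ht as [|E]; trivial; rewrite <- E in Hlt; lra).
  destruct (IVT_interv (fun s => - f s) 0 t) as [z [Hz E]]; try lra.
  - intros s Hs. apply continuity_pt_opp, continuity_pt_filterlim, Hc, Hs.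
  - apply (Hn z Hz). lra.
Qed.

(* th is the Pruefer angle of (u', K u); a scale K <> 1 only serves to see that
   the angle gets large with the energy. *)
Lemma pruefer_exists (K a e : R) : 0 < K -> exists th B : R -> R,
  th 0 = PI / 2 /\
  forall t, 0 <= t ->
    is_derive th t (K * cos (th t) ^ 2 - qM a e t / K * sin (th t) ^ 2) /\
    0 < B t /\ solM' true a e t = B t * cos (th t) /\ K * solM true a e t = B t * sin (th t).
Proof.
  intros HK. assert (HS := solM_Sol true a e).
  assert (Hnt := solM_nontrivial true a e).
  destruct (solM_0 true a e) as [I1 I2].
  set (u := solM true a e) in *. set (u' := solM' true a e) in *. set (q := qM a e) in *.
  set (rho := fun t => K ^ 2 * u t ^ 2 + u' t ^ 2).
  assert (Hrho : forall t, 0 < rho t).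
  { intros t. unfold rho. specialize (Hnt t).
    assert (Z1 := pow2_ge_0 (u t)). assert (Z2 := pow2_ge_0 (u' t)).
    assert (Z3 : 0 < K ^ 2) by now apply pow_lt.
    destruct Z2 as [Z2|Z2]; [|rewrite <- Z2 in *]; nra. }
  (* The derivative that such an angle must have, expressed through u and u' alone, so that the
     angle is a plain integral. *)
  set (w := fun t => K * (u' t ^ 2 - q t * u t ^ 2) / rho t).
  assert (Hw : forall t, continuous w t).
  { intros t. apply (ex_derive_continuous w). unfold w, rho.
    destruct (HS t) as [D1 D2]. specialize (Hrho t). unfold rho in Hrho.
    auto_derive. repeat split; trivial; try (eexists; eassumption); try lra.
    unfold q, qM, VM. auto_derive. trivial. }
  set (th := fun t => PI / 2 + RInt w 0 t).
  assert (Hth : forall t, is_derive th t (w t)).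
  { intros t. assert (D := is_derive_RInt_cont w 0 t Hw).
    set (F := fun x => RInt w 0 x) in *.
    change (is_derive (fun t => PI / 2 + F t) t (w t)). derive_tac. }
  assert (Hth0 : th 0 = PI / 2).
  { unfold th. rewrite (RInt_point 0 w). change (PI / 2 + 0 = PI / 2). ring. }
  (* A and B are the components of (u', K u) across and along the direction th. A^2 / rho is
     constant and starts at 0, so A = 0; then B^2 = rho > 0 and continuity keeps B positive. *)
  set (A := fun t => K * u t * cos (th t) - u' t * sin (th t)).
  set (B := fun t => K * u t * sin (th t) + u' t * cos (th t)).
  assert (DR : forall t, is_derive (fun t => A t ^ 2 / rho t) t 0).
  { intros t. destruct (HS t) as [D1 D2]. specialize (Hth t). unfold A, rho.
    specialize (Hrho t). unfold rho in Hrho. auto_derive.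
    - repeat split; trivial; try (eexists; eassumption); lra.
    - derive_rw. unfold w, rho. field. lra. }
  assert (HA : forall t, 0 <= t -> A t = 0).
  { intros t Ht.
    assert (E : A t ^ 2 / rho t = A 0 ^ 2 / rho 0).
    { apply Rle_antisym.
      - apply (deriv_nonpos_le (fun t => A t ^ 2 / rho t) (fun _ => 0)); trivial; intros; lra.
      - apply (deriv_nonneg_le (fun t => A t ^ 2 / rho t) (fun _ => 0)); trivial; intros; lra. }
    assert (A0 : A 0 = 0).
    { unfold A. rewrite Hth0, I1, I2, cos_PI2. ring. }
    rewrite A0 in E. specialize (Hrho t).
    assert (A t ^ 2 = 0); [|nra].
    replace (A t ^ 2) with (A t ^ 2 / rho t * rho t) by (field; lra).
    rewrite E. unfold Rdiv. ring. }
  assert (HB2 : forall t, 0 <= t -> B t ^ 2 = rho t).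
  { intros t Ht. assert (X := HA t Ht).
    replace (B t ^ 2) with (A t ^ 2 + B t ^ 2) by (rewrite X; ring).
    assert (SC := sin2_cos2 (th t)). unfold Rsqr in SC.
    unfold A, B, rho.
    replace (K ^ 2 * u t ^ 2 + u' t ^ 2) with
     ((K ^ 2 * u t ^ 2 + u' t ^ 2) * (sin (th t) * sin (th t) + cos (th t) * cos (th t)))
     by (rewrite SC; ring). ring. }
  assert (HB : forall t, 0 <= t -> 0 < B t).
  { intros t Ht. apply (continuous_nonzero_pos B t Ht).
    - intros s _. apply (ex_derive_continuous B). unfold B.
      destruct (HS s) as [D1 D2]. specialize (Hth s).
      auto_derive. repeat split; trivial; eexists; eassumption.
    - unfold B. rewrite Hth0, I1, I2, sin_PI2. lra.
    - intros s Hs E. assert (X := HB2 s ltac:(lra)). specialize (Hrho s). rewrite E in X. nra. }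
  exists th, B. split; trivial. intros t Ht.
  assert (SC := sin2_cos2 (th t)). unfold Rsqr in SC.
  assert (E1 : u' t = B t * cos (th t)).
  { replace (B t * cos (th t)) with (u' t * (sin (th t) * sin (th t) + cos (th t) * cos (th t))
      + sin (th t) * A t) by (unfold A, B; ring). rewrite SC, (HA t Ht). ring. }
  assert (E2 : K * u t = B t * sin (th t)).
  { replace (B t * sin (th t)) with (K * u t * (sin (th t) * sin (th t) + cos (th t) * cos (th t))
      - cos (th t) * A t) by (unfold A, B; ring). rewrite SC, (HA t Ht). ring. }
  split; [|split; [now apply HB | split; trivial]].
  replace (K * cos (th t) ^ 2 - q t / K * sin (th t) ^ 2) with (w t); [apply Hth|].
  unfold w. rewrite <- (HB2 t Ht). assert (HBt := HB t Ht).
  replace (u t) with (B t * sin (th t) / K) by (rewrite <- E2; field; lra).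
  rewrite E1. field. split; lra.
Qed.

Definition pruefer (a e : R) : R -> R :=
  proj1_sig (constructive_indefinite_description _ (pruefer_exists 1 a e Rlt_0_1)).

Lemma pruefer_spec (a e : R) : pruefer a e 0 = PI / 2 /\ exists B : R -> R,
  forall t, 0 <= t ->
    is_derive (pruefer a e) t (cos (pruefer a e t) ^ 2 - qM a e t * sin (pruefer a e t) ^ 2) /\
    0 < B t /\ solM' true a e t = B t * cos (pruefer a e t) /\
    solM true a e t = B t * sin (pruefer a e t).
Proof.
  unfold pruefer.
  destruct (constructive_indefinite_description _ _) as [th [B [H0 H]]]; cbn [proj1_sig].
  split; trivial. exists B. intros t Ht. destruct (H t Ht) as [H1 [H2 [H3 H4]]].
  rewrite Rmult_1_l in H4. split; [|now split; [|split]].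
  replace (cos (th t) ^ 2 - qM a e t * sin (th t) ^ 2) with
    (1 * cos (th t) ^ 2 - qM a e t / 1 * sin (th t) ^ 2) by field. exact H1.
Qed.

Global Opaque pruefer.

Lemma pruefer_ode (a e t : R) : 0 <= t ->
    is_derive (pruefer a e) t (cos (pruefer a e t) ^ 2 - qM a e t * sin (pruefer a e t) ^ 2).
Proof. intros Ht. destruct (pruefer_spec a e) as [_ [B H]]. now apply H. Qed.

(** At a multiple of pi the angle has derivative 1, whatever the energy. *)
Lemma pruefer_above (a e : R) (k : Z) (t0 t : R) : 0 <= t0 <= t ->
  IZR k * PI <= pruefer a e t0 -> IZR k * PI <= pruefer a e t.
Proof.
  intros Ht H0.
  apply (lower_barrier (pruefer a e) _ _ t0 (fun t Ht => pruefer_ode a e t ltac:(lra))); trivial; [|lra].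
  intros s Hs E. rewrite E, sin_kPI, cos_kPI_sq. lra.
Qed.

(** At an odd multiple of pi / 2 the angle has derivative -q, which is negative past the turning
    abscissa. *)
Lemma pruefer_below (a e : R) (k : Z) (t0 t : R) : turning a e <= t0 <= t ->
  pruefer a e t0 <= IZR k * PI + PI / 2 -> pruefer a e t <= IZR k * PI + PI / 2.
Proof.
  intros Ht H0. assert (Tp := turning_ge0 a e).
  cut (- (IZR k * PI + PI / 2) <= - pruefer a e t); [lra|].
  apply (lower_barrier (fun t => - pruefer a e t)
    (fun t => - (cos (pruefer a e t) ^ 2 - qM a e t * sin (pruefer a e t) ^ 2)) _ t0); try lra.
  - intros s Hs. apply (is_derive_opp (pruefer a e)), pruefer_ode. lra.
  - intros s Hs E. assert (E' : pruefer a e s = IZR k * PI + PI / 2) by lra.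
    assert (Hq := qM_ge1 a e s ltac:(lra)).
    rewrite E'. assert (C : cos (IZR k * PI + PI / 2) = 0) by (apply cos_eq_0_1; now exists k).
    assert (SC := sin2_cos2 (IZR k * PI + PI / 2)). rewrite C in *. unfold Rsqr in SC.
    replace (sin (IZR k * PI + PI / 2) ^ 2) with 1 by lra. lra.
Qed.

Lemma pruefer_continuous (a e t eps : R) : 0 <= t -> 0 < eps ->
  exists d, 0 < d /\ forall e1, Rabs (e1 - e) < d -> Rabs (pruefer a e1 t - pruefer a e t) < eps.
Proof.
  intros Ht Heps.
  set (M := (t ^ 2 / 2 + Rabs a) ^ 2 + Rabs e).
  assert (HM : 0 <= M).
  { assert (Z := pow2_ge_0 (t ^ 2 / 2 + Rabs a)). assert (Z' := Rabs_pos e). unfold M; lra. }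
  set (X := t * exp ((3 + 2 * M) * t)).
  assert (HX : 0 <= X) by (apply Rmult_le_pos; [trivial | left; apply exp_pos]).
  exists (eps / (1 + X)). split; [apply Rdiv_lt_0_compat; lra|].
  intros e1 He1.
  set (th := pruefer a e) in *. set (th1 := pruefer a e1) in *.
  assert (Hd : forall s, 0 <= s -> is_derive th s (cos (th s) ^ 2 - qM a e s * sin (th s) ^ 2))
    by (intros; now apply pruefer_ode).
  assert (Hd1 : forall s, 0 <= s -> is_derive th1 s (cos (th1 s) ^ 2 - qM a e1 s * sin (th1 s) ^ 2))
    by (intros; now apply pruefer_ode).
  assert (G := gronwall (fun s => (th1 s - th s) ^ 2)
    (fun s => 2 * (th1 s - th s) * ((- qM a e s - 1) * (sin (th1 s) ^ 2 - sin (th s) ^ 2)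
        + (e1 - e) * sin (th1 s) ^ 2)) (3 + 2 * M) ((e1 - e) ^ 2) t
      ltac:(lra) (pow2_ge_0 _)).
  assert (H : (th1 t - th t) ^ 2 <= ((th1 0 - th 0) ^ 2 + (e1 - e) ^ 2 * t) * exp ((3 + 2 * M) * t)).
  { apply G; try lra.
    - intros s [Hs _]. assert (D := Hd s Hs). assert (D1 := Hd1 s Hs).
      auto_derive; [repeat split; trivial; eexists; eassumption|]. derive_rw.
      assert (S1 := sin2_cos2 (th s)). assert (S2 := sin2_cos2 (th1 s)). unfold Rsqr in S1, S2.
      replace (cos (th s) ^ 2) with (1 - sin (th s) ^ 2) by lra.
      replace (cos (th1 s) ^ 2) with (1 - sin (th1 s) ^ 2) by lra.
      unfold qM. ring.
    - intros s Hs.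
      assert (Hq := qM_bound (Rabs a) (Rabs e) t a e s (Rle_refl _) (Rle_refl _) Hs).
      fold M in Hq. apply Rabs_le_between in Hq.
      set (x := th1 s - th s). set (y := sin (th1 s) ^ 2 - sin (th s) ^ 2).
      assert (Hy : Rabs y <= Rabs x) by apply sin_sq_lipschitz.
      assert (Hxy : Rabs (x * y) <= x ^ 2).
      { rewrite Rabs_mult, <- pow2_abs. assert (Q := Rabs_pos x). nra. }
      apply Rabs_le_between in Hxy.
      assert (Y1 : 2 * (x * y) * (- qM a e s - 1) <= (1 + M) * (2 * x ^ 2)).
      { apply mult_le_of_between; lra. }
      assert (Sb : 0 <= sin (th1 s) ^ 2 <= 1).
      { split; [apply pow2_ge_0|]. assert (S2 := sin2_cos2 (th1 s)). unfold Rsqr in S2.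
        assert (Z := pow2_ge_0 (cos (th1 s))). lra. }
      assert (Y2 : 2 * x * ((e1 - e) * sin (th1 s) ^ 2) <= x ^ 2 + (e1 - e) ^ 2).
      { assert (W := two_mul_between x ((e1 - e) * sin (th1 s) ^ 2)).
        assert (W' : ((e1 - e) * sin (th1 s) ^ 2) ^ 2 <= (e1 - e) ^ 2).
        { rewrite Rpow_mult_distr. assert (Z := pow2_ge_0 (e1 - e)).
          assert ((sin (th1 s) ^ 2) ^ 2 <= 1) by nra. nra. }
        lra. }
      lra. }
  assert (T0 : th1 0 - th 0 = 0).
  { unfold th, th1. destruct (pruefer_spec a e) as [-> _]. destruct (pruefer_spec a e1) as [-> _]. ring. }
  rewrite T0 in H.
  replace ((0 ^ 2 + (e1 - e) ^ 2 * t) * exp ((3 + 2 * M) * t)) with ((e1 - e) ^ 2 * X) in H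
    by (unfold X; ring).
  apply Rlt_div_r in He1; [|lra].
  apply (Rle_lt_trans _ (Rabs (e1 - e) * (1 + X))); trivial.
  apply Rabs_le_of_sq; [assert (Q := Rabs_pos (e1 - e)); nra|].
  eapply Rle_trans; [exact H|]. rewrite Rpow_mult_distr, pow2_abs.
  apply Rmult_le_compat_l; [apply pow2_ge_0 | nra].
Qed.

(** Failure of [eigt] means u u' > 0 at a far point, hence at all later ones. As u u' = B^2 sin cos,
    the angle is then in an open quadrant of this kind, to whose closure the two barriers confine
    it. *)
Lemma not_eigt_quadrant (a e t0 : R) : ~ eigt true a e -> exists (t : R) (k : Z),
  t0 <= t /\ turning a e <= t /\ IZR k * PI < pruefer a e t < IZR k * PI + PI / 2.
Proof.
  intros N. apply not_all_ex_not in N. destruct N as [s Hs].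
  apply imply_to_and in Hs. destruct Hs as [Hs1 Hs2]. apply Rnot_le_lt in Hs2.
  set (t := Rmax s t0). assert (L1 := Rmax_l s t0). assert (L2 := Rmax_r s t0). fold t in L1, L2.
  assert (H : solM true a e s * solM' true a e s <= solM true a e t * solM' true a e t).
  { apply (product_nondecreasing _ _ _ _ _ (solM_Sol true a e)); trivial.
    intros r Hr. assert (X := qM_ge1 a e r ltac:(lra)). lra. }
  assert (Ht : 0 <= t) by (assert (X := turning_ge0 a e); lra).
  destruct (pruefer_spec a e) as [_ [B HB]]. destruct (HB t Ht) as [_ [B1 [B2 B3]]].
  assert (P : 0 < sin (pruefer a e t) * cos (pruefer a e t)).
  { rewrite B2, B3 in H. apply Rnot_le_lt. intros X.
    assert (0 < B t ^ 2) by now apply pow_lt.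
    assert (B t ^ 2 * (sin (pruefer a e t) * cos (pruefer a e t)) <= 0) by nra. lra. }
  destruct (sin_cos_pos_quadrant _ P) as [k Hk]. exists t, k. split; [trivial | split; [lra | trivial]].
Qed.

(** Where q <= -K^2 the angle of (u', K u) turns at speed at least K. It starts with the unscaled
    angle and stays within pi / 2 of it, a loss that the initial value pi / 2 compensates. *)
Lemma pruefer_large (a K e : R) : 0 < K -> (/ 2 + Rabs a) ^ 2 + K ^ 2 <= e ->
  K <= pruefer a e 1.
Proof.
  intros HK He.
  destruct (pruefer_exists K a e HK) as [th [B [H0 H]]].
  destruct (pruefer_spec a e) as [G0 [B1 G]].
  set (th1 := pruefer a e) in *.
  assert (HPI := PI_RGT_0).
  assert (HKr : th 0 - K * 0 <= th 1 - K * 1).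
  { apply (deriv_nonneg_le (fun t => th t - K * t)
      (fun t => K * cos (th t) ^ 2 - qM a e t / K * sin (th t) ^ 2 - K)); [lra| |].
    - intros s [Hs _]. destruct (H s Hs) as [D _]. derive_tac.
    - intros s Hs.
      assert (Hq : K ^ 2 <= - qM a e s).
      { unfold qM, VM. assert (X := Rabs_pos a). assert (X1 := Rle_abs a). assert (X2 := Rle_abs (- a)).
        rewrite Rabs_Ropp in X2.
        assert ((s ^ 2 / 2 - a) ^ 2 <= (/ 2 + Rabs a) ^ 2); [|lra].
        apply pow_maj_Rabs, Rabs_le_between.
        assert (0 <= s ^ 2 <= 1) by nra. lra. }
      assert (SC := sin2_cos2 (th s)). unfold Rsqr in SC.
      replace (cos (th s) ^ 2) with (1 - sin (th s) ^ 2) by lra.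
      replace (K * (1 - sin (th s) ^ 2) - qM a e s / K * sin (th s) ^ 2 - K)
        with ((- qM a e s - K ^ 2) * sin (th s) ^ 2 / K) by (field; lra).
      apply Rdiv_le_0_compat; trivial. apply Rmult_le_pos; [lra | apply pow2_ge_0]. }
  (* The two angles always lie in the same closed quadrant. *)
  assert (Hcos : forall t, 0 <= t -> 0 < cos (th t - th1 t)).
  { intros t Ht. destruct (H t Ht) as [_ [X1 [X2 X3]]]. destruct (G t Ht) as [_ [Y1 [Y2 Y3]]].
    assert (Hnt := solM_nontrivial true a e t).
    set (u := solM true a e t) in *. set (u' := solM' true a e t) in *.
    assert (P : 0 < u' ^ 2 + K * u ^ 2).
    { assert (Z1 := pow2_ge_0 u). assert (Z2 := pow2_ge_0 u').
      destruct Z2 as [Z2|Z2]; [|rewrite <- Z2 in *]; nra. }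
    rewrite cos_minus. apply Rnot_le_lt. intros N.
    assert (E : u' ^ 2 + K * u ^ 2 = B t * B1 t *
       (cos (th t) * cos (th1 t) + sin (th t) * sin (th1 t))).
    { replace (u' ^ 2 + K * u ^ 2) with (u' * u' + K * u * u) by ring.
      rewrite X2 at 1. rewrite X3. rewrite Y2. rewrite Y3 at 1. ring. }
    assert (0 < B t * B1 t) by now apply Rmult_lt_0_compat. nra. }
  assert (Hdiff : th 1 - th1 1 < PI / 2).
  { apply Rnot_le_lt. intros N.
    destruct (Req_dec (th 1 - th1 1) (PI / 2)) as [E|Ne].
    - assert (X := Hcos 1 ltac:(lra)). rewrite E, cos_PI2 in X. lra.
    - destruct (IVT_interv (fun t => th t - th1 t - PI / 2) 0 1) as [z [Hz Ez]]; try lra.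
      + intros s [Hs _]. apply continuity_pt_filterlim.
        apply (ex_derive_continuous (fun t => th t - th1 t - PI / 2)).
        destruct (H s Hs) as [D _]. destruct (G s Hs) as [D1 _].
        auto_derive. repeat split; trivial; eexists; eassumption.
      + assert (X := Hcos z ltac:(lra)). replace (th z - th1 z) with (PI / 2) in X by lra.
        rewrite cos_PI2 in X. lra. }
  lra.
Qed.

Lemma eigenvalues_unbounded (a L : R) : exists e, L < e /\ eigt true a e.
Proof.
  apply NNPP. intros N.
  assert (Hno : forall e, L < e -> ~ eigt true a e).
  { intros e He X. apply N. now exists e. }
  assert (HPI := PI_RGT_0).
  set (e0 := Rabs L + 1).
  assert (HL := Rle_abs L). assert (HL0 := Rabs_pos L). assert (Ha0 := Rabs_pos a).
  destruct (not_eigt_quadrant a e0 0 (Hno e0 ltac:(unfold e0; lra))) as [t0 [k0 [Ht0 [Ht0' Hk0]]]].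
  (* K exceeds (k0 + 1) pi, so at energy e1 the angle ends beyond the quadrant where it is trapped
     at e0. *)
  set (K := Rabs (IZR k0 + 1) * PI + 1).
  assert (HK : (IZR k0 + 1) * PI < K).
  { unfold K. assert (X := Rle_abs (IZR k0 + 1)). nra. }
  assert (HKp : 0 < K) by (unfold K; assert (X := Rabs_pos (IZR k0 + 1)); nra).
  set (e1 := (/ 2 + Rabs a) ^ 2 + K ^ 2 + e0).
  assert (Z1 := pow2_ge_0 (/ 2 + Rabs a)). assert (Z2 := pow2_ge_0 K).
  assert (He01 : 0 < e0 <= e1) by (unfold e1, e0; lra).
  set (T := 2 + Rabs a + e1).
  assert (HT : forall e, e0 <= e <= e1 -> turning a e <= T).
  { intros e He. unfold turning, T. rewrite (Rabs_pos_eq e); lra. }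
  assert (HT1 : 1 <= T) by (unfold T; lra).
  assert (Hend : forall t, T <= t -> IZR (k0 + 1) * PI <= pruefer a e1 t).
  { intros t Ht. apply (pruefer_above a e1 (k0 + 1) 1 t); [lra|].
    rewrite plus_IZR. apply Rlt_le, (Rlt_le_trans _ _ _ HK).
    apply pruefer_large; trivial. unfold e1. lra. }
  assert (Hsplit : forall e t t', e0 <= e <= e1 -> T <= t -> T <= t' ->
     pruefer a e t < IZR k0 * PI + PI / 2 -> IZR (k0 + 1) * PI <= pruefer a e t' -> False).
  { intros e t t' He Ht Ht' H1 H2. specialize (HT e He).
    set (s := Rmax t t'). assert (L1 := Rmax_l t t'). assert (L2 := Rmax_r t t'). fold s in L1, L2.
    assert (X := pruefer_below a e k0 t s ltac:(lra) ltac:(lra)).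
    assert (Y := pruefer_above a e (k0 + 1) t' s ltac:(lra) H2).
    rewrite plus_IZR in Y. lra. }
  (* Energies whose angle finally stays at or below the top of quadrant k0. At the supremum m the
     angle is strictly inside some quadrant at a time t; continuity in e at this fixed t either puts
     larger energies into S or keeps energies just below m out of it. *)
  set (S := fun e => e0 <= e <= e1 /\ exists t, T <= t /\ pruefer a e t < IZR k0 * PI + PI / 2).
  assert (HS0 : S e0).
  { split; [lra|]. destruct (not_eigt_quadrant a e0 (Rmax t0 T) (Hno e0 ltac:(unfold e0; lra)))
      as [t [k [Ht [_ Hk]]]].
    assert (L1 := Rmax_l t0 T). assert (L2 := Rmax_r t0 T).
    exists t. split; [lra|].
    assert (X := pruefer_below a e0 k0 t0 t ltac:(lra) ltac:(lra)).
    assert (Hkk : (k <= k0)%Z).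
    { apply Z.lt_succ_r, lt_IZR. rewrite succ_IZR. nra. }
    apply IZR_le in Hkk. nra. }
  destruct (completeness S) as [m [Hub Hlub]].
  { exists e1. intros e [He _]. lra. }
  { now exists e0. }
  assert (Hm0 : e0 <= m) by now apply Hub.
  assert (Hm1 : m <= e1) by (apply Hlub; intros e [He _]; lra).
  destruct (not_eigt_quadrant a m T (Hno m ltac:(unfold e0 in *; lra)))
      as [t [k [Ht [_ Hk]]]].
  destruct (Z_le_gt_dec k k0) as [Hkk|Hkk].
  - apply IZR_le in Hkk.
    assert (Hlt : pruefer a m t < IZR k0 * PI + PI / 2) by nra.
    destruct (Req_dec m e1) as [E|Ne].
    + apply (Hsplit m t T); try lra. rewrite E. apply Hend. lra.
    + destruct (pruefer_continuous a m t (IZR k0 * PI + PI / 2 - pruefer a m t))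
        as [d [Pd Hd]]; try lra.
      set (h := Rmin (d / 2) (e1 - m)).
      assert (L1 := Rmin_l (d / 2) (e1 - m)). assert (L2 := Rmin_r (d / 2) (e1 - m)).
      assert (L3 : 0 < h) by (apply Rmin_glb_lt; lra). fold h in L1, L2.
      assert (m + h <= m); [|lra]. apply Hub. split; [lra|]. exists t. split; trivial.
      specialize (Hd (m + h) ltac:(replace (m + h - m) with h by ring; rewrite Rabs_pos_eq; lra)).
      apply Rabs_lt_between in Hd. lra.
  - assert (Hkk' : IZR (k0 + 1) <= IZR k) by (apply IZR_le; lia).
    assert (Hgt : IZR (k0 + 1) * PI < pruefer a m t) by nra.
    destruct (pruefer_continuous a m t (pruefer a m t - IZR (k0 + 1) * PI))
        as [d [Pd Hd]]; try lra.
    assert (HX : exists e, S e /\ m - d / 2 < e).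
    { apply NNPP. intros NX. assert (m <= m - d / 2); [|lra].
      apply Hlub. intros e He. apply Rnot_lt_le. intros Y. apply NX. now exists e. }
    destruct HX as [e [[He [t' [Ht' Hlt]]] Hed]].
    assert (e <= m) by (apply Hub; split; trivial; now exists t').
    apply (Hsplit e t' t); trivial.
    specialize (Hd e ltac:(apply Rabs_lt_between; lra)).
    apply Rabs_lt_between in Hd. lra.
Qed.

(** * The j-th eigenvalue *)

Lemma list_min (l : list R) : l <> nil -> exists m, In m l /\ forall x, In x l -> m <= x.
Proof.
  induction l as [|y l IH]; [easy|]. intros _.
  destruct l as [|z l].
  - exists y. split; [now left|]. intros x [-> |[]]. lra.
  - destruct IH as [m [Hm Hmin]]; [easy|].
    destruct (Rle_dec y m) as [H|H].
    + exists y. split; [now left|]. intros x [-> |Hx]; [lra|]. specialize (Hmin x Hx). lra.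
    + exists m. split; [now right|]. intros x [<- |Hx]; [lra | now apply Hmin].
Qed.

(** By excluded middle, a duplicate-free list is either complete or can be extended by a missing
    element; the length bound ends the process. *)
Lemma finite_set_list (P : R -> Prop) (N : nat) :
  (forall l, NoDup l -> (forall x, In x l -> P x) -> (length l <= N)%nat) ->
  exists l, NoDup l /\ forall x, In x l <-> P x.
Proof.
  intros HN.
  assert (H : forall k, (k <= N + 1)%nat ->
     (exists l, NoDup l /\ forall x, In x l <-> P x) \/
     (exists l, NoDup l /\ length l = k /\ forall x, In x l -> P x)).
  { induction k as [|k IH].
    - intros _. right. exists nil. split; [constructor | split; [reflexivity | easy]].
    - intros Hk. destruct IH as [X|[l [H1 [H2 H3]]]]; [lia | now left |].
      destruct (classic (forall x, P x -> In x l)) as [Y|Y].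
      + left. exists l. split; trivial. intros x. split; [apply H3 | apply Y].
      + right. apply not_all_ex_not in Y. destruct Y as [x Hx].
        apply imply_to_and in Hx. destruct Hx as [Hx1 Hx2].
        exists (x :: l). split; [now constructor|]. split; [simpl; now rewrite H2|].
        intros y [<- |Hy]; [trivial | now apply H3]. }
  destruct (H (N + 1)%nat (Nat.le_refl _)) as [X|[l [H1 [H2 H3]]]]; trivial.
  specialize (HN l H1 H3). lia.
Qed.

Lemma list_ranked (L : list R) : NoDup L -> forall j, (j < length L)%nat ->
  exists e l, In e L /\ NoDup l /\ length l = j /\ forall x, In x l <-> In x L /\ x < e.
Proof.
  intros HL. induction j as [|j IH]; intros Hj.
  - destruct (list_min L) as [m [Hm Hmin]]; [intros ->; simpl in Hj; lia|].
    exists m, nil. split; [trivial|]. split; [constructor|]. split; [reflexivity|].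
    intros x. split; [easy|]. intros [H1 H2]. specialize (Hmin x H1). lra.
  - destruct IH as [e [l [He [Hl [Hlen Hiff]]]]]; [lia|].
    set (L' := filter (fun x => if Rlt_dec e x then true else false) L).
    assert (HL' : forall x, In x L' <-> In x L /\ e < x).
    { intros x. unfold L'. rewrite filter_In. destruct (Rlt_dec e x); intuition easy. }
    destruct (list_min L') as [m [Hm Hmin]].
    { intros E. assert (Hin : incl L (e :: l)).
      { intros x Hx. destruct (Rtotal_order x e) as [Y|[Y|Y]].
        - right. apply Hiff. now split.
        - now left.
        - assert (X : In x L') by (apply HL'; now split). rewrite E in X. easy. }
      apply (NoDup_incl_length HL) in Hin. simpl in Hin. lia. }
    apply HL' in Hm. destruct Hm as [Hm1 Hm2].
    exists m, (e :: l). split; [trivial|]. split.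
    { constructor; trivial. intros X. apply Hiff in X. lra. }
    split; [simpl; now rewrite Hlen|].
    intros x. split.
    + intros [<- |Hx]; [now split|]. apply Hiff in Hx. split; [easy | lra].
    + intros [H1 H2]. destruct (Rtotal_order x e) as [Y|[Y|Y]].
      * right. apply Hiff. now split.
      * now left.
      * assert (X : In x L') by (apply HL'; now split). specialize (Hmin x X). lra.
Qed.

Lemma many_eigenvalues (a : R) (n : nat) : exists l E, NoDup l /\ length l = n /\
  forall x, In x l -> is_eigM a x /\ x < E.
Proof.
  induction n as [|n [l [E [H1 [H2 H3]]]]].
  - exists nil, 0. split; [constructor | split; [reflexivity | easy]].
  - destruct (eigenvalues_unbounded a E) as [e [He Hg]].
    exists (e :: l), (e + 1). split; [|split].
    + constructor; trivial. intros X. apply H3 in X. lra.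
    + simpl. now rewrite H2.
    + intros x [<- |Hx]; [split; [now apply (is_eigM_of_eigt true) | lra]|].
      destruct (H3 x Hx). split; [trivial | lra].
Qed.

Lemma jth_eig_exists (j : nat) (a : R) : (1 <= j)%nat -> exists e, is_jth_eig j a e.
Proof.
  intros Hj. destruct (many_eigenvalues a j) as [l0 [E [N0 [Len0 H0]]]].
  destruct (eigenvalue_count_bound (Rabs a) (Rabs E) (Rabs_pos a) (Rabs_pos E)) as [N HN].
  destruct (finite_set_list (fun x => is_eigM a x /\ x < E) N) as [L [HL Hiff]].
  { intros l Hl Hin. apply (HN a l); [lra | trivial|].
    intros x Hx. destruct (Hin x Hx). split; trivial. assert (X := Rle_abs E). lra. }
  assert (Hlen : (j <= length L)%nat).
  { rewrite <- Len0. apply NoDup_incl_length; trivial.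
    intros x Hx. apply Hiff. now apply H0. }
  destruct (list_ranked L HL (j - 1)%nat ltac:(lia)) as [e [l [He [Hl [Hll Hx]]]]].
  apply Hiff in He. exists e. split; [easy|]. exists l. split; [trivial | split; [trivial|]].
  intros x. rewrite Hx, Hiff. split; [now intros [[? ?] ?] | intros [? ?]; split; trivial].
  split; trivial. lra.
Qed.

Lemma lamM_spec (j : nat) (a : R) : (1 <= j)%nat -> is_jth_eig j a (lamM j a).
Proof. intros Hj. unfold lamM. apply epsilon_spec. now apply jth_eig_exists. Qed.

(** Otherwise the j - 1 smaller eigenvalues would all lie below E, exceeding a count that is uniform
    for a in [-A, A]. *)
Lemma lamM_large (A E : R) : 0 <= A -> 0 <= E -> exists N : nat, forall j a,
  (N <= j)%nat -> Rabs a <= A -> E < lamM j a.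
Proof.
  intros HA HE. destruct (eigenvalue_count_bound A E HA HE) as [N HN].
  exists (N + 2)%nat. intros j a Hj Ha. apply Rnot_le_lt. intros Hle.
  destruct (lamM_spec j a ltac:(lia)) as [_ [l [H1 [H2 H3]]]].
  assert (X : (length l <= N)%nat); [|lia].
  apply (HN a l Ha H1). intros x Hx. apply H3 in Hx. destruct Hx. split; [trivial | lra].
Qed.

(** * Moment identities *)

Definition poly_bounded (p : R -> R) : Prop :=
  exists C n, 0 <= C /\ forall x, 0 <= x -> Rabs (p x) <= C * (1 + x) ^ n.

Lemma poly_bounded_const c : poly_bounded (fun _ => c).
Proof.
  exists (Rabs c), 0%nat. split; [apply Rabs_pos|]. intros x _. simpl. lra.
Qed.

Lemma poly_bounded_id : poly_bounded (fun x => x).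
Proof.
  exists 1, 1%nat. split; [lra|]. intros x Hx. rewrite Rabs_pos_eq; lra.
Qed.

Lemma poly_bounded_opp p : poly_bounded p -> poly_bounded (fun x => - p x).
Proof.
  intros [C [n [HC H]]]. exists C, n. split; trivial. intros x Hx. rewrite Rabs_Ropp. now apply H.
Qed.

Lemma poly_bounded_plus p r : poly_bounded p -> poly_bounded r -> poly_bounded (fun x => p x + r x).
Proof.
  intros [C [n [HC H]]] [D [m [HD H']]]. exists (C + D), (n + m)%nat. split; [lra|].
  intros x Hx. specialize (H x Hx). specialize (H' x Hx).
  eapply Rle_trans; [apply Rabs_triang|].
  assert (P1 : 1 <= (1 + x) ^ n) by (apply pow_R1_Rle; lra).
  assert (P2 : 1 <= (1 + x) ^ m) by (apply pow_R1_Rle; lra).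
  rewrite pow_add. set (X := (1 + x) ^ n) in *. set (Y := (1 + x) ^ m) in *.
  assert (C * X <= C * (X * Y)) by (apply Rmult_le_compat_l; nra).
  assert (D * Y <= D * (X * Y)) by (apply Rmult_le_compat_l; nra). lra.
Qed.

Lemma poly_bounded_mult p r : poly_bounded p -> poly_bounded r -> poly_bounded (fun x => p x * r x).
Proof.
  intros [C [n [HC H]]] [D [m [HD H']]]. exists (C * D), (n + m)%nat. split; [nra|].
  intros x Hx. specialize (H x Hx). specialize (H' x Hx).
  rewrite Rabs_mult, pow_add.
  replace (C * D * ((1 + x) ^ n * (1 + x) ^ m)) with ((C * (1 + x) ^ n) * (D * (1 + x) ^ m)) by ring.
  apply Rmult_le_compat; trivial; apply Rabs_pos.
Qed.

Lemma poly_bounded_pow p k : poly_bounded p -> poly_bounded (fun x => p x ^ k).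
Proof.
  intros H. induction k as [|k IH].
  - apply (poly_bounded_const 1).
  - apply (poly_bounded_mult p (fun x => p x ^ k)); trivial.
Qed.

Ltac poly_bounded_tac :=
  unfold Rdiv, Rminus;
  repeat first [ apply poly_bounded_const | apply poly_bounded_id
    | apply poly_bounded_plus | apply poly_bounded_opp
    | apply poly_bounded_mult | apply poly_bounded_pow ].

Lemma rapid_poly p f : poly_bounded p -> rapid f -> rapid (fun x => p x * f x).
Proof. intros [C [n [_ H]]] Hf. now apply (rapid_mult p f C n). Qed.

Definition sv (x : R) : R := x ^ 2 / 2 - 1.

(* Rescaled eigenfunctions restricted to the half line; [cs_0] encodes parity and
   [cs_crit] is the Hellmann-Feynman form of criticality. *)
Record critical_state (k E : R) (v v' : R -> R) (M : R) : Prop := {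
  cs_k : 0 < k;
  cs_E : 0 < E;
  cs_sol : Sol (fun x => k * (sv x ^ 2 - E)) v v';
  cs_0 : v 0 * v' 0 = 0;
  cs_rapid : rapid (fun x => v x ^ 2 + v' x ^ 2);
  cs_M : 0 < M;
  cs_mass : HI (fun x => v x ^ 2) M;
  cs_crit : HI (fun x => sv x * v x ^ 2) 0 }.
Arguments cs_k {k E v v' M}.
Arguments cs_E {k E v v' M}.
Arguments cs_sol {k E v v' M}.
Arguments cs_0 {k E v v' M}.
Arguments cs_rapid {k E v v' M}.
Arguments cs_M {k E v v' M}.
Arguments cs_mass {k E v v' M}.
Arguments cs_crit {k E v v' M}.

Section moments.
Variables (k E : R) (v v' : R -> R) (M : R).
Hypothesis CS : critical_state k E v v' M.

Let HS := cs_sol CS.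

Lemma cs_quad_rapid p1 p2 p3 : poly_bounded p1 -> poly_bounded p2 -> poly_bounded p3 ->
  rapid (fun x => p1 x * v x ^ 2 + p2 x * (v x * v' x) + p3 x * v' x ^ 2).
Proof.
  intros H1 H2 H3. assert (Hr := cs_rapid CS).
  assert (R1 : rapid (fun x => v x ^ 2)).
  { apply (rapid_dom _ _ 1) with (2 := Hr). intros x _.
    rewrite Rabs_pos_eq by apply pow2_ge_0. assert (Z := pow2_ge_0 (v' x)). lra. }
  assert (R3 : rapid (fun x => v' x ^ 2)).
  { apply (rapid_dom _ _ 1) with (2 := Hr). intros x _.
    rewrite Rabs_pos_eq by apply pow2_ge_0. assert (Z := pow2_ge_0 (v x)). lra. }
  assert (R2 : rapid (fun x => v x * v' x)).
  { apply (rapid_dom _ _ 1) with (2 := Hr). intros x _.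
    assert (Z := two_mul_between (v x) (v' x)). apply Rabs_le_between.
    assert (Z1 := pow2_ge_0 (v x)). assert (Z2 := pow2_ge_0 (v' x)). lra. }
  apply (rapid_plus (fun x => p1 x * v x ^ 2 + p2 x * (v x * v' x)) (fun x => p3 x * v' x ^ 2)).
  - apply (rapid_plus (fun x => p1 x * v x ^ 2) (fun x => p2 x * (v x * v' x))).
    + now apply (rapid_poly p1 (fun x => v x ^ 2)).
    + now apply (rapid_poly p2 (fun x => v x * v' x)).
  - now apply (rapid_poly p3 (fun x => v' x ^ 2)).
Qed.

(** Each moment identity integrates the derivative of a quadratic form in (v, v'). At 0 parity
    removes the v v' term, and p1, p3 vanish there in every use, which is why multipliers are odd;
    decay handles infinity. *)
Lemma cs_quad_FTC p1 p2 p3 (g : R -> R) :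
  poly_bounded p1 -> poly_bounded p2 -> poly_bounded p3 ->
  (forall x, is_derive (fun x => p1 x * v x ^ 2 + p2 x * (v x * v' x) + p3 x * v' x ^ 2) x (g x)) ->
  (forall x, continuous g x) ->
  p1 0 * v 0 ^ 2 + p3 0 * v' 0 ^ 2 = 0 -> HI g 0.
Proof.
  intros H1 H2 H3 Hd Hc H0.
  destruct (rapid_bound1 _ (cs_quad_rapid p1 p2 p3 H1 H2 H3)) as [C HC].
  assert (H := HI_FTC _ g C Hd Hc HC). cbv beta in H.
  rewrite (cs_0 CS) in H.
  replace (- (p1 0 * v 0 ^ 2 + p2 0 * 0 + p3 0 * v' 0 ^ 2)) with 0 in H by lra. exact H.
Qed.

Lemma cs_quad_HI p1 p2 p3 (f : R -> R) : poly_bounded p1 -> poly_bounded p2 -> poly_bounded p3 ->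
  (forall x, continuous p1 x) -> (forall x, continuous p2 x) -> (forall x, continuous p3 x) ->
  (forall x, p1 x * v x ^ 2 + p2 x * (v x * v' x) + p3 x * v' x ^ 2 = f x) ->
  exists l, HI f l.
Proof.
  intros H1 H2 H3 C1 C2 C3 Hf.
  destruct (rapid_HI (fun x => p1 x * v x ^ 2 + p2 x * (v x * v' x) + p3 x * v' x ^ 2)) as [l Hl].
  - intros t. assert (C := Sol_cont _ _ _ HS).
    apply (continuous_plus (fun x => p1 x * v x ^ 2 + p2 x * (v x * v' x)) (fun x => p3 x * v' x ^ 2)).
    + apply (continuous_plus (fun x => p1 x * v x ^ 2) (fun x => p2 x * (v x * v' x))).
      * apply continuous_mult_R; [apply C1|]. apply continuous_sq. intros; apply C.
      * apply continuous_mult_R; [apply C2|]. apply continuous_mult_R; apply C.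
    + apply continuous_mult_R; [apply C3|]. apply continuous_sq. intros; apply C.
  - now apply cs_quad_rapid.
  - exists l. now apply (HI_ext _ _ l Hf).
Qed.

End moments.

Lemma cs_moments k E v v' M : critical_state k E v v' M ->
  exists m2 m3 m4 mk c,
    HI (fun x => sv x ^ 2 * v x ^ 2) m2 /\ HI (fun x => sv x ^ 3 * v x ^ 2) m3 /\
    HI (fun x => sv x ^ 4 * v x ^ 2) m4 /\ HI (fun x => v' x ^ 2) mk /\
    HI (fun x => sv x * x * (v x * v' x)) c.
Proof.
  intros CS. assert (HS := cs_sol CS).
  assert (P0 := poly_bounded_const 0). assert (C0 := fun x => continuous_const (U := R_UniformSpace) 0 x).
  assert (X : forall n, exists l, HI (fun x => sv x ^ n * v x ^ 2) l).
  { intros n. apply (cs_quad_HI k E v v' M CS (fun x => sv x ^ n) (fun _ => 0) (fun _ => 0)); trivial.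
    - unfold sv. poly_bounded_tac.
    - intros t. apply (ex_derive_continuous (fun x => sv x ^ n)). unfold sv. auto_derive. trivial.
    - intros t. ring. }
  destruct (X 2%nat) as [m2 H2], (X 3%nat) as [m3 H3], (X 4%nat) as [m4 H4].
  assert (Y : exists l, HI (fun x => v' x ^ 2) l).
  { apply (cs_quad_HI k E v v' M CS (fun _ => 0) (fun _ => 0) (fun _ => 1)); trivial.
    - apply poly_bounded_const.
    - intros t. apply continuous_const.
    - intros t. ring. }
  assert (Z : exists l, HI (fun x => sv x * x * (v x * v' x)) l).
  { apply (cs_quad_HI k E v v' M CS (fun _ => 0) (fun x => sv x * x) (fun _ => 0)); trivial.
    - unfold sv. poly_bounded_tac.
    - intros t. apply (ex_derive_continuous (fun x => sv x * x)). unfold sv. auto_derive. trivial.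
    - intros t. ring. }
  destruct Y as [mk Hk], Z as [c Hc]. exists m2, m3, m4, mk, c. repeat (split; [assumption|]). assumption.
Qed.

Lemma HI_poly_s (v : R -> R) M m2 m3 m4 c0 c1 c2 c3 c4 :
  HI (fun x => v x ^ 2) M -> HI (fun x => sv x * v x ^ 2) 0 ->
  HI (fun x => sv x ^ 2 * v x ^ 2) m2 -> HI (fun x => sv x ^ 3 * v x ^ 2) m3 ->
  HI (fun x => sv x ^ 4 * v x ^ 2) m4 ->
  HI (fun x => (c0 + c1 * sv x + c2 * sv x ^ 2 + c3 * sv x ^ 3 + c4 * sv x ^ 4) * v x ^ 2)
     (c0 * M + c2 * m2 + c3 * m3 + c4 * m4).
Proof.
  intros H0 H1 H2 H3 H4.
  assert (H := HI_plus _ _ _ _ (HI_plus _ _ _ _ (HI_plus _ _ _ _ (HI_plus _ _ _ _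
    (HI_scal c0 _ _ H0) (HI_scal c1 _ _ H1)) (HI_scal c2 _ _ H2)) (HI_scal c3 _ _ H3))
    (HI_scal c4 _ _ H4)).
  replace (c0 * M + c2 * m2 + c3 * m3 + c4 * m4) with
    (c0 * M + c1 * 0 + c2 * m2 + c3 * m3 + c4 * m4) by ring.
  eapply HI_ext; [|exact H]. intros t. cbv beta. ring.
Qed.

Ltac cs_derive HS x :=
  let D1 := fresh in let D2 := fresh in
  destruct (HS x) as [D1 D2];
  auto_derive; [repeat split; trivial; eexists; eassumption | derive_rw; unfold sv; field].

Ltac cs_cont HS x :=
  let D1 := fresh in let D2 := fresh in
  destruct (HS x) as [D1 D2];
  match goal with |- continuous ?g _ => apply (ex_derive_continuous g) end;
  unfold sv; auto_derive; repeat split; trivial; eexists; eassumption.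

(* The identities come from integrating (phi Q - phi' v v' + phi'' v^2 / 2)',
   Q = v'^2 + k (E - s^2) v^2, for phi = x, x s, x s^2, and from
   (v v')' and (s x v^2)'. *)
Lemma cs_identities k E v v' M m2 m3 m4 mk c : critical_state k E v v' M ->
  HI (fun x => sv x ^ 2 * v x ^ 2) m2 -> HI (fun x => sv x ^ 3 * v x ^ 2) m3 ->
  HI (fun x => sv x ^ 4 * v x ^ 2) m4 -> HI (fun x => v' x ^ 2) mk ->
  HI (fun x => sv x * x * (v x * v' x)) c ->
  2 * E * M - 6 * m2 = 0 /\
  k * (4 * E * M - 8 * m2 - 10 * m3) + 3 / 2 * M = 0 /\
  k * (10 * E * m2 - 12 * m3 - 14 * m4) + 12 * M = 0 /\
  mk + k * (m2 - E * M) = 0 /\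
  M + c = 0.
Proof.
  intros CS H2 H3 H4 Hk Hc.
  assert (HS := cs_sol CS).
  assert (k0 := cs_k CS).
  assert (H0 := cs_mass CS). assert (H1 := cs_crit CS).
  split; [|split; [|split; [|split]]].
  - assert (X : HI (fun x => (2 * E + (-4) * sv x + (-6) * sv x ^ 2 + 0 * sv x ^ 3 + 0 * sv x ^ 4) * (v x ^ 2)) 0).
    { assert (W : HI (fun x => (2 * E - 4 * sv x - 6 * sv x ^ 2) * k * v x ^ 2) 0).
      2:{ apply (HI_scal (/ k)) in W. rewrite Rmult_0_r in W.
          eapply HI_ext; [|exact W]. intros t. cbv beta. field. lra. }
      apply (cs_quad_FTC k E v v' M CS (fun x => x * (k * (E - sv x ^ 2))) (fun _ => -1) (fun x => x)).
      1-3: unfold sv; poly_bounded_tac.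
      + intros x. unfold sv in *. cs_derive HS x.
      + intros x. cs_cont HS x.
      + ring. }
    assert (Y := HI_unique _ _ _ X (HI_poly_s v M m2 m3 m4 _ _ _ _ _ H0 H1 H2 H3 H4)). lra.
  - assert (X : HI (fun x => ((4 * E * k + 3 / 2) + (6 * E * k) * sv x + (-8 * k) * sv x ^ 2 + (-10 * k) * sv x ^ 3 + 0 * sv x ^ 4) * (v x ^ 2)) 0).
    { apply (cs_quad_FTC k E v v' M CS
         (fun x => x * sv x * (k * (E - sv x ^ 2)) + 3 * x / 2) (fun x => - (3 * sv x + 2)) (fun x => x * sv x)).
      1-3: unfold sv; poly_bounded_tac.
      + intros x. unfold sv in *. cs_derive HS x.
      + intros x. cs_cont HS x.
      + unfold sv. field. }
    assert (Y := HI_unique _ _ _ X (HI_poly_s v M m2 m3 m4 _ _ _ _ _ H0 H1 H2 H3 H4)). lra.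
  - assert (X : HI (fun x => (12 + (8 * E * k + 15) * sv x + (10 * E * k) * sv x ^ 2 + (-12 * k) * sv x ^ 3 + (-14 * k) * sv x ^ 4) * (v x ^ 2)) 0).
    { apply (cs_quad_FTC k E v v' M CS
         (fun x => x * sv x ^ 2 * (k * (E - sv x ^ 2)) + (5 * sv x + 2) * x)
         (fun x => - (5 * sv x ^ 2 + 4 * sv x)) (fun x => x * sv x ^ 2)).
      1-3: unfold sv; poly_bounded_tac.
      + intros x. unfold sv in *. cs_derive HS x.
      + intros x. cs_cont HS x.
      + unfold sv. field. }
    assert (Y := HI_unique _ _ _ X (HI_poly_s v M m2 m3 m4 _ _ _ _ _ H0 H1 H2 H3 H4)). lra.
  - assert (X : HI (fun x => v' x ^ 2 + k * (sv x ^ 2 - E) * v x ^ 2) 0).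
    { apply (cs_quad_FTC k E v v' M CS (fun _ => 0) (fun _ => 1) (fun _ => 0)).
      1-3: unfold sv; poly_bounded_tac.
      + intros x. unfold sv in *. cs_derive HS x.
      + intros x. cs_cont HS x.
      + ring. }
    assert (Y := HI_plus _ _ _ _ Hk (HI_poly_s v M m2 m3 m4 (- k * E) 0 k 0 0 H0 H1 H2 H3 H4)).
    assert (Z : 0 = mk + (- k * E * M + k * m2 + 0 * m3 + 0 * m4)).
    { eapply HI_unique; [exact X|]. eapply HI_ext; [|exact Y]. intros t. cbv beta. ring. }
    lra.
  - assert (X : HI (fun x => (3 * sv x + 2) * v x ^ 2 + 2 * (sv x * x * (v x * v' x))) 0).
    { apply (cs_quad_FTC k E v v' M CS (fun x => sv x * x) (fun _ => 0) (fun _ => 0)).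
      1-3: unfold sv; poly_bounded_tac.
      + intros x. unfold sv in *. cs_derive HS x.
      + intros x. cs_cont HS x.
      + ring. }
    assert (Y := HI_plus _ _ _ _ (HI_poly_s v M m2 m3 m4 2 3 0 0 0 H0 H1 H2 H3 H4) (HI_scal 2 _ _ Hc)).
    assert (Z : 0 = 2 * M + 0 * m2 + 0 * m3 + 0 * m4 + 2 * c).
    { eapply HI_unique; [exact X|]. eapply HI_ext; [|exact Y]. intros t. cbv beta. ring. }
    lra.
Qed.

(** Integrals of squares with free coefficients: (s + 1 - y)^2 against (s + 1) v^2, positive because
    s + 1 = x^2 / 2; (s^2 - y s - z)^2 against v^2; and (y s x v + z v')^2, where x^2 = 2 s + 2
    turns the integral of s^2 x^2 v^2 into 2 m2 + 2 m3. *)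
Lemma cs_inequalities k E v v' M m2 m3 m4 mk c : critical_state k E v v' M ->
  HI (fun x => sv x ^ 2 * v x ^ 2) m2 -> HI (fun x => sv x ^ 3 * v x ^ 2) m3 ->
  HI (fun x => sv x ^ 4 * v x ^ 2) m4 -> HI (fun x => v' x ^ 2) mk ->
  HI (fun x => sv x * x * (v x * v' x)) c ->
  (forall y, 0 <= (m3 + 3 * m2 + M) - 2 * y * (m2 + M) + y ^ 2 * M) /\
  (forall y z, 0 <= m4 - 2 * y * m3 + (y ^ 2 - 2 * z) * m2 + z ^ 2 * M) /\
  (forall y z, 0 <= y ^ 2 * (2 * m2 + 2 * m3) + 2 * y * z * c + z ^ 2 * mk).
Proof.
  intros CS H2 H3 H4 Hk Hc.
  assert (H0 := cs_mass CS). assert (H1 := cs_crit CS).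
  split; [|split].
  - intros y.
    assert (Y := HI_poly_s v M m2 m3 m4 (1 - 2 * y + y ^ 2) (3 - 4 * y + y ^ 2) (3 - 2 * y) 1 0 H0 H1 H2 H3 H4).
    apply HI_ge0 in Y; [lra|]. intros t _.
    replace (_ * v t ^ 2) with ((t ^ 2 / 2) * ((sv t + 1 - y) ^ 2 * v t ^ 2)) by (unfold sv; field).
    apply Rmult_le_pos; [|apply Rmult_le_pos; apply pow2_ge_0].
    assert (Z := pow2_ge_0 t). lra.
  - intros y z.
    assert (Y := HI_poly_s v M m2 m3 m4 (z ^ 2) (2 * y * z) (y ^ 2 - 2 * z) (- 2 * y) 1 H0 H1 H2 H3 H4).
    apply HI_ge0 in Y; [lra|]. intros t _.
    replace (_ * v t ^ 2) with (((sv t ^ 2 - y * sv t - z) * v t) ^ 2) by ring.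
    apply pow2_ge_0.
  - intros y z.
    assert (Y := HI_plus _ _ _ _ (HI_plus _ _ _ _ (HI_poly_s v M m2 m3 m4 0 0 (2 * y ^ 2) (2 * y ^ 2) 0 H0 H1 H2 H3 H4)
       (HI_scal (2 * y * z) _ _ Hc)) (HI_scal (z ^ 2) _ _ Hk)).
    apply HI_ge0 in Y; [lra|]. intros t _. cbv beta.
    replace (_ + z ^ 2 * v' t ^ 2) with ((y * (sv t * t) * v t + z * v' t) ^ 2) by (unfold sv; field).
    apply pow2_ge_0.
Qed.

(** The first bound holds for every k, which serves bounded a; for large k it gives E below about
    21/5. At h = 0 the least-squares inequality would force E = 0 or E above 1.3, so 6/5 leaves a
    margin while staying above 1. *)
Lemma cs_energy_bounds k E v v' M : critical_state k E v v' M ->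
  E ^ 2 / 9 <= 7 * E / 15 + 3 / (20 * k) /\ (10000 <= k -> 6 / 5 <= E).
Proof.
  intros CS.
  destruct (cs_moments _ _ _ _ _ CS) as [m2 [m3 [m4 [mk [c [H2 [H3 [H4 [Hk Hc]]]]]]]]].
  destruct (cs_identities _ _ _ _ _ _ _ _ _ _ CS H2 H3 H4 Hk Hc) as [I1 [I2 [I3 [I4 I5]]]].
  destruct (cs_inequalities _ _ _ _ _ _ _ _ _ _ CS H2 H3 H4 Hk Hc) as [J1 [J2 J3]].
  assert (k0 := cs_k CS). assert (E0 := cs_E CS). assert (M0 := cs_M CS).
  set (h := / k). assert (h0 : 0 < h) by now apply Rinv_0_lt_compat.
  assert (hk : k * h = 1) by (unfold h; field; lra).
  assert (E2 : m2 = E / 3 * M) by lra.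
  assert (E3 : m3 = (2 * E / 15 + 3 * h / 20) * M).
  { assert (X : 10 * m3 = 4 * E * M - 8 * m2 + 3 / 2 * M * h).
    { apply (Rmult_eq_reg_l k); [|lra].
      replace (k * (4 * E * M - 8 * m2 + 3 / 2 * M * h)) with
        (k * (4 * E * M - 8 * m2) + 3 / 2 * M * (k * h)) by ring. rewrite hk. lra. }
    rewrite E2 in X. lra. }
  assert (E4 : m4 = (10 * E ^ 2 / 3 - 8 * E / 5 + 51 / 5 * h) / 14 * M).
  { assert (X : 14 * m4 = 10 * E * m2 - 12 * m3 + 12 * M * h).
    { apply (Rmult_eq_reg_l k); [|lra].
      replace (k * (10 * E * m2 - 12 * m3 + 12 * M * h)) with
        (k * (10 * E * m2 - 12 * m3) + 12 * M * (k * h)) by ring. rewrite hk. lra. }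
    rewrite E2, E3 in X. lra. }
  assert (Ek : mk = 2 * k * E / 3 * M) by (rewrite E2 in I4; lra).
  assert (Ec : c = - M) by lra.
  subst m2 m3 m4 mk c.
  split.
  (* The minimising y: the mean of s + 1 for the measure (s + 1) v^2, that is (m2 + M) / M. *)
  - specialize (J1 (E / 3 + 1)).
    assert (X : 0 <= ((2 * E / 15 + 3 * h / 20) + E + 1 - (E / 3 + 1) ^ 2) * M) by lra.
    assert (Y : 0 <= (2 * E / 15 + 3 * h / 20) + E + 1 - (E / 3 + 1) ^ 2).
    { apply Rnot_lt_le. intros N. assert (W := Rmult_lt_compat_r M _ _ M0 N). lra. }
    replace (3 / (20 * k)) with (3 * h / 20) by (unfold h; field; lra). lra.
  - intros Hk4. apply Rnot_lt_le. intros HE.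
    assert (Hh : h <= / 10000) by (apply Rinv_le_contravar; lra).
    (* uncertainty principle: M^2 <= <s^2 x^2> <v'^2> *)
    assert (B : h <= 28 / 45 * E ^ 2 + h * E / 5).
    { specialize (J3 (2 * k * E / 3) 1).
      assert (X : 0 <= (2 * k * E / 3 * (2 * (E / 3) + 2 * (2 * E / 15 + 3 * h / 20)) - 1) * (2 * k * E / 3) * M) by lra.
      assert (Y : 0 <= 2 * k * E / 3 * (2 * (E / 3) + 2 * (2 * E / 15 + 3 * h / 20)) - 1).
      { apply Rnot_lt_le. intros N.
        assert (P : 0 < (2 * k * E / 3) * M) by (repeat apply Rmult_lt_0_compat; lra).
        assert (W := Rmult_lt_compat_r _ _ _ P N). lra. }
      apply (Rmult_le_compat_l h) in Y; [|lra].
      replace (h * (2 * k * E / 3 * (2 * (E / 3) + 2 * (2 * E / 15 + 3 * h / 20)) - 1)) with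
        ((k * h) * (2 * E / 3 * (2 * (E / 3) + 2 * (2 * E / 15 + 3 * h / 20))) - h) in Y by field.
      rewrite hk in Y. lra. }
    (* J2 with the least-squares choice y = m3 / m2, z = m2 / M *)
    assert (C : E ^ 2 / 9 + 4 * E / 75 <= (10 * E ^ 2 / 3 - 8 * E / 5 + 51 / 5 * h) / 14).
    { set (y := (2 * E / 15 + 3 * h / 20) / (E / 3)).
      specialize (J2 y (E / 3)).
      assert (Ey : y * (E / 3) = 2 * E / 15 + 3 * h / 20) by (unfold y; field; lra).
      assert (X : 0 <= ((10 * E ^ 2 / 3 - 8 * E / 5 + 51 / 5 * h) / 14 - y * (2 * E / 15 + 3 * h / 20) - (E / 3) ^ 2) * M).
      { replace (_ * M) with ((10 * E ^ 2 / 3 - 8 * E / 5 + 51 / 5 * h) / 14 * M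
          - 2 * y * ((2 * E / 15 + 3 * h / 20) * M) + (y * (y * (E / 3)) - 2 * (E / 3) * (E / 3)) * M + (E / 3) ^ 2 * M).
        - lra.
        - rewrite Ey. field. }
      assert (Y : 0 <= (10 * E ^ 2 / 3 - 8 * E / 5 + 51 / 5 * h) / 14 - y * (2 * E / 15 + 3 * h / 20) - (E / 3) ^ 2).
      { apply Rnot_lt_le. intros N. assert (W := Rmult_lt_compat_r M _ _ M0 N). lra. }
      assert (W : 2 / 5 <= y) by nra.
      nra. }
    (* For E < 6/5 the least-squares bound leaves only E <= 48 h, while the uncertainty bound gives
       h <= E^2. Together they force E >= 1/48, against E <= 48 / 10000. *)
    assert (D1 : h * 51 / 5 >= 16 / 75 * E) by nra.
    assert (D2 : h <= E ^ 2) by nra.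
    assert (D3 : E <= 48 * h) by lra.
    assert (D4 : h <= 48 * h * E) by nra.
    assert (D5 : / 48 <= E) by nra.
    lra.
Qed.

(** * The function F *)

(* With r = sqrt E and x = sqrt (2 + 2 r) sin y, the integrand of F becomes
   2 sqrt 2 (r / sqrt Q - sqrt Q). *)
Definition Qf (r y : R) : R := (1 + r) * sin y ^ 2 + r - 1.
Definition gf (r y : R) : R := r / sqrt (Qf r y) - sqrt (Qf r y).
Definition gf' (r y : R) : R :=
  - (sin y ^ 2 * (1 + sin y ^ 2) * r + (1 - sin y ^ 2) ^ 2) * / (2 * (Qf r y * sqrt (Qf r y))).

Lemma Qf_pos r y : 1 < r -> 0 < Qf r y.
Proof. intros Hr. unfold Qf. assert (Z := pow2_ge_0 (sin y)). nra. Qed.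

Lemma gf_derive r y : 1 < r -> is_derive (fun z => gf z y) r (gf' r y).
Proof.
  intros Hr. assert (HQ := Qf_pos r y Hr). unfold gf, gf'.
  assert (Hs := sqrt_lt_R0 _ HQ). assert (Hss := sqrt_sqrt _ (Rlt_le _ _ HQ)).
  unfold Qf in *.
  auto_derive.
  - replace ((1 + r) * (sin y * (sin y * 1)) + r + - (1)) with ((1 + r) * sin y ^ 2 + r - 1) by ring.
    repeat split; trivial; apply Rgt_not_eq; lra.
  - set (w := sqrt ((1 + r) * sin y ^ 2 + r - 1)) in *.
    replace ((1 + r) * (sin y * (sin y * 1)) + r + - (1)) with (w * w) by (rewrite Hss; ring).
    rewrite sqrt_square by lra. rewrite <- Hss. clearbody w. clear HQ.
    set (s := sin y) in *. clearbody s.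
    assert (Hs2 : 0 < s ^ 2 + 1) by (assert (Z := pow2_ge_0 s); lra).
    (* Eliminating r through w^2 = Q leaves a rational identity in w and s. *)
    assert (Er : r = (w * w + 1 - s ^ 2) / (s ^ 2 + 1)) by (rewrite Hss; field; lra).
    rewrite Er. field. split; lra.
Qed.

Lemma gf'_neg r y : 1 < r -> gf' r y < 0.
Proof.
  intros Hr. assert (HQ := Qf_pos r y Hr). unfold gf'.
  assert (Hs := sqrt_lt_R0 _ HQ).
  assert (P : 0 < / (2 * (Qf r y * sqrt (Qf r y)))).
  { apply Rinv_0_lt_compat. repeat apply Rmult_lt_0_compat; lra. }
  set (s := sin y ^ 2). assert (Z : 0 <= s) by apply pow2_ge_0. clearbody s.
  assert (N : 0 < s * (1 + s) * r + (1 - s) ^ 2).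
  { destruct Z as [Hs0 | <-]; [|lra].
    assert (Z2 := pow2_ge_0 (1 - s)).
    assert (0 < s * (1 + s) * r) by (repeat apply Rmult_lt_0_compat; lra). lra. }
  nra.
Qed.

Lemma gf_cont r y : 1 < r -> continuous (gf r) y.
Proof.
  intros Hr. assert (HQ := Qf_pos r y Hr). assert (Hs := sqrt_lt_R0 _ HQ).
  apply (ex_derive_continuous (gf r)). unfold gf, Qf in *. auto_derive.
  replace ((1 + r) * (sin y * (sin y * 1)) + r + - (1)) with ((1 + r) * sin y ^ 2 + r - 1) by ring.
  repeat split; trivial; apply Rgt_not_eq; lra.
Qed.

Lemma gf'_cont r y : 1 < r -> continuous (gf' r) y.
Proof.
  intros Hr. assert (HQ := Qf_pos r y Hr). assert (Hs := sqrt_lt_R0 _ HQ).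
  assert (HP := Rmult_lt_0_compat _ _ HQ Hs).
  apply (ex_derive_continuous (gf' r)). unfold gf', Qf in *. auto_derive.
  replace ((1 + r) * (sin y * (sin y * 1)) + r + - (1)) with ((1 + r) * sin y ^ 2 + r - 1) by ring.
  repeat split; trivial. apply Rgt_not_eq. lra.
Qed.

Lemma gf'_cont_2d r y : 1 < r -> continuity_2d_pt gf' r y.
Proof.
  intros Hr. assert (HQ := Qf_pos r y Hr). assert (Hs := sqrt_lt_R0 _ HQ).
  assert (CS : continuity_2d_pt (fun _ v => sin v ^ 2) r y).
  { apply (continuity_1d_2d_pt_comp (fun v => sin v ^ 2) (fun _ v => v)); [|apply continuity_2d_pt_id2].
    apply continuity_pt_filterlim, (ex_derive_continuous (fun v => sin v ^ 2)). auto_derive. trivial. }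
  assert (C1 := continuity_2d_pt_const r y 1). assert (C2 := continuity_2d_pt_const r y 2).
  assert (Cr := continuity_2d_pt_id1 r y).
  assert (CQ : continuity_2d_pt Qf r y).
  { unfold Qf.
    apply (continuity_2d_pt_minus (fun u v => (1 + u) * sin v ^ 2 + u)); trivial.
    apply (continuity_2d_pt_plus (fun u v => (1 + u) * sin v ^ 2)); trivial.
    apply (continuity_2d_pt_mult (fun u v => 1 + u)); trivial.
    now apply (continuity_2d_pt_plus (fun u v => 1)). }
  assert (CsQ : continuity_2d_pt (fun u v => sqrt (Qf u v)) r y).
  { apply (continuity_1d_2d_pt_comp sqrt Qf); trivial.
    apply continuity_pt_sqrt. lra. }
  unfold gf'.
  apply (continuity_2d_pt_mult (fun r y => - (sin y ^ 2 * (1 + sin y ^ 2) * r + (1 - sin y ^ 2) ^ 2))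
    (fun r y => / (2 * (Qf r y * sqrt (Qf r y))))).
  - apply (continuity_2d_pt_opp (fun r y => sin y ^ 2 * (1 + sin y ^ 2) * r + (1 - sin y ^ 2) ^ 2)).
    apply (continuity_2d_pt_plus (fun r y => sin y ^ 2 * (1 + sin y ^ 2) * r)).
    + apply (continuity_2d_pt_mult (fun r y => sin y ^ 2 * (1 + sin y ^ 2))); trivial.
      apply (continuity_2d_pt_mult (fun r y => sin y ^ 2)); trivial.
      now apply (continuity_2d_pt_plus (fun r y => 1)).
    + apply (continuity_2d_pt_ext (fun r y => (1 - sin y ^ 2) * (1 - sin y ^ 2))); [intros; ring|].
      apply (continuity_2d_pt_mult (fun r y => 1 - sin y ^ 2));
      now apply (continuity_2d_pt_minus (fun r y => 1)).
  - apply (continuity_2d_pt_inv (fun r y => 2 * (Qf r y * sqrt (Qf r y)))).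
    + apply (continuity_2d_pt_mult (fun r y => 2)); trivial.
      now apply (continuity_2d_pt_mult Qf).
    + assert (0 < Qf r y * sqrt (Qf r y)) by now apply Rmult_lt_0_compat. lra.
Qed.

Lemma continuous_RInt_param (f : R -> R -> R) (a b x d : R) : a < b -> 0 < d ->
  (forall y, Rabs (y - x) < d -> forall t, continuous (f y) t) ->
  (forall t, a <= t <= b -> continuity_2d_pt f x t) ->
  continuous (fun y => RInt (f y) a b) x.
Proof.
  intros Hab Hd Hc H2.
  apply continuity_pt_filterlim. intros eps Heps.
  assert (He : 0 < eps / (2 * (b - a))) by (apply Rdiv_lt_0_compat; lra).
  destruct (uniform_continuity_2d_1d' f a b x H2 (mkposreal _ He)) as [del Hdel].
  simpl in Hdel. assert (Pd := cond_pos del).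
  exists (Rmin d del). split; [now apply Rmin_glb_lt|].
  intros y [_ Hy]. simpl in Hy. unfold R_dist in Hy.
  assert (L1 := Rmin_l d del). assert (L2 := Rmin_r d del).
  simpl. unfold R_dist.
  assert (Ey : ex_RInt (f y) a b) by (apply ex_RInt_cont, Hc; lra).
  assert (Ex : ex_RInt (f x) a b).
  { apply ex_RInt_cont, Hc. unfold Rminus. rewrite Rplus_opp_r, Rabs_R0. lra. }
  replace (RInt (f y) a b - RInt (f x) a b) with (RInt (fun t => f y t - f x t) a b)
    by now apply (RInt_minus (f y) (f x)).
  apply (Rle_lt_trans _ ((b - a) * (eps / (2 * (b - a))))).
  - apply (norm_RInt_le_const (fun t => f y t - f x t) a b); [lra| |].
    + intros t Ht. left. apply (Hdel t x t y); trivial; try lra.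
      * assert (Hy' : Rabs (y - x) < del) by lra. apply Rabs_lt_between in Hy'. lra.
      * unfold Rminus. rewrite Rplus_opp_r, Rabs_R0. lra.
    + now apply RInt_correct_R, (ex_RInt_minus (f y) (f x)).
  - replace ((b - a) * (eps / (2 * (b - a)))) with (eps / 2) by (field; lra). lra.
Qed.

Definition Phi (r : R) : R := RInt (gf r) 0 (PI / 2).
Definition Phi' (r : R) : R := RInt (gf' r) 0 (PI / 2).

Lemma locally_gt1 (r : R) : 1 < r -> locally r (fun z => 1 < z).
Proof. intros Hr. now apply (open_gt 1 r). Qed.

Lemma Phi_derive r : 1 < r -> is_derive Phi r (Phi' r).
Proof.
  intros Hr. assert (HPI := PI_RGT_0).
  assert (E : Phi' r = RInt (fun t => Derive (fun u => gf u t) r) 0 (PI / 2)).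
  { apply RInt_ext. intros t _. symmetry. now apply is_derive_unique, gf_derive. }
  rewrite E.
  apply (is_derive_RInt_param gf 0 (PI / 2) r).
  - apply (filter_imp (fun z => 1 < z)); [|now apply locally_gt1].
    intros z Hz t _. exists (gf' z t). now apply gf_derive.
  - intros t _. apply (continuity_2d_pt_ext_loc gf'); [|now apply gf'_cont_2d].
    exists (mkposreal (r - 1) ltac:(lra)). simpl. intros u v Hu _.
    symmetry. apply is_derive_unique, gf_derive. apply Rabs_lt_between in Hu. lra.
  - apply (filter_imp (fun z => 1 < z)); [|now apply locally_gt1].
    intros z Hz. apply ex_RInt_cont. intros t. now apply gf_cont.
Qed.

Lemma Phi'_cont r : 1 < r -> continuous Phi' r.
Proof.
  intros Hr. assert (HPI := PI_RGT_0).
  apply (continuous_RInt_param gf' 0 (PI / 2) r (r - 1)); try lra.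
  - intros y Hy t. apply gf'_cont. apply Rabs_lt_between in Hy. lra.
  - intros t _. now apply gf'_cont_2d.
Qed.

Lemma Phi_decreasing r r1 : 1 < r -> r < r1 -> Phi r1 < Phi r.
Proof.
  intros Hr Hr1. assert (HPI := PI_RGT_0).
  apply RInt_lt; [lra | intros; apply gf_cont; lra | intros; apply gf_cont; lra|].
  intros t _.
  destruct (MVT_gen (fun z => gf z t) r r1 (fun z => gf' z t)) as [c [Hc E]].
  - rewrite Rmin_left, Rmax_right by lra. intros x Hx. apply gf_derive. lra.
  - rewrite Rmin_left, Rmax_right by lra. intros x Hx.
    apply continuity_pt_filterlim, (ex_derive_continuous (fun z => gf z t)).
    exists (gf' x t). apply gf_derive. lra.
  - rewrite Rmin_left, Rmax_right in Hc by lra.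
    assert (N := gf'_neg c t ltac:(lra)). nra.
Qed.

(** At r = 2 the integrand is convex in sin y ^ 2 with end values 1 and -1, so it lies below the
    chord 1 - 2 sin y ^ 2 = cos (2 y), whose integral is 0. *)
Lemma Phi_2_neg : Phi 2 <= 0.
Proof.
  assert (HPI := PI_RGT_0).
  assert (Z : is_RInt (fun y => 1 - 2 * sin y ^ 2) 0 (PI / 2) (sin (PI / 2) * cos (PI / 2) - sin 0 * cos 0)).
  { apply (is_RInt_derive (fun y => sin y * cos y)).
    - intros y _. auto_derive; trivial. assert (S := sin2_cos2 y). unfold Rsqr in S.
      simpl. lra.
    - intros y _. apply (ex_derive_continuous (fun y => 1 - 2 * sin y ^ 2)). auto_derive. trivial. }
  apply (is_RInt_unique (V := R_CompleteNormedModule)) in Z. rewrite cos_PI2, sin_0 in Z.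
  apply (Rle_trans _ (RInt (fun y => 1 - 2 * sin y ^ 2) 0 (PI / 2))); [|rewrite Z; lra].
  apply RInt_le; [lra | apply ex_RInt_cont; intros; apply gf_cont; lra | |].
  { apply ex_RInt_cont. intros y. apply (ex_derive_continuous (fun y => 1 - 2 * sin y ^ 2)).
    auto_derive. trivial. }
  intros y _. unfold gf. assert (HQ := Qf_pos 2 y ltac:(lra)).
  assert (Hs := sqrt_lt_R0 _ HQ). assert (Hss := sqrt_sqrt _ (Rlt_le _ _ HQ)).
  set (w := sqrt (Qf 2 y)) in *. unfold Qf in Hss.
  assert (SC := sin2_cos2 y). unfold Rsqr in SC.
  assert (Z1 := pow2_ge_0 (sin y)). assert (Z2 := pow2_ge_0 (cos y)).
  assert (W1 : 1 <= w) by nra. assert (W2 : w <= 2) by nra.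
  replace (1 - 2 * sin y ^ 2) with ((5 - 2 * (w * w)) / 3) by lra.
  (* chord inequality: 2 w^3 - 3 w^2 - 5 w + 6 = (w - 1)(w - 2)(2 w + 3) *)
  assert (C : (w - 1) * (2 - w) * (2 * w + 3) >= 0).
  { apply Rle_ge. repeat apply Rmult_le_pos; lra. }
  apply (Rmult_le_reg_r w); [trivial|].
  replace ((2 / w - w) * w) with (2 - w * w) by (field; lra). lra.
Qed.

(** As r tends to 1 the integrand approaches 1 / (sqrt 2 y) near 0 and Phi diverges logarithmically
    to +oo; an explicit r close to 1 lets crude bounds suffice. *)
Lemma Phi_near_1_pos : exists r, 1 < r < 2 /\ 0 <= Phi r.
Proof.
  set (eta := / 10000). exists (1 + eta ^ 2).
  assert (He : 0 < eta ^ 2 <= / 10000) by (unfold eta; lra).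
  split; [lra|].
  assert (HPI := PI2_1). assert (HPI4 := PI_4).
  set (r := 1 + eta ^ 2) in *.
  set (c := sqrt 2). assert (Hc : 0 < c) by (apply sqrt_lt_R0; lra).
  assert (Hcc : c * c = 2) by (apply sqrt_sqrt; lra).
  (* A minorant with an elementary primitive: Q <= 2 y^2 + 2 eta^2 <= 2 (y + eta)^2, and 1 / w - w
     decreases in w. *)
  set (low := fun y => / (c * (y + eta)) - c * (y + eta)).
  assert (HI : is_RInt low 0 (PI / 2) ((ln (PI / 2 + eta) / c - c * (PI / 2 + eta) ^ 2 / 2)
       - (ln (0 + eta) / c - c * (0 + eta) ^ 2 / 2))).
  { apply (is_RInt_derive (fun y => ln (y + eta) / c - c * (y + eta) ^ 2 / 2) low).
    - rewrite Rmin_left, Rmax_right by lra. intros y Hy.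
      assert (0 < y + eta) by (unfold eta; lra).
      unfold low. auto_derive; [lra|]. field. lra.
    - rewrite Rmin_left, Rmax_right by lra. intros y Hy.
      assert (0 < y + eta) by (unfold eta; lra).
      apply (ex_derive_continuous low). unfold low. auto_derive.
      assert (0 < c * (y + eta)) by now apply Rmult_lt_0_compat. lra. }
  apply (Rle_trans _ (RInt low 0 (PI / 2))).
  - rewrite (is_RInt_unique _ _ _ _ HI).
    (* The quotient inside the logarithm exceeds 10000 > 3^8 >= exp 8. Then 8 / (3/2) outweighs (3/2
       * 5) / 2, the bound for the quadratic part. *)
    assert (Hl : 8 <= ln (PI / 2 + eta) - ln (0 + eta)).
    { rewrite <- ln_div by (unfold eta; lra).
      apply (Rle_trans _ (ln (exp 8))); [rewrite ln_exp; lra|].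
      apply ln_le; [apply exp_pos|].
      replace 8 with (INR 8 * 1) by (simpl; ring). rewrite exp_INR_mult.
      apply (Rle_trans _ (3 ^ 8)).
      - apply pow_incr. split; [left; apply exp_pos | apply exp_le_3].
      - apply Rle_div_r; unfold eta; lra. }
    assert (Hc2 : c <= 3 / 2) by nra.
    replace (_ - _) with ((ln (PI / 2 + eta) - ln (0 + eta)) / c
      - c * ((PI / 2 + eta) ^ 2 - eta ^ 2) / 2) by (field; lra).
    assert (A1 : 8 / (3 / 2) <= (ln (PI / 2 + eta) - ln (0 + eta)) / c).
    { apply Rmult_le_compat; try lra. apply Rinv_le_contravar; lra. }
    assert (A2 : c * ((PI / 2 + eta) ^ 2 - eta ^ 2) <= 3 / 2 * 5).
    { apply Rmult_le_compat; try lra; unfold eta; nra. }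
    lra.
  - apply RInt_le; [lra | eexists; exact HI | apply ex_RInt_cont; intros; apply gf_cont; unfold r; lra|].
    intros y Hy. unfold low, gf.
    assert (HQ := Qf_pos r y ltac:(unfold r; lra)).
    assert (Hs := sqrt_lt_R0 _ HQ).
    assert (Hye : 0 < c * (y + eta)) by (apply Rmult_lt_0_compat; unfold eta; lra).
    assert (Hle : sqrt (Qf r y) <= c * (y + eta)).
    { rewrite <- (sqrt_square (c * (y + eta))) by lra. apply sqrt_le_1_alt.
      assert (Hsin : 0 <= sin y <= y).
      { split; [apply sin_ge_0; lra | left; apply sin_lt_x; lra]. }
      assert (Hs1 : sin y ^ 2 <= 1).
      { assert (SC := sin2_cos2 y). unfold Rsqr in SC. assert (Z2 := pow2_ge_0 (cos y)). lra. }
      assert (Hs2 : sin y ^ 2 <= y ^ 2) by (apply pow_incr; lra).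
      replace (c * (y + eta) * (c * (y + eta))) with (2 * (y + eta) ^ 2)
        by (rewrite <- Hcc; ring).
      unfold Qf, r. assert (0 <= y * eta) by (apply Rmult_le_pos; unfold eta; lra). nra. }
    apply Rplus_le_compat; [|lra].
    apply (Rle_trans _ (/ sqrt (Qf r y))).
    + apply Rinv_le_contravar; lra.
    + unfold Rdiv. rewrite <- (Rmult_1_l (/ sqrt (Qf r y))) at 1.
      apply Rmult_le_compat_r; [left; now apply Rinv_0_lt_compat | unfold r; lra].
Qed.

(** * The change of variable in F *)

Section substitution.
Variable E : R.
Hypothesis HE : 1 < E.

Lemma sqrt_E_gt1 : 1 < sqrt E.
Proof. rewrite <- sqrt_1. apply sqrt_lt_1_alt. lra. Qed.

Lemma sqrt_E_sq : sqrt E * sqrt E = E.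
Proof. apply sqrt_sqrt. lra. Qed.

Lemma F_upper_sq : F_upper E ^ 2 = 2 + 2 * sqrt E.
Proof.
  unfold F_upper. simpl. rewrite Rmult_1_r. apply sqrt_sqrt.
  assert (H := sqrt_E_gt1). lra.
Qed.

Lemma F_upper_gt2 : 2 < F_upper E.
Proof.
  assert (H := sqrt_E_gt1). assert (H2 := F_upper_sq).
  assert (0 <= F_upper E) by apply sqrt_pos. nra.
Qed.

Lemma radicand_factor (x : R) :
  E - (x ^ 2 / 2 - 1) ^ 2 = (F_upper E ^ 2 - x ^ 2) / 2 * (sqrt E - 1 + x ^ 2 / 2).
Proof. rewrite F_upper_sq. assert (H := sqrt_E_sq). rewrite <- H at 1. field. Qed.

Lemma radicand_pos (x : R) : 0 <= x < F_upper E -> 0 < E - (x ^ 2 / 2 - 1) ^ 2.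
Proof.
  intros Hx. rewrite radicand_factor. assert (H := sqrt_E_gt1).
  apply Rmult_lt_0_compat; nra.
Qed.

Lemma F_integrand_cont (x : R) : 0 <= x < F_upper E -> continuous (F_integrand E) x.
Proof.
  intros Hx. assert (H := radicand_pos x Hx). assert (Hs := sqrt_lt_R0 _ H).
  apply (ex_derive_continuous (F_integrand E)). unfold F_integrand. auto_derive.
  unfold Rminus, Rdiv in *. simpl in *. repeat split; trivial; lra.
Qed.

(** Stopping short of pi / 2 keeps the integrand of F continuous on the range; the limit is then
    taken on the regular side only. *)
Lemma RInt_F_substitution (th : R) : 0 <= th < PI / 2 ->
  RInt (F_integrand E) 0 (F_upper E * sin th) = 2 * sqrt 2 * RInt (gf (sqrt E)) 0 th.
Proof.
  intros Hth.
  assert (HX2 := F_upper_sq). assert (HX := F_upper_gt2). assert (Hr := sqrt_E_gt1).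
  assert (Hcos : forall y, 0 <= y <= th -> 0 < cos y /\ 0 <= sin y).
  { intros y Hy. split; [apply cos_gt_0; lra | apply sin_ge_0; lra]. }
  assert (Hlt : forall y, 0 <= y <= th -> 0 <= F_upper E * sin y < F_upper E).
  { intros y Hy. destruct (Hcos y Hy) as [C S]. split; [apply Rmult_le_pos; lra|].
    assert (SC := sin2_cos2 y). unfold Rsqr in SC. assert (sin y < 1) by nra. nra. }
  replace 0 with (F_upper E * sin 0) at 1 by (rewrite sin_0; ring).
  rewrite <- (RInt_comp (F_integrand E) (fun y => F_upper E * sin y) (fun y => F_upper E * cos y) 0 th).
  - transitivity (RInt (fun y => scal (2 * sqrt 2) (gf (sqrt E) y)) 0 th).
    2:{ apply (RInt_scal (gf (sqrt E)) 0 th (2 * sqrt 2)). apply ex_RInt_cont. intros t. now apply gf_cont. }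
    apply RInt_ext. rewrite Rmin_left, Rmax_right by lra. intros y Hy.
    destruct (Hcos y ltac:(lra)) as [C S].
    change (F_upper E * cos y * F_integrand E (F_upper E * sin y) = 2 * sqrt 2 * gf (sqrt E) y).
    unfold F_integrand. rewrite radicand_factor.
    assert (SC := sin2_cos2 y). unfold Rsqr in SC.
    assert (HQ := Qf_pos (sqrt E) y Hr).
    assert (Hs := sqrt_lt_R0 _ HQ). assert (Hss := sqrt_sqrt _ (Rlt_le _ _ HQ)).
    set (rr := sqrt E) in *.
    replace ((F_upper E ^ 2 - (F_upper E * sin y) ^ 2) / 2 * (rr - 1 + (F_upper E * sin y) ^ 2 / 2))
      with ((F_upper E * cos y / sqrt 2) ^ 2 * Qf rr y).
    2:{ unfold Rdiv. rewrite !Rpow_mult_distr, HX2. unfold Qf.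
        replace ((/ sqrt 2) ^ 2) with (/ 2).
        - replace (cos y ^ 2) with (1 - sin y ^ 2) by lra. field.
        - rewrite pow_inv. f_equal. simpl. rewrite Rmult_1_r, sqrt_sqrt; lra. }
    assert (Hq2 : 0 < sqrt 2) by (apply sqrt_lt_R0; lra).
    assert (HXc : 0 < F_upper E * cos y / sqrt 2).
    { apply Rdiv_lt_0_compat; [apply Rmult_lt_0_compat; lra | trivial]. }
    rewrite sqrt_mult_alt by apply pow2_ge_0.
    rewrite sqrt_pow2 by lra.
    rewrite Rpow_mult_distr, HX2. unfold gf.
    set (w := sqrt (Qf rr y)) in *.
    assert (Es : 2 - (2 + 2 * rr) * sin y ^ 2 = 2 * (rr - w * w)) by (rewrite Hss; unfold Qf; ring).
    rewrite Es. field. repeat split; lra.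
  - rewrite Rmin_left, Rmax_right by lra. intros y Hy. apply F_integrand_cont, Hlt, Hy.
  - intros y _. split.
    + auto_derive; trivial. ring.
    + apply (ex_derive_continuous (fun y => F_upper E * cos y)). auto_derive. trivial.
Qed.

(** This explicit form yields the improper integral and is used again to choose the cutoff of the
    multiplier before the turning point. *)
Lemma RInt_F_limit (eps : R) : 0 < eps -> exists b0, 0 <= b0 < F_upper E /\
  forall b, b0 < b < F_upper E ->
    ex_RInt (F_integrand E) 0 b /\
    Rabs (RInt (F_integrand E) 0 b - 2 * sqrt 2 * Phi (sqrt E)) < eps.
Proof.
  intros Heps. assert (HPI := PI_RGT_0).
  assert (HX := F_upper_gt2). assert (Hr := sqrt_E_gt1).
  assert (Cg : forall t, continuous (gf (sqrt E)) t) by (intros; now apply gf_cont).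
  set (G := fun th => 2 * sqrt 2 * RInt (gf (sqrt E)) 0 th).
  assert (HG : continuous G (PI / 2)).
  { apply (continuous_scal_r (2 * sqrt 2) (fun th => RInt (gf (sqrt E)) 0 th)).
    apply (ex_derive_continuous (fun th => RInt (gf (sqrt E)) 0 th)).
    exists (gf (sqrt E) (PI / 2)). now apply is_derive_RInt_cont. }
  destruct (HG (ball (G (PI / 2)) (mkposreal eps Heps)) (locally_ball _ _)) as [d Hd].
  assert (Pd := cond_pos d).
  set (t1 := Rmax 0 (PI / 2 - d / 2)).
  assert (L1 := Rmax_l 0 (PI / 2 - d / 2)). assert (L2 := Rmax_r 0 (PI / 2 - d / 2)).
  fold t1 in L1, L2.
  assert (L3 : t1 < PI / 2) by (apply Rmax_lub_lt; lra).
  assert (S1 : 0 <= sin t1 < 1).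
  { split; [apply sin_ge_0; lra|]. rewrite <- sin_PI2. apply sin_increasing_1; lra. }
  exists (F_upper E * sin t1). split; [split; [apply Rmult_le_pos; lra | nra]|].
  intros b [Hb1 Hb2].
  assert (Hb0 : 0 <= b) by (assert (0 <= F_upper E * sin t1) by (apply Rmult_le_pos; lra); lra).
  split.
  { apply (ex_RInt_continuous (F_integrand E)). rewrite Rmin_left, Rmax_right by lra.
    intros z Hz. apply F_integrand_cont. lra. }
  set (th := asin (b / F_upper E)).
  assert (Hq : 0 <= b / F_upper E < 1).
  { split; [apply Rdiv_le_0_compat; lra | apply Rlt_div_l; lra]. }
  assert (Hsin : sin th = b / F_upper E) by (apply sin_asin; lra).
  assert (HB := asin_bound (b / F_upper E)). fold th in HB.
  assert (T1 : t1 < th).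
  { apply sin_increasing_0; try lra. rewrite Hsin. apply Rlt_div_r; lra. }
  assert (T2 : th < PI / 2).
  { destruct (proj2 HB) as [|Eq]; trivial. rewrite Eq, sin_PI2 in Hsin. lra. }
  replace b with (F_upper E * sin th) by (rewrite Hsin; field; lra).
  rewrite RInt_F_substitution by lra.
  apply (Hd th). change (Rabs (th - PI / 2) < d). apply Rabs_lt_between. lra.
Qed.

Lemma F_is_RInt_gen :
  is_RInt_gen (F_integrand E) (at_point 0) (at_left (F_upper E)) (2 * sqrt 2 * Phi (sqrt E)).
Proof.
  intros P [eps HP].
  destruct (RInt_F_limit eps (cond_pos eps)) as [b0 [Hb0 H]].
  exists (fun a => a = 0) (fun b => b0 < b < F_upper E).
  - reflexivity.
  - exists (mkposreal (F_upper E - b0) ltac:(lra)). intros b Hb Hlt.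
    change (Rabs (b - F_upper E) < F_upper E - b0) in Hb. apply Rabs_lt_between in Hb. lra.
  - intros a b -> Hb. destruct (H b Hb) as [H1 H2].
    exists (RInt (F_integrand E) 0 b). split.
    + now apply RInt_correct_R.
    + apply HP. exact H2.
Qed.

Lemma F_fun_eq : F_fun E = 2 * sqrt 2 * Phi (sqrt E).
Proof.
  apply (is_RInt_gen_unique (F_integrand E)), F_is_RInt_gen.
Qed.

End substitution.

Lemma F_fun_C1 E : 1 < E -> ex_derive F_fun E /\ continuous (Derive F_fun) E.
Proof.
  intros HE.
  set (F' := fun e => 2 * sqrt 2 * (Phi' (sqrt e) * / (2 * sqrt e))).
  assert (HD : forall e, 1 < e -> is_derive F_fun e (F' e)).
  { intros e He. apply (is_derive_ext_loc (fun e => 2 * sqrt 2 * Phi (sqrt e))).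
    - apply (filter_imp (fun z => 1 < z)); [|now apply locally_gt1].
      intros z Hz. symmetry. now apply F_fun_eq.
    - assert (D := Phi_derive (sqrt e) (sqrt_E_gt1 e He)).
      unfold F'. auto_derive.
      + split; [now exists (Phi' (sqrt e)) | split; [lra | trivial]].
      + derive_rw. field. assert (X := sqrt_E_gt1 e He). lra. }
  split; [exists (F' E); now apply HD|].
  apply (continuous_ext_loc (Derive F_fun) F' E).
  - apply (filter_imp (fun z => 1 < z)); [|now apply locally_gt1].
    intros z Hz. symmetry. now apply is_derive_unique, HD.
  - unfold F'. apply (continuous_scal_r (2 * sqrt 2) (fun e => Phi' (sqrt e) * / (2 * sqrt e))).
    apply (continuous_mult (fun e => Phi' (sqrt e)) (fun e => / (2 * sqrt e))).
    + apply (continuous_comp sqrt Phi'); [apply continuous_sqrt|].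
      apply Phi'_cont, sqrt_E_gt1, HE.
    + apply (ex_derive_continuous (fun e => / (2 * sqrt e))). auto_derive.
      assert (X := sqrt_E_gt1 E HE). split; [lra | split; [lra | trivial]].
Qed.

Lemma F_unique_zero : exists Ec, 1 < Ec /\ F_fun Ec = 0 /\
  forall E, 1 < E -> F_fun E = 0 -> E = Ec.
Proof.
  assert (Hq2 : 0 < sqrt 2) by (apply sqrt_lt_R0; lra).
  assert (HZ : exists r, 1 < r /\ Phi r = 0).
  { destruct Phi_near_1_pos as [r0 [Hr0 H0]].
    destruct (Req_dec (Phi r0) 0) as [Z|N]; [exists r0; split; [lra | trivial]|].
    destruct (Req_dec (Phi 2) 0) as [Z2|N2]; [exists 2; split; [lra | trivial]|].
    assert (H2 := Phi_2_neg).
    destruct (IVT_interv (fun r => - Phi r) r0 2) as [z [Hz Ez]]; try lra.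
    - intros x Hx. apply continuity_pt_opp, continuity_pt_filterlim.
      apply (ex_derive_continuous Phi). exists (Phi' x). apply Phi_derive. lra.
    - exists z. lra. }
  destruct HZ as [r [Hr HP]].
  assert (Hrr : 1 < r * r) by nra.
  exists (r * r). split; [trivial|]. split.
  - rewrite F_fun_eq by trivial. rewrite sqrt_square by lra. rewrite HP. ring.
  - intros E HE H0. rewrite F_fun_eq in H0 by trivial.
    assert (HPE : Phi (sqrt E) = 0) by nra.
    assert (X := sqrt_E_gt1 E HE).
    assert (Eq : sqrt E = r).
    { destruct (Rtotal_order (sqrt E) r) as [L|[L|L]]; trivial.
      - assert (Y := Phi_decreasing _ _ X L). lra.
      - assert (Y := Phi_decreasing _ _ Hr L). lra. }
    rewrite <- Eq. symmetry. now apply sqrt_E_sq.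
Qed.

(** * The multiplier *)

Lemma radicand_pos_sym (E x : R) : 1 < E -> - F_upper E < x < F_upper E ->
  0 < E - (x ^ 2 / 2 - 1) ^ 2.
Proof.
  intros HE Hx. rewrite <- (pow2_abs x). apply radicand_pos; trivial.
  split; [apply Rabs_pos | apply Rabs_lt_between; lra].
Qed.

(** The integrands are continuous only inside the allowed interval; taking it symmetric makes 0 an
    interior point, so two-sided derivatives exist there. *)
Lemma is_derive_RInt_local (f : R -> R) (X x : R) :
  (forall y, - X < y < X -> continuous f y) -> - X < x < X -> 0 < X ->
  is_derive (fun z => RInt f 0 z) x (f x).
Proof.
  intros Hc Hx HX. apply (is_derive_RInt f (fun z => RInt f 0 z) 0 x); [|now apply Hc].
  assert (Hd : 0 < Rmin (x + X) (X - x)) by (apply Rmin_glb_lt; lra).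
  exists (mkposreal _ Hd). intros y Hy. change (Rabs (y - x) < Rmin (x + X) (X - x)) in Hy.
  assert (L1 := Rmin_l (x + X) (X - x)). assert (L2 := Rmin_r (x + X) (X - x)).
  apply Rabs_lt_between in Hy.
  apply RInt_correct_R, (ex_RInt_continuous f). intros z Hz. apply Hc.
  destruct (Rle_dec 0 y).
  - rewrite Rmin_left, Rmax_right in Hz by lra. lra.
  - rewrite Rmin_right, Rmax_left in Hz by lra. lra.
Qed.

(* The multiplier solves 2 (E - V) phi' - V' phi = sg (2 - x^2) - d on the
   classically allowed side: phi = P / sqrt (E - V) with
   P' = (sg (2 - x^2) - d) / (2 sqrt (E - V)).  When F(E) <> 0, P does not
   vanish at the turning point, so phi becomes large there and can be
   prolonged by the constant a = phi x1. *)
Lemma multiplier_exists (E : R) : 1 < E -> F_fun E <> 0 ->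
  exists (sg d x1 a C : R) (phi phi' phi'' : R -> R),
    (sg = 1 \/ sg = -1) /\ 0 < d <= 1 /\ 2 <= x1 /\ 0 < E - sv x1 ^ 2 /\ 1 <= a /\ 0 <= C /\
    phi 0 = 0 /\ phi x1 = a /\
    forall x, 0 <= x <= x1 ->
      is_derive phi x (phi' x) /\ is_derive phi' x (phi'' x) /\
      2 * (E - sv x ^ 2) * phi' x - (2 * sv x * x) * phi x = sg * (2 - x ^ 2) - d /\
      Rabs (phi' x) <= C /\ Rabs (phi'' x) <= C.
Proof.
  intros HE HF.
  assert (HX := F_upper_gt2 E HE).
  assert (HFE := F_fun_eq E HE).
  set (X := F_upper E) in *.
  destruct (RInt_F_limit E HE (Rabs (F_fun E) / 2)) as [b0 [Hb0 Hlim]].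
  { assert (Z := Rabs_pos_lt _ HF). lra. }
  fold X in Hb0, Hlim. rewrite <- HFE in Hlim.
  set (F0 := Rabs (F_fun E)) in *. assert (HF0 : 0 < F0) by now apply Rabs_pos_lt.
  (* The sign makes the numerator P positive at the cutoff, so that phi is large and positive there
     rather than negative. *)
  assert (Hsg : exists sg, (sg = 1 \/ sg = -1) /\ sg * F_fun E = F0).
  { unfold F0, Rabs. destruct (Rcase_abs (F_fun E)); [exists (-1) | exists 1]; split; try lra; auto. }
  destruct Hsg as [sg [Hsg HsgF]].
  set (W := fun x => E - (x ^ 2 / 2 - 1) ^ 2).
  assert (HW : forall x, - X < x < X -> 0 < W x) by (intros; now apply radicand_pos_sym).
  assert (HWX : W X = 0).
  { unfold W. rewrite (radicand_factor E HE). fold X. unfold Rdiv. ring. }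
  assert (CW : continuous W X).
  { apply (ex_derive_continuous W). unfold W. auto_derive. trivial. }
  (* P x1 will be at least (F0 / 2 - F0 / 4) / 2 = F0 / 8, so sqrt (W x1) < F0 / 8 gives phi x1 >=
     1. *)
  assert (HF8 : 0 < (F0 / 8) ^ 2) by (apply pow_lt; lra).
  destruct (CW (ball (W X) (mkposreal _ HF8)) (locally_ball _ _)) as [dl Hdl].
  assert (Pdl := cond_pos dl).
  (* Beyond b0 the integral of F is within F0 / 2 of its limit, beyond X - dl / 2 the radicand W is
     small, and 2 serves the tail inequality past the cutoff. *)
  set (bb := Rmax (Rmax b0 2) (X - dl / 2)).
  assert (L1 := Rmax_l (Rmax b0 2) (X - dl / 2)). assert (L2 := Rmax_r (Rmax b0 2) (X - dl / 2)).
  assert (L3 := Rmax_l b0 2). assert (L4 := Rmax_r b0 2).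
  fold bb in L1, L2.
  assert (Hbb : bb < X) by (apply Rmax_lub_lt; [apply Rmax_lub_lt|]; lra).
  set (x1 := (bb + X) / 2).
  assert (Hx1 : bb < x1 < X) by (unfold x1; lra).
  destruct (Hlim x1 ltac:(lra)) as [_ HI1].
  assert (HW1 : 0 < W x1 < (F0 / 8) ^ 2).
  { split; [apply HW; lra|].
    assert (B : ball X dl x1) by (change (Rabs (x1 - X) < dl); apply Rabs_lt_between; lra).
    specialize (Hdl x1 B). rewrite HWX in Hdl. change (Rabs (W x1 - 0) < (F0 / 8) ^ 2) in Hdl.
    apply Rabs_lt_between in Hdl. lra. }
  assert (CsW : forall x, - X < x < X -> continuous (fun y => / sqrt (W y)) x).
  { intros x Hx. assert (H := HW x Hx). assert (Hs := sqrt_lt_R0 _ H).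
    apply (ex_derive_continuous (fun y => / sqrt (W y))). unfold W in *. auto_derive.
    replace (E + - ((x * (x * 1) * / 2 + - (1)) * ((x * (x * 1) * / 2 + - (1)) * 1)))
      with (E - (x ^ 2 / 2 - 1) ^ 2) by (unfold Rdiv; ring).
    repeat split; trivial. apply Rgt_not_eq. lra. }
  set (T1 := RInt (fun y => / sqrt (W y)) 0 x1).
  assert (Hin : forall z, Rmin 0 x1 <= z <= Rmax 0 x1 -> - X < z < X).
  { rewrite Rmin_left, Rmax_right by lra. intros; lra. }
  assert (ET : ex_RInt (fun y => / sqrt (W y)) 0 x1).
  { apply (ex_RInt_continuous (fun y => / sqrt (W y))). intros z Hz. now apply CsW, Hin. }
  assert (EF : ex_RInt (F_integrand E) 0 x1) by (apply (Hlim x1); lra).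
  assert (HT1 : 0 < T1).
  { apply RInt_gt_0; [lra | |].
    - intros x Hx. apply Rinv_0_lt_compat, sqrt_lt_R0, HW. lra.
    - intros z Hz. apply CsW. lra. }
  (* The term d T1 uses up at most half of the guaranteed F0 / 2; the cap 1 is for the tail
     inequality. *)
  set (d := Rmin 1 (F0 / (4 * T1))).
  assert (Hd1 : d <= 1) by apply Rmin_l.
  assert (Hd2 : d * T1 <= F0 / 4).
  { apply (Rle_trans _ (F0 / (4 * T1) * T1)).
    - apply Rmult_le_compat_r; [lra | apply Rmin_r].
    - right. field. lra. }
  assert (Hd0 : 0 < d) by (apply Rmin_glb_lt; [lra | apply Rdiv_lt_0_compat; lra]).
  set (f := fun x => sg * (2 - x ^ 2) - d).
  set (f0 := fun y => f y * / sqrt (W y)).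
  assert (Cf0 : forall x, - X < x < X -> continuous f0 x).
  { intros x Hx. apply continuous_mult_R; [|now apply CsW].
    apply (ex_derive_continuous f). unfold f. auto_derive. trivial. }
  set (P := fun x => / 2 * RInt f0 0 x).
  assert (HP : forall x, - X < x < X -> is_derive P x (/ 2 * f0 x)).
  { intros x Hx. apply (is_derive_scal (fun z => RInt f0 0 z) x (/ 2)).
    apply (is_derive_RInt_local f0 X x); trivial. lra. }
  set (phi := fun x => P x / sqrt (W x)).
  set (phi' := fun x => (f x + (x ^ 3 - 2 * x) * phi x) / (2 * W x)).
  set (phi'' := fun x => ((- 2 * sg * x + (3 * x ^ 2 - 2) * phi x + (x ^ 3 - 2 * x) * phi' x) * W x
      + (x ^ 3 - 2 * x) * (f x + (x ^ 3 - 2 * x) * phi x)) / (2 * (W x) ^ 2)).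
  assert (Hphi : forall x, - X < x < X -> is_derive phi x (phi' x)).
  { intros x Hx. assert (D := HP x Hx). assert (H := HW x Hx). assert (Hs := sqrt_lt_R0 _ H).
    assert (Hss := sqrt_sqrt _ (Rlt_le _ _ H)).
    unfold phi', phi. unfold f0 in D. unfold W in D, H, Hs, Hss |- *.
    auto_derive.
    - replace (E + - ((x * (x * 1) * / 2 + - (1)) * ((x * (x * 1) * / 2 + - (1)) * 1)))
        with (E - (x ^ 2 / 2 - 1) ^ 2) by (unfold Rdiv; ring).
      repeat split; trivial; [eexists; exact D | apply Rgt_not_eq; lra].
    - derive_rw.
      replace (E + - ((x * (x * 1) * / 2 + - (1)) * ((x * (x * 1) * / 2 + - (1)) * 1)))
        with (E - (x ^ 2 / 2 - 1) ^ 2) by (unfold Rdiv; ring).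
      set (w := sqrt (E - (x ^ 2 / 2 - 1) ^ 2)) in *. rewrite <- Hss.
      clearbody w. field. lra. }
  assert (Hphi' : forall x, - X < x < X -> is_derive phi' x (phi'' x)).
  { intros x Hx. assert (D := Hphi x Hx). assert (H := HW x Hx).
    unfold phi'', phi'. fold (phi' x). unfold f. unfold W in H |- *.
    assert (N : E + - ((x * (x * 1) * / 2 + - (1)) * ((x * (x * 1) * / 2 + - (1)) * 1)) =
        E - (x ^ 2 / 2 - 1) ^ 2) by (unfold Rdiv; ring).
    clearbody phi. auto_derive.
    - rewrite N. repeat split; trivial; [eexists; exact D | apply Rgt_not_eq; lra].
    - derive_rw. rewrite N. unfold phi', f, W. set (w := E - (x ^ 2 / 2 - 1) ^ 2) in *.
      clearbody w. field. lra. }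
  assert (Cphi : forall x, - X < x < X -> continuous phi x).
  { intros x Hx. apply (ex_derive_continuous phi). exists (phi' x). now apply Hphi. }
  assert (Cphi' : forall x, - X < x < X -> continuous phi' x).
  { intros x Hx. apply (ex_derive_continuous phi'). exists (phi'' x). now apply Hphi'. }
  assert (Cphi'' : forall x, - X < x < X -> continuous phi'' x).
  { intros x Hx. assert (H := HW x Hx). apply (ex_derive_continuous phi'').
    assert (D := Hphi x Hx). assert (D' := Hphi' x Hx).
    unfold phi'', f, W. clearbody phi phi''.
    assert (N : E + - ((x * (x * 1) * / 2 + - (1)) * ((x * (x * 1) * / 2 + - (1)) * 1)) =
        E - (x ^ 2 / 2 - 1) ^ 2) by (unfold Rdiv; ring). unfold W in H.
    clearbody phi'. auto_derive.
    repeat split; trivial; try (eexists; eassumption).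
    rewrite N. apply Rgt_not_eq. rewrite Rmult_1_r. repeat apply Rmult_lt_0_compat; lra. }
  destruct (bounded_on_segment phi' 0 x1) as [C1 [HC1 HB1]]; [lra | intros; apply Cphi'; lra|].
  destruct (bounded_on_segment phi'' 0 x1) as [C2 [HC2 HB2]]; [lra | intros; apply Cphi''; lra|].
  exists sg, d, x1, (phi x1), (Rmax C1 C2), phi, phi', phi''.
  assert (M1 := Rmax_l C1 C2). assert (M2 := Rmax_r C1 C2).
  split; [trivial|]. split; [lra|]. split; [lra|]. split; [apply HW1|]. split.
  - assert (EP : RInt f0 0 x1 = sg * RInt (F_integrand E) 0 x1 - d * T1).
    { transitivity (RInt (fun y => minus (scal sg (F_integrand E y)) (scal d (/ sqrt (W y)))) 0 x1).
      - apply RInt_ext. intros y _. unfold f0, f, F_integrand, Rdiv.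
        change ((sg * (2 - y ^ 2) - d) * / sqrt (W y) =
         sg * ((2 - y ^ 2) * / sqrt (W y)) - d * / sqrt (W y)). ring.
      - eapply eq_trans.
        + apply (RInt_minus (fun y => scal sg (F_integrand E y)) (fun y => scal d (/ sqrt (W y)))).
          * now apply (ex_RInt_scal (V := R_NormedModule) (F_integrand E)).
          * now apply (ex_RInt_scal (V := R_NormedModule) (fun y => / sqrt (W y))).
        + apply (f_equal2 Rminus).
          * exact (RInt_scal (F_integrand E) 0 x1 sg EF).
          * exact (RInt_scal (fun y => / sqrt (W y)) 0 x1 d ET). }
    assert (HsI : F0 / 2 <= sg * RInt (F_integrand E) 0 x1).
    { apply Rabs_lt_between in HI1. destruct Hsg as [-> | ->]; lra. }
    assert (HPx : F0 / 8 <= P x1) by (unfold P; rewrite EP; lra).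
    assert (Hs := sqrt_lt_R0 _ (proj1 HW1)).
    unfold phi. apply Rle_div_r; [trivial|]. rewrite Rmult_1_l.
    apply (Rle_trans _ (F0 / 8)); [|trivial].
    rewrite <- (sqrt_pow2 (F0 / 8)) by lra. apply sqrt_le_1_alt. lra.
  - split; [lra|]. split; [|split; [reflexivity|]].
    + unfold phi, P. rewrite (RInt_point 0 f0).
      change (/ 2 * 0 / sqrt (W 0) = 0). unfold Rdiv. ring.
    + intros x Hx. split; [apply Hphi; lra|]. split; [apply Hphi'; lra|]. split.
      * change (E - sv x ^ 2) with (W x). assert (H := HW x ltac:(lra)).
        unfold phi', f, sv. field. lra.
      * split; [apply (Rle_trans _ C1); [apply HB1|] | apply (Rle_trans _ C2); [apply HB2|]]; lra.
Qed.

(** * Excluding energies where F does not vanish *)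

Section far_energies.
Variables (k E : R) (v v' : R -> R) (M : R).
Hypothesis CS : critical_state k E v v' M.

Let HS := cs_sol CS.
Let Q := fun x => v' x ^ 2 + k * (E - sv x ^ 2) * v x ^ 2.

(** The v v' terms cancel through the equation, so a constant multiplier produces a pure v^2
    density. *)
Lemma Q_derive x : is_derive Q x (- k * (2 * sv x * x) * v x ^ 2).
Proof.
  unfold Q. destruct (HS x) as [D1 D2]. unfold sv in *.
  auto_derive; [repeat split; trivial; eexists; eassumption|]. derive_rw. field.
Qed.

Lemma Q_lim : is_lim Q p_infty 0.
Proof.
  assert (Pb : poly_bounded (fun x => k * (E - sv x ^ 2))) by (unfold sv; poly_bounded_tac).
  destruct (rapid_bound1 _ (cs_quad_rapid _ _ _ _ _ CS (fun x => k * (E - sv x ^ 2)) (fun _ => 0)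
    (fun _ => 1) Pb (poly_bounded_const 0) (poly_bounded_const 1))) as [C HC].
  apply (is_lim_0_of_bound _ C). intros t Ht. specialize (HC t Ht). unfold Q.
  replace (v' t ^ 2 + k * (E - sv t ^ 2) * v t ^ 2) with
    (k * (E - sv t ^ 2) * v t ^ 2 + 0 * (v t * v' t) + 1 * v' t ^ 2) by ring.
  exact HC.
Qed.

(** With a constant multiplier a beyond x1, c (a Q + k int g v^2) is nondecreasing, and its limit is
    k c l because Q tends to 0. The factor c = 1 or -1 covers both directions. *)
Lemma Q_tail_le (a c x1 l : R) (g : R -> R) : 0 <= x1 -> HI (fun x => g x * v x ^ 2) l ->
  (forall x, x1 <= x -> 0 <= c * (g x - a * (2 * sv x * x))) ->
  c * a * Q x1 + k * c * RInt (fun x => g x * v x ^ 2) 0 x1 <= k * c * l.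
Proof.
  intros Hx1 [Hc Hl] Hg. assert (k0 := cs_k CS).
  assert (HL := is_lim_plus' _ _ _ _ _ (is_lim_scal_l _ (c * a) _ _ Q_lim)
     (is_lim_scal_l _ (k * c) _ _ Hl)).
  cbv beta in HL. rewrite Rmult_0_r, Rplus_0_l in HL.
  apply (is_lim_ge_eventually _ _ _ x1 HL). intros r Hr.
  apply (deriv_nonneg_le (fun x => c * a * Q x + k * c * RInt (fun x => g x * v x ^ 2) 0 x)
    (fun x => k * (c * (g x - a * (2 * sv x * x))) * v x ^ 2)); [lra| |].
  - intros s Hs. assert (D := is_derive_RInt_cont _ 0 s Hc). assert (DQ := Q_derive s).
    set (N := fun x => RInt (fun t : R => g t * v t ^ 2) 0 x) in *.
    change (is_derive (fun x => c * a * Q x + k * c * N x) s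
       (k * (c * (g s - a * (2 * sv s * s))) * v s ^ 2)).
    clearbody N Q. derive_tac.
  - intros s Hs. specialize (Hg s ltac:(lra)).
    apply Rmult_le_pos; [apply Rmult_le_pos; lra | apply pow2_ge_0].
Qed.

(** Multiplier 1, with s^2 + 2 s + 2 - 2 s x = (s - x)^2 because x^2 = 2 s + 2. In the allowed
    region this bounds v and v' pointwise. *)
Lemma Q_upper (x1 m2 : R) : 0 <= x1 -> HI (fun x => sv x ^ 2 * v x ^ 2) m2 ->
  Q x1 <= k * (m2 + 2 * M).
Proof.
  intros Hx1 H2. assert (k0 := cs_k CS).
  assert (H0 := cs_mass CS). assert (H1 := cs_crit CS).
  assert (H : HI (fun x => (sv x ^ 2 + 2 * sv x + 2) * v x ^ 2) (m2 + 2 * M)).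
  { assert (X := HI_plus _ _ _ _ (HI_plus _ _ _ _ H2 (HI_scal 2 _ _ H1)) (HI_scal 2 _ _ H0)).
    rewrite Rmult_0_r, Rplus_0_r in X. eapply HI_ext; [|exact X]. intros t. cbv beta. ring. }
  assert (X := Q_tail_le 1 1 x1 _ _ Hx1 H).
  assert (Y : 0 <= RInt (fun x => (sv x ^ 2 + 2 * sv x + 2) * v x ^ 2) 0 x1).
  { apply RInt_ge_0; [trivial | apply ex_RInt_cont, (proj1 H)|].
    intros x _. apply Rmult_le_pos; [|apply pow2_ge_0].
    assert (Z := pow2_ge_0 (sv x + 1)). lra. }
  assert (Z : forall x, x1 <= x -> 0 <= 1 * (sv x ^ 2 + 2 * sv x + 2 - 1 * (2 * sv x * x))).
  { intros x _. replace (1 * _) with ((sv x - x) ^ 2) by (unfold sv; field). apply pow2_ge_0. }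
  specialize (X Z).
  assert (0 <= k * 1 * RInt (fun x => (sv x ^ 2 + 2 * sv x + 2) * v x ^ 2) 0 x1)
    by (apply Rmult_le_pos; lra).
  lra.
Qed.

(** The derivative of phi Q - phi' v v' is k (2 (E - s^2) phi' - 2 s x phi) v^2 - phi'' v v'. The
    equation of phi turns the first part into -k g v^2 with an error of order E - Es. Criticality
    cancels 2 - x^2 = -2 s in the mean, so g leaves k d M, which the error terms must dominate. *)
Lemma multiplier_estimate (Es eta sg d x1 a C : R) (phi phi' phi'' : R -> R) :
  (sg = 1 \/ sg = -1) -> 0 < d <= 1 -> 2 <= x1 -> 0 < Es - sv x1 ^ 2 -> 1 <= a -> 0 <= C ->
  phi 0 = 0 -> phi x1 = a ->
  (forall x, 0 <= x <= x1 ->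
      is_derive phi x (phi' x) /\ is_derive phi' x (phi'' x) /\
      2 * (Es - sv x ^ 2) * phi' x - (2 * sv x * x) * phi x = sg * (2 - x ^ 2) - d /\
      Rabs (phi' x) <= C /\ Rabs (phi'' x) <= C) ->
  Rabs (E - Es) <= eta -> eta <= (Es - sv x1 ^ 2) / 2 ->
  d <= 2 * eta * C + C * ((E / 3 + 2) * (2 / (Es - sv x1 ^ 2) + 1) / 2 + 1 / 2 + E / 3) / sqrt k.
Proof.
  intros Hsg Hd Hx1 Hw Ha HC Hphi0 Hphi1 Hphi Heta Heta2.
  set (w := Es - sv x1 ^ 2) in *.
  assert (k0 := cs_k CS). assert (M0 := cs_M CS). assert (E0 := cs_E CS).
  assert (H0 := cs_mass CS). assert (H1 := cs_crit CS).
  destruct (cs_moments _ _ _ _ _ CS) as [m2 [m3 [m4 [mk [c [H2 [H3 [H4 [Hk Hc]]]]]]]]].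
  destruct (cs_identities _ _ _ _ _ _ _ _ _ _ CS H2 H3 H4 Hk Hc) as [I1 [_ [_ [I4 _]]]].
  assert (E2 : m2 = E / 3 * M) by lra.
  assert (Ek : mk = 2 * k * E / 3 * M) by (rewrite E2 in I4; lra).
  set (q := sqrt k). assert (q0 : 0 < q) by now apply sqrt_lt_R0.
  assert (qq : q * q = k) by (apply sqrt_sqrt; lra).
  set (g := fun x => d - sg * (2 - x ^ 2)).
  assert (Hg : HI (fun x => g x * v x ^ 2) (d * M)).
  { assert (X := HI_plus _ _ _ _ (HI_scal d _ _ H0) (HI_scal (2 * sg) _ _ H1)).
    rewrite Rmult_0_r, Rplus_0_r in X. eapply HI_ext; [|exact X].
    intros t. cbv beta. unfold g, sv. field. }
  (* Past x1 >= 2, a >= 1 and d <= 1 give g <= 1 + (x^2 - 2) <= 2 a s x for either sign sg. *)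
  assert (T1 : k * (d * M) <= a * Q x1 + k * RInt (fun x => g x * v x ^ 2) 0 x1).
  { assert (X := Q_tail_le a (-1) x1 _ g ltac:(lra) Hg).
    assert (Y : forall x, x1 <= x -> 0 <= -1 * (g x - a * (2 * sv x * x))).
    { intros x Hx. unfold g, sv.
      replace (2 * (x ^ 2 / 2 - 1) * x) with ((x ^ 2 - 2) * x) by field.
      assert (2 <= x ^ 2 - 2) by nra.
      assert (4 <= (x ^ 2 - 2) * x) by nra.
      assert ((x ^ 2 - 2) * x <= a * ((x ^ 2 - 2) * x)) by nra.
      assert (2 * (x ^ 2 - 2) <= (x ^ 2 - 2) * x) by nra.
      destruct Hsg as [-> | ->]; lra. }
    specialize (X Y). lra. }
  assert (Cv : forall t, continuous (fun t : R => v t ^ 2) t) by apply H0.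
  assert (Cv' : forall t, continuous (fun t : R => v' t ^ 2) t) by apply Hk.
  set (N := fun x => RInt (fun t : R => v t ^ 2) 0 x).
  set (L := fun x => RInt (fun t : R => v' t ^ 2) 0 x).
  set (G := fun x => RInt (fun t : R => g t * v t ^ 2) 0 x) in *.
  (* The N and L terms absorb the errors from E - Es and phi'', so that the whole expression is
     nonincreasing on [0, x1]. *)
  assert (T2 : phi x1 * Q x1 - phi' x1 * (v x1 * v' x1) + k * G x1
      - (2 * k * eta * C + C * q / 2) * N x1 - C / (2 * q) * L x1 <=
     phi 0 * Q 0 - phi' 0 * (v 0 * v' 0) + k * G 0
      - (2 * k * eta * C + C * q / 2) * N 0 - C / (2 * q) * L 0).
  { apply (deriv_nonpos_le
     (fun x => phi x * Q x - phi' x * (v x * v' x) + k * G x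
      - (2 * k * eta * C + C * q / 2) * N x - C / (2 * q) * L x)
     (fun x => 2 * k * (E - Es) * phi' x * v x ^ 2 - phi'' x * (v x * v' x)
        - (2 * k * eta * C + C * q / 2) * v x ^ 2 - C / (2 * q) * v' x ^ 2)); [lra| |].
    - intros x Hx. destruct (Hphi x Hx) as [P1 [P2 [P3 _]]].
      assert (DN : is_derive N x (v x ^ 2)) by (apply is_derive_RInt_cont; exact Cv).
      assert (DL : is_derive L x (v' x ^ 2)) by (apply is_derive_RInt_cont; exact Cv').
      assert (DG : is_derive G x (g x * v x ^ 2)).
      { apply (is_derive_RInt_cont (fun t => g t * v t ^ 2)). apply Hg. }
      assert (DQ := Q_derive x). destruct (HS x) as [D1 D2].
      assert (EQ : Q x = v' x ^ 2 + k * (E - sv x ^ 2) * v x ^ 2) by reflexivity.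
      clearbody N L G Q.
      auto_derive; [repeat split; trivial; eexists; eassumption|]. derive_rw.
      rewrite EQ. unfold g.
      replace (sg * (2 - x ^ 2)) with (d + (2 * (Es - sv x ^ 2) * phi' x - 2 * sv x * x * phi x)) by lra.
      field. lra.
    - intros x Hx. destruct (Hphi x Hx) as [_ [_ [_ [B1 B2]]]].
      assert (Z1 := pow2_ge_0 (v x)). assert (Z2 := pow2_ge_0 (v' x)).
      assert (X1 : (E - Es) * phi' x <= eta * C).
      { apply (Rle_trans _ (Rabs ((E - Es) * phi' x))); [apply Rle_abs|].
        rewrite Rabs_mult. apply Rmult_le_compat; trivial; apply Rabs_pos. }
      assert (X2 : 2 * k * ((E - Es) * phi' x) * v x ^ 2 <= 2 * k * (eta * C) * v x ^ 2).
      { apply Rmult_le_compat_r; trivial. apply Rmult_le_compat_l; lra. }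
      (* Weights balanced by q = sqrt k: since v'^2 has integral of order k M, both terms contribute
         order sqrt k M, a k^(-1/2) fraction of k d M. *)
      assert (X3 : Rabs (v x * v' x) <= q / 2 * v x ^ 2 + / (2 * q) * v' x ^ 2).
      { replace (q / 2 * v x ^ 2 + / (2 * q) * v' x ^ 2) with
          (((q * v x) ^ 2 + v' x ^ 2) / (2 * q)) by (field; lra).
        apply Rle_div_r; [lra|].
        rewrite <- (Rabs_pos_eq (2 * q)) by lra. rewrite <- Rabs_mult.
        assert (W := two_mul_between (q * v x) (v' x)). apply Rabs_le_between. lra. }
      assert (X4 : - (phi'' x * (v x * v' x)) <= C * (q / 2 * v x ^ 2 + / (2 * q) * v' x ^ 2)).
      { apply (Rle_trans _ (Rabs (phi'' x * (v x * v' x)))).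
        - rewrite <- Rabs_Ropp. apply Rle_abs.
        - rewrite Rabs_mult. apply Rmult_le_compat; trivial; apply Rabs_pos. }
      unfold Rdiv in *. rewrite Rmult_plus_distr_l in X4. lra. }
  assert (N0 : N 0 = 0) by apply (RInt_point 0 (fun t : R => v t ^ 2)).
  assert (L0 : L 0 = 0) by apply (RInt_point 0 (fun t : R => v' t ^ 2)).
  assert (G0 : G 0 = 0) by apply (RInt_point 0 (fun t : R => g t * v t ^ 2)).
  rewrite N0, L0, G0, Hphi0, (cs_0 CS), Hphi1 in T2.
  assert (NM : N x1 <= M) by (apply (HI_ge_RInt (fun t => v t ^ 2)); trivial; [intros; apply pow2_ge_0 | lra]).
  assert (LM : L x1 <= mk) by (apply (HI_ge_RInt (fun t => v' t ^ 2)); trivial; [intros; apply pow2_ge_0 | lra]).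
  assert (HQ := Q_upper x1 m2 ltac:(lra) H2). unfold Q in HQ at 1.
  apply Rabs_le_between in Heta.
  assert (Z1 := pow2_ge_0 (v x1)). assert (Z2 := pow2_ge_0 (v' x1)).
  (* E differs from Es by at most w / 2, so x1 is still in the allowed region for E and Q x1
     controls v^2 and v'^2 separately. *)
  assert (Hkw : k * (w / 2) * v x1 ^ 2 <= k * (E - sv x1 ^ 2) * v x1 ^ 2).
  { apply Rmult_le_compat_r; trivial. apply Rmult_le_compat_l; [lra|]. unfold w in *. lra. }
  assert (Hkw0 : 0 <= k * (w / 2) * v x1 ^ 2) by (apply Rmult_le_pos; [apply Rmult_le_pos; lra | trivial]).
  set (B := E / 3 + 2).
  assert (EB : m2 + 2 * M = B * M) by (unfold B; rewrite E2; ring).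
  rewrite EB in HQ.
  assert (V1 : v' x1 ^ 2 <= k * (B * M)) by lra.
  assert (V2 : v x1 ^ 2 <= 2 / w * (B * M)).
  { apply (Rmult_le_reg_l (k * (w / 2))); [apply Rmult_lt_0_compat; lra|].
    replace (k * (w / 2) * (2 / w * (B * M))) with (k * (B * M)) by (field; lra). lra. }
  assert (V3 : Rabs (v x1 * v' x1) <= q * (B * (2 / w + 1) / 2 * M)).
  { apply (Rmult_le_reg_l (2 * q)); [lra|].
    apply (Rle_trans _ ((q * v x1) ^ 2 + v' x1 ^ 2)).
    - rewrite <- (Rabs_pos_eq (2 * q)) by lra. rewrite <- Rabs_mult.
      assert (W := two_mul_between (q * v x1) (v' x1)). apply Rabs_le_between. lra.
    - replace ((q * v x1) ^ 2) with (k * v x1 ^ 2) by (rewrite <- qq; ring).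
      replace (2 * q * (q * (B * (2 / w + 1) / 2 * M))) with (k * (2 / w * (B * M)) + k * (B * M))
        by (rewrite <- qq; field; lra).
      apply Rplus_le_compat; trivial. apply Rmult_le_compat_l; lra. }
  assert (V4 : phi' x1 * (v x1 * v' x1) <= C * (q * (B * (2 / w + 1) / 2 * M))).
  { apply (Rle_trans _ (Rabs (phi' x1 * (v x1 * v' x1)))); [apply Rle_abs|].
    rewrite Rabs_mult. apply Rmult_le_compat; trivial; try apply Rabs_pos.
    apply (Hphi x1). lra. }
  assert (V5 : C / (2 * q) * L x1 <= C * (q * (E / 3 * M))).
  { apply (Rle_trans _ (C / (2 * q) * mk)).
    - apply Rmult_le_compat_l; trivial. apply Rdiv_le_0_compat; lra.
    - right. rewrite Ek, <- qq. field. lra. }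
  assert (V6 : (2 * k * eta * C + C * q / 2) * N x1 <= (2 * k * eta * C + C * q / 2) * M).
  { apply Rmult_le_compat_l; trivial.
    assert (0 <= eta) by lra. assert (0 <= 2 * k * eta * C) by (repeat apply Rmult_le_pos; lra).
    assert (0 <= C * q) by (apply Rmult_le_pos; lra). lra. }
  apply (Rmult_le_reg_l (k * M)); [now apply Rmult_lt_0_compat|].
  fold B.
  replace (k * M * (2 * eta * C + C * (B * (2 / w + 1) / 2 + 1 / 2 + E / 3) / q)) with
    (2 * k * eta * C * M + C * (q * (B * (2 / w + 1) / 2 * M)) + C * q / 2 * M + C * (q * (E / 3 * M)))
    by (rewrite <- qq; field; lra).
  lra.
Qed.

End far_energies.

Lemma no_critical_near (Es : R) : 1 < Es -> F_fun Es <> 0 ->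
  exists eta, 0 < eta /\ forall k E v v' M, critical_state k E v v' M ->
    / eta <= k -> Rabs (E - Es) < eta -> False.
Proof.
  intros HEs HF.
  destruct (multiplier_exists Es HEs HF) as
    [sg [d [x1 [a [C [phi [phi' [phi'' [Hsg [Hd [Hx1 [Hw [Ha [HC [P0 [P1 Hphi]]]]]]]]]]]]]]]].
  set (w := Es - sv x1 ^ 2) in *.
  set (B := Es + 1).
  set (Z := C * ((B / 3 + 2) * (2 / w + 1) / 2 + 1 / 2 + B / 3)).
  assert (Hw2 : 0 < 2 / w) by (apply Rdiv_lt_0_compat; lra).
  assert (HZ : 0 <= Z).
  { apply Rmult_le_pos; trivial. unfold B.
    assert (0 <= ((Es + 1) / 3 + 2) * (2 / w + 1)) by (apply Rmult_le_pos; lra). lra. }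
  set (K := (2 * Z / d + 1) ^ 2).
  assert (HZd : 0 <= 2 * Z / d) by (apply Rdiv_le_0_compat; lra).
  assert (HK : 0 < K) by (apply pow_lt; lra).
  (* These choices make the two error terms at most d / 4 and less than 5 d / 8, with sum below d.
     The entry / K turns / eta <= k into K <= k, and 1 bounds E by Es + 1 in the constant Z. *)
  set (eta := Rmin (Rmin 1 (w / 2)) (Rmin (d / (8 * (C + 1))) (/ K))).
  assert (L1 := Rmin_l (Rmin 1 (w / 2)) (Rmin (d / (8 * (C + 1))) (/ K))).
  assert (L2 := Rmin_r (Rmin 1 (w / 2)) (Rmin (d / (8 * (C + 1))) (/ K))).
  fold eta in L1, L2.
  assert (L3 := Rmin_l 1 (w / 2)). assert (L4 := Rmin_r 1 (w / 2)).
  assert (L5 := Rmin_l (d / (8 * (C + 1))) (/ K)). assert (L6 := Rmin_r (d / (8 * (C + 1))) (/ K)).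
  assert (HiK : 0 < / K) by now apply Rinv_0_lt_compat.
  assert (Hd8 : 0 < d / (8 * (C + 1))) by (apply Rdiv_lt_0_compat; lra).
  assert (Heta : 0 < eta) by (apply Rmin_glb_lt; apply Rmin_glb_lt; lra).
  exists eta. split; trivial. intros k E v v' M CS Hk HE.
  assert (HkK : K <= k).
  { apply (Rle_trans _ (/ eta)); trivial. rewrite <- (Rinv_inv K).
    apply Rinv_le_contravar; lra. }
  assert (X := multiplier_estimate k E v v' M CS Es eta sg d x1 a C phi phi' phi'' Hsg Hd Hx1 Hw Ha HC
    P0 P1 Hphi ltac:(lra) ltac:(fold w; lra)). fold w in X.
  assert (Hq : 2 * Z / d + 1 <= sqrt k).
  { rewrite <- (sqrt_pow2 (2 * Z / d + 1)) by lra. now apply sqrt_le_1_alt. }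
  assert (EB : E <= B) by (unfold B; apply Rabs_lt_between in HE; lra).
  assert (E0 := cs_E CS).
  assert (X1 : C * ((E / 3 + 2) * (2 / w + 1) / 2 + 1 / 2 + E / 3) <= Z).
  { apply Rmult_le_compat_l; trivial.
    assert ((E / 3 + 2) * (2 / w + 1) <= (B / 3 + 2) * (2 / w + 1)) by (apply Rmult_le_compat_r; lra).
    lra. }
  assert (X2 : C * ((E / 3 + 2) * (2 / w + 1) / 2 + 1 / 2 + E / 3) / sqrt k < d / 2 + d / 8).
  { apply Rlt_div_l; [lra|].
    assert (d * (2 * Z / d + 1) <= d * sqrt k) by (apply Rmult_le_compat_l; lra).
    replace (d * (2 * Z / d + 1)) with (2 * Z + d) in H by (field; lra). lra. }
  assert (X3 : eta * C <= d / 8).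
  { apply (Rle_trans _ (d / (8 * (C + 1)) * C)); [apply Rmult_le_compat_r; lra|].
    replace (d / (8 * (C + 1)) * C) with (d / 8 * (C / (C + 1))) by (field; lra).
    assert (C / (C + 1) <= 1) by (apply Rle_div_l; lra).
    assert (d / 8 * (C / (C + 1)) <= d / 8 * 1) by (apply Rmult_le_compat_l; lra). lra. }
  lra.
Qed.

(** * Critical points *)

Lemma HI_rescale (f : R -> R) (l c : R) : 0 < c -> HI f l -> HI (fun x => f (c * x)) (l / c).
Proof.
  intros Hc [Hf Hl].
  split; [now apply continuous_linear|].
  apply (is_lim_ext (fun r => / c * RInt f 0 (c * r))); [intros r; rewrite RInt_linear by (trivial; lra); reflexivity|].
  unfold Rdiv. rewrite (Rmult_comm l).
  apply (is_lim_scal_l (fun r => RInt f 0 (c * r)) (/ c) p_infty l).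
  apply is_lim_spec. apply is_lim_spec in Hl. intros eps.
  destruct (Hl eps) as [M HM]. exists (M / c). intros r Hr. apply HM.
  apply Rlt_div_l in Hr; lra.
Qed.

Lemma rapid_rescale (f : R -> R) (c : R) : 0 < c -> rapid f -> rapid (fun x => f (c * x)).
Proof.
  intros Hc Hf n. destruct (Hf n) as [C HC]. exists ((1 + / c) ^ n * C).
  intros t Ht. assert (Hic : 0 < / c) by now apply Rinv_0_lt_compat.
  assert (Hct : 0 <= c * t) by (apply Rmult_le_pos; lra).
  specialize (HC (c * t) Hct).
  assert (X : (1 + t) ^ n <= (1 + / c) ^ n * (1 + c * t) ^ n).
  { rewrite <- Rpow_mult_distr. apply pow_incr. split; [lra|].
    replace ((1 + / c) * (1 + c * t)) with (1 + t + (c * t + / c)) by (field; lra). lra. }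
  apply (Rle_trans _ (Rabs (f (c * t)) * ((1 + / c) ^ n * (1 + c * t) ^ n))).
  - apply Rmult_le_compat_l; [apply Rabs_pos | trivial].
  - assert (P : 0 <= (1 + / c) ^ n) by (apply pow_le; lra). nra.
Qed.

Lemma critical_alpha_pos b a e : HI (fun t => solM b a e t ^ 2 * (t ^ 2 - 2 * a)) 0 -> 0 < a.
Proof.
  intros H. apply Rnot_le_lt. intros Ha.
  assert (0 < 0); [|lra]. apply (HI_pos _ 0) with (3 := H).
  - intros t _. apply Rmult_le_pos; [apply pow2_ge_0|]. assert (Z := pow2_ge_0 t). lra.
  - destruct (solM_nonzero_point b a e) as [t [Ht Hn]]. exists t. split; [lra|].
    apply Rmult_lt_0_compat; [now apply pow2_gt_0|].
    assert (0 < t ^ 2) by (apply pow_lt; lra). lra.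
Qed.

Lemma critical_state_of_eigt b a e : eigt b a e ->
  HI (fun t => solM b a e t ^ 2 * (t ^ 2 - 2 * a)) 0 ->
  exists v v' M, critical_state (a ^ 3) (e / a ^ 2) v v' M.
Proof.
  intros Hg Hcrit. assert (Ha := critical_alpha_pos b a e Hcrit).
  set (c := sqrt a). assert (Hc : 0 < c) by now apply sqrt_lt_R0.
  assert (Hcc : c ^ 2 = a) by (apply pow2_sqrt; lra).
  assert (HS := solM_Sol b a e).
  destruct (eigt_HI_sq b a e Hg) as [l Hl].
  set (u := solM b a e) in *. set (u' := solM' b a e) in *.
  exists (fun x => u (c * x)), (fun x => c * u' (c * x)), (l / c).
  constructor.
  - now apply pow_lt.
  - apply Rdiv_lt_0_compat; [exact (eigt_pos b a e Hg) | now apply pow_lt].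
  - intros x. destruct (HS (c * x)) as [D1 D2]. split.
    + auto_derive; [now exists (u' (c * x))|]. derive_rw. ring.
    + auto_derive; [now exists (qM a e (c * x) * u (c * x))|]. derive_rw.
      unfold qM, VM, sv. replace ((c * x) ^ 2) with (a * x ^ 2) by (rewrite <- Hcc; ring).
      rewrite <- Hcc. field. lra.
  - rewrite Rmult_0_r. unfold u, u'. destruct (solM_0 b a e) as [-> ->]. destruct b; ring.
  - apply (rapid_dom _ (fun x => u (c * x) ^ 2 + u' (c * x) ^ 2) (1 + a)).
    + intros t _. assert (Z1 := pow2_ge_0 (u (c * t))). assert (Z2 := pow2_ge_0 (u' (c * t))).
      rewrite Rpow_mult_distr, Hcc. rewrite Rabs_pos_eq; nra.
    + apply (rapid_rescale (fun t => u t ^ 2 + u' t ^ 2) c Hc). exact (eigt_rapid b a e Hg).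
  - apply Rdiv_lt_0_compat; trivial. apply (HI_pos (fun t => u t ^ 2)); trivial.
    + intros; apply pow2_ge_0.
    + destruct (solM_nonzero_point b a e) as [t [Ht Hn]]. exists t. split; [lra|].
      now apply pow2_gt_0.
  - exact (HI_rescale (fun t => u t ^ 2) l c Hc Hl).
  - assert (H := HI_scal (/ (2 * a)) _ _ (HI_rescale _ 0 c Hc Hcrit)).
    replace (/ (2 * a) * (0 / c)) with 0 in H by (field; lra).
    eapply HI_ext; [|exact H]. intros t. cbv beta. unfold sv.
    replace ((c * t) ^ 2) with (a * t ^ 2) by (rewrite <- Hcc; ring). field. lra.
Qed.

Lemma critical_point_state (j : nat) (a : R) : (1 <= j)%nat -> A_crit j a ->
  0 < a /\ 0 < lamM j a /\
  exists v v' M, critical_state (a ^ 3) (lamM j a / a ^ 2) v v' M.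
Proof.
  intros Hj Hc.
  destruct (hellmann_feynman_critical (lamM j) a (fun x => proj1 (lamM_spec j x Hj)) Hc)
    as [b [Hg H]].
  split; [exact (critical_alpha_pos _ _ _ H)|]. split; [exact (eigt_pos _ _ _ Hg)|].
  now apply (critical_state_of_eigt b).
Qed.

(** Multiplying the first energy bound by a^4 removes every negative power of a: L^2 / 9 <= 7/15 a^2
    L + 3/20 a. The estimate therefore does not degenerate as a tends to 0. *)
Lemma critical_lam_bound (j : nat) (a A : R) : (1 <= j)%nat -> A_crit j a -> 1 <= A -> a <= A ->
  lamM j a <= 5 * A ^ 2 + 2 * A + 1.
Proof.
  intros Hj Hc HA HaA.
  destruct (critical_point_state j a Hj Hc) as [Ha [Hl [v [v' [M CS]]]]].
  destruct (cs_energy_bounds _ _ _ _ _ CS) as [HB _].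
  set (L := lamM j a) in *.
  assert (Ha4 : 0 < a ^ 4) by now apply pow_lt.
  apply (Rmult_le_compat_r (a ^ 4)) in HB; [|lra].
  replace ((L / a ^ 2) ^ 2 / 9 * a ^ 4) with (L ^ 2 / 9) in HB by (field; lra).
  replace ((7 * (L / a ^ 2) / 15 + 3 / (20 * a ^ 3)) * a ^ 4) with
    (7 / 15 * a ^ 2 * L + 3 / 20 * a) in HB by (field; lra).
  assert (Ha2 : a ^ 2 <= A ^ 2) by (apply pow_incr; lra).
  apply Rnot_lt_le. intros N.
  assert (a ^ 2 * L <= A ^ 2 * L) by (apply Rmult_le_compat_r; lra).
  assert (HA2 : 1 <= A ^ 2) by nra.
  assert (L * (5 * A ^ 2 + 2 * A + 1) < L * L) by (apply Rmult_lt_compat_l; lra).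
  assert (A <= L * A) by nra.
  nra.
Qed.

Theorem theorem1p4 :
  (* the improper integral defining F converges on (1,+oo) *)
  (forall E, 1 < E ->
     ex_RInt_gen (F_integrand E) (at_point 0) (at_left (F_upper E))) /\
  (* F is C^1 on (1,+oo) *)
  (forall E, 1 < E -> ex_derive F_fun E /\ continuous (Derive F_fun) E) /\
  exists Ec : R,
    (1 < Ec /\ F_fun Ec = 0 /\ (forall E, 1 < E -> F_fun E = 0 -> E = Ec)) /\
    forall alpha : nat -> R,
      (forall j, (1 <= j)%nat -> A_crit j (alpha j)) ->
      is_lim_seq alpha p_infty /\
      is_lim_seq (fun j => lamM j (alpha j) / (alpha j) ^ 2) Ec.
Proof.
  split; [|split].
  - intros E HE. eexists. now apply F_is_RInt_gen.
  - exact F_fun_C1.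
  - destruct F_unique_zero as [Ec [H1 [H2 H3]]]. exists Ec. split; [now split; [|split]|].
    intros alpha Hcrit.
    (* A critical point at most A1 would bound lambda_j independently of j, against its growth. The
       conclusion 1 <= j is kept because [alpha 0] is unconstrained. *)
    assert (Hlarge : forall A, exists N : nat, forall j, (N <= j)%nat -> (1 <= j)%nat /\ A < alpha j).
    { intros A. set (A1 := Rmax 1 A). assert (L1 := Rmax_l 1 A). assert (L2 := Rmax_r 1 A).
      fold A1 in L1, L2.
      destruct (lamM_large A1 (5 * A1 ^ 2 + 2 * A1 + 1)) as [N HN]; [lra | nra|].
      exists (N + 1)%nat. intros j Hj. split; [lia|].
      apply (Rle_lt_trans _ A1); trivial. apply Rnot_le_lt. intros Hle.
      destruct (critical_point_state j (alpha j) ltac:(lia) (Hcrit j ltac:(lia))) as [Hp _].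
      assert (X := critical_lam_bound j (alpha j) A1 ltac:(lia) (Hcrit j ltac:(lia)) L1 Hle).
      assert (Y := HN j (alpha j) ltac:(lia) ltac:(rewrite Rabs_pos_eq; lra)). lra. }
    split.
    + apply is_lim_seq_spec. intros A. destruct (Hlarge A) as [N HN].
      exists N. intros j Hj. now apply HN.
    + apply is_lim_seq_spec. intros eps.
      (* One number d serves both as a radius around t and, through 1 / d, as a threshold for k. At
         t = Ec closeness is the conclusion itself; elsewhere critical states are excluded. *)
      assert (Hdelta : forall t, exists d : posreal, 6 / 5 <= t <= 5 ->
        forall k E v v' M, critical_state k E v v' M -> / d <= k -> Rabs (E - t) < d ->
          Rabs (E - Ec) < eps).
      { intros t. destruct (Req_dec t Ec) as [-> |Hne].
        - exists eps. now intros _ k E v v' M _ _.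
        - destruct (Rlt_dec 1 t) as [Ht|Ht]; [|exists eps; intros; lra].
          destruct (no_critical_near t Ht) as [d [Hd Hno]].
          { intros X. apply Hne. now apply H3. }
          exists (mkposreal d Hd). intros _ k E v v' M CS Hk HE.
          exfalso. now apply (Hno k E v v' M CS). }
      set (delta := fun t => proj1_sig (constructive_indefinite_description _ (Hdelta t))).
      assert (Hdel : forall t, 6 / 5 <= t <= 5 ->
        forall k E v v' M, critical_state k E v v' M -> / delta t <= k ->
          Rabs (E - t) < delta t -> Rabs (E - Ec) < eps).
      { intros t. exact (proj2_sig (constructive_indefinite_description _ (Hdelta t))). }
      (* Each E in [6/5, 5] is within delta t of some t with delta t >= d, so the single threshold 1
         / d for k suffices. The statement is doubly negated, hence [NNPP] below. *)
      destruct (compactness_value_1d (6 / 5) 5 delta) as [d Hd].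
      destruct (Hlarge (Rmax 10000 (/ d))) as [N HN].
      assert (L1 := Rmax_l 10000 (/ d)). assert (L2 := Rmax_r 10000 (/ d)).
      exists N. intros j Hj. destruct (HN j Hj) as [Hj1 Ha].
      destruct (critical_point_state j (alpha j) Hj1 (Hcrit j Hj1)) as [_ [_ [v [v' [M CS]]]]].
      set (a := alpha j) in *. set (E := lamM j a / a ^ 2) in *.
      assert (Ha3 : a <= a ^ 3).
      { assert (1 <= a ^ 2) by nra. replace (a ^ 3) with (a ^ 2 * a) by ring. nra. }
      destruct (cs_energy_bounds _ _ _ _ _ CS) as [HB1 HB2].
      specialize (HB2 ltac:(lra)).
      assert (HE5 : E <= 5).
      { assert (X : 3 / (20 * a ^ 3) <= / 1000) by (apply Rle_div_l; lra).
        apply Rnot_lt_le. intros N5. assert (5 * E < E ^ 2) by nra. lra. }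
      apply NNPP. intros Hn. apply (Hd E ltac:(lra)). intros [t [Ht [Ht1 Ht2]]].
      apply Hn. apply (Hdel t Ht (a ^ 3) E v v' M CS); trivial.
      assert (Pd := cond_pos d).
      apply (Rle_trans _ (/ d)); [apply Rinv_le_contravar|]; lra.
Qed.
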